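(* With the nozzle $\Omega$, the energy minimizer $\psi_N$ in the truncated nozzle $\Omega_N$, and the function $\tilde h_{0,N}$ as defined in the context: suppose $h_0(\bar x_1)<0$ for some $\bar x_1\in(-N,N)$. Then $\tilde h_{0,N}(\bar x_1)\ge0$ if one of the following conditions holds: (i) $h_1(x_1)=1-h_0(x_1)$ for $x_1\in\mathbb{R}$; (ii) $h_1(x_1)\equiv1$ for $x_1\in\mathbb{R}$.
   Context: Nozzle: $\Omega=\{(x_1,x_2): h_0(x_1)<x_2<h_1(x_1),\ x_1\in\mathbb{R}\}$, where $h_0,h_1\in C^{2,\alpha}(\mathbb{R})$ for some $\alpha\in(0,1)$, $h_1>h_0$ on $\mathbb{R}$, and there are constants $\underline{L}<0<\bar{L}$ and $0\le a<b\le 1$ such that $(h_0,h_1)=(0,1)$ for $x_1\le\underline{L}$ and $(h_0,h_1)=(a,b)$ for $x_1\ge\bar{L}$. Let $Q>0$. $\kappa:[0,Q]\to[0,1]$ is the inverse of the increasing bijection $t\mapsto Q(3t^2-2t^3)$ from $[0,1]$ to $[0,Q]$, $f(s)=6Q(1-2\kappa(s))$ on $[0,Q]$, and $F(t)=\int_0^t\hat f(s)\,ds$ for $t\in\mathbb{R}$, where $\hat f=f$ on $[0,Q]$ and $\hat f=0$ outside $[0,Q]$. For $d\in(0,1]$, $\bar\varphi_d\in C^2((0,d))\cap C^1([0,d])$ is the unique solution of $\psi''=f(\psi)$ on $(0,d)$, $\psi(0)=0$, $\psi(d)=Q$. For any given $N>0$ let $\Omega_N=\Omega\cap\{|x_1|<N\}$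 and let $g_N\in H^1(\Omega_N)$ have boundary values $g_N=0$ on $x_2=h_0(x_1)$, $g_N=Q$ on $x_2=h_1(x_1)$, and $g_N=\bar\varphi_{h_1(\pm N)-h_0(\pm N)}(x_2-h_0(\pm N))$ on $x_1=\pm N$, $x_2\in(h_0(\pm N),h_1(\pm N))$ (these lateral data are meaningful when the widths $h_1(\pm N)-h_0(\pm N)$ are at most $1$, the range in which $\bar\varphi_d$ is defined). $\psi_N$ is the (unique) minimizer of $\mathcal{E}_N(\psi)=\int_{\Omega_N}\frac{|\nabla\psi|^2}{2}+F(\psi)\,dx$ over $\mathcal{K}_N=\{\psi\in H^1(\Omega_N):\psi=g_N\text{ on }\partial\Omega_N\}$. For $x_1\in(-N,N)$, $$\tilde h_{0,N}(x_1)=\sup\{x_2\in[h_0(x_1),h_1(x_1)]:\psi_N(x_1,x_2)=0\}.$$ *)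

(* Defs.v *)
From HB Require Import structures.
From mathcomp Require Import all_boot all_order all_algebra.
From mathcomp Require Import all_classical all_reals all_analysis.

Set Implicit Arguments.
Unset Strict Implicit.
Unset Printing Implicit Defensive.

Import Order.TTheory GRing.Theory Num.Theory.
Import numFieldNormedType.Exports.

Local Open Scope classical_set_scope.
Local Open Scope ring_scope.

Section Nozzle.
Context {R : realType}.
Implicit Types (h : R -> R) (x : R * R).

(* For functions that are constant near -oo and near +oo, as the walls of a
   nozzle are, local and global Hoelder continuity of h'' coincide and the sup
   norms of h, h', h'' are finite. *)
Definition C2holder (alpha : R) h : Prop :=
  [/\ forall t : R, derivable h t 1,
      forall t : R, derivable (derive1 h) t 1 &
      exists C : R, forall s t,
        `| derive1 (derive1 h) s - derive1 (derive1 h) t |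
          <= C * `| s - t | `^ alpha].

Definition is_nozzle (alpha Lm Lp a b : R) (h0 h1 : R -> R) : Prop :=
  [/\ 0 < alpha < 1 /\ Lm < 0 < Lp,
      [/\ 0 <= a, a < b & b <= 1],
      C2holder alpha h0 /\ C2holder alpha h1,
      forall t, h0 t < h1 t &
      (forall t, t <= Lm -> h0 t = 0 /\ h1 t = 1) /\
      (forall t, Lp <= t -> h0 t = a /\ h1 t = b)].

Definition nozzle (h0 h1 : R -> R) : set (R * R) :=
  [set x | h0 x.1 < x.2 < h1 x.1].

Definition trunc_nozzle (h0 h1 : R -> R) (N : R) : set (R * R) :=
  nozzle h0 h1 `&` [set x | `| x.1 | < N].

End Nozzle.

Section Nonlinearity.
Context {R : realType}.
Variable Q : R.

Definition poiseuille (t : R) : R := Q * (3 * t ^+ 2 - 2 * t ^+ 3).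

Definition kappa (s : R) : R := 'pinv_(fun=> 0) `[0, 1] poiseuille s.

Definition f (s : R) : R := 6 * Q * (1 - 2 * kappa s).

Definition fhat (s : R) : R := if 0 <= s <= Q then f s else 0.

Definition F (t : R) : R :=
  if 0 <= t then \int[lebesgue_measure]_(s in `[0, t]) fhat s
  else - (\int[lebesgue_measure]_(s in `[t, 0]) fhat s).

(* The range condition is part of the equation: f is only defined on [0, Q].
   The function phi1 is the continuous extension of phi' to [0, d]. *)
Definition is_phibar (d : R) (phi : R -> R) : Prop :=
  [/\ forall y : R, 0 <= y <= d -> 0 <= phi y <= Q,
      {within `[0, d], continuous phi} /\
      (exists phi1 : R -> R, {within `[0, d], continuous phi1} /\
         forall y : R, 0 < y < d -> is_derive y 1 phi (phi1 y)),
      forall y : R, 0 < y < d ->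
        derivable (derive1 phi) y 1 /\ {for y, continuous (derive1 (derive1 phi))},
      forall y : R, 0 < y < d -> derive1 (derive1 phi) y = f (phi y) &
      phi 0 = 0 /\ phi d = Q].

End Nonlinearity.

Section Sobolev.
Context {R : realType}.
Implicit Types (D : set (R * R)) (u v : R * R -> R) (G : R * R -> R * R).

Local Notation leb2 := (@lebesgue_measure R \x @lebesgue_measure R)%E.

Definition dx1 u : R * R -> R := fun x => 'D_((1, 0) : R * R) u x.
Definition dx2 u : R * R -> R := fun x => 'D_((0, 1) : R * R) u x.

Fixpoint Ck (k : nat) u : Prop :=
  if k is k'.+1 then
    [/\ continuous u,
        forall x, derivable u x ((1, 0) : R * R) /\
                  derivable u x ((0, 1) : R * R),
        Ck k' (dx1 u) & Ck k' (dx2 u)]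
  else continuous u.

Definition test_fun D u : Prop :=
  [/\ forall k, Ck k u,
      compact (closure [set x | u x != 0]) &
      closure [set x | u x != 0] `<=` D].

Definition L2 D u : Prop :=
  @measurable_fun _ _ (measurableTypeR R * measurableTypeR R)%type
    (measurableTypeR R) D u /\
  (\int[leb2]_(x in D) ((u x) ^+ 2)%:E < +oo)%E.

Definition weak_gradient D u G : Prop :=
  [/\ L2 D u, L2 D (fun x => (G x).1), L2 D (fun x => (G x).2) &
      forall phi, test_fun D phi ->
        (\int[leb2]_(x in D) (u x * dx1 phi x)) =
          - (\int[leb2]_(x in D) ((G x).1 * phi x)) /\
        (\int[leb2]_(x in D) (u x * dx2 phi x)) =
          - (\int[leb2]_(x in D) ((G x).2 * phi x))].

Definition H1 D u : Prop := exists G, weak_gradient D u G.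

Definition H1_dist2 D u G v : \bar R :=
  (\int[leb2]_(x in D)
     ((v x - u x) ^+ 2 +
      (dx1 v x - (G x).1) ^+ 2 + (dx2 v x - (G x).2) ^+ 2)%:E)%E.

End Sobolev.

Section Minimization.
Context {R : realType}.
Variables (h0 h1 : R -> R) (N : R).
Implicit Types (u b g psi w : R * R -> R) (G : R * R -> R * R).
Local Notation mu1 := (@lebesgue_measure R).
Local Notation leb2 := (@lebesgue_measure R \x @lebesgue_measure R)%E.
Local Notation Omega_N := (trunc_nozzle h0 h1 N).

(* The squared L^2 norm on the boundary of Omega_N.  The two walls are
   parametrized by the first coordinate; as h0' and h1' are bounded this gives
   the same topology as arc length. *)
Definition bdry_norm2 (w : R * R -> R) : \bar R :=
  ((\int[mu1]_(t in `](- N)%R, N[) ((w (t, h0 t)) ^+ 2)%:E) +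
   (\int[mu1]_(t in `](- N)%R, N[) ((w (t, h1 t)) ^+ 2)%:E) +
   (\int[mu1]_(t in `]h0 (- N)%R, h1 (- N)%R[) ((w ((- N)%R, t)) ^+ 2)%:E) +
   (\int[mu1]_(t in `]h0 N, h1 N[) ((w (N, t)) ^+ 2)%:E))%E.

(* The trace operator on the Lipschitz domain Omega_N is the continuous
   extension to H^1 of the restriction of C^1 functions to the boundary. *)
Definition has_trace u b : Prop :=
  exists (G : R * R -> R * R) (v : nat -> R * R -> R),
    [/\ weak_gradient Omega_N u G,
        forall n, Ck 1 (v n),
        H1_dist2 Omega_N u G (v n) @[n --> \oo] --> 0%E &
        bdry_norm2 (fun x => v n x - b x) @[n --> \oo] --> 0%E].

(* Only the values on the boundary of Omega_N matter: the last case is used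
   at x.1 = N and x.1 = - N. *)
Definition boundary_data (Q : R) (phibar : R -> R -> R) (x : R * R) : R :=
  if x.2 == h0 x.1 then 0
  else if x.2 == h1 x.1 then Q
  else phibar (h1 x.1 - h0 x.1) (x.2 - h0 x.1).

Definition admissible g : set (R * R -> R) :=
  [set psi | H1 Omega_N psi /\ has_trace (fun x => psi x - g x) (fun=> 0)].

Definition energy (Q : R) psi G : \bar R :=
  (\int[leb2]_(x in Omega_N)
     (((G x).1 ^+ 2 + (G x).2 ^+ 2) / 2 + F Q (psi x))%:E)%E.

(* Weak gradients are unique almost everywhere, so the energy depends only on
   psi. *)
Definition is_minimizer (Q : R) g psi : Prop :=
  admissible g psi /\
  forall w Gpsi Gw, admissible g w ->
    weak_gradient Omega_N psi Gpsi -> weak_gradient Omega_N w Gw ->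
    (energy Q psi Gpsi <= energy Q w Gw)%E.

(* The minimizer is a class of functions modulo null sets; psi is the
   representative that is continuous up to both walls, which is the one whose
   pointwise values enter in htilde0. *)
Definition is_the_minimizer (Q : R) g psi : Prop :=
  [/\ is_minimizer Q g psi,
      forall w, is_minimizer Q g w ->
        {ae leb2, forall x, Omega_N x -> w x = psi x} &
      {within [set x : R * R | `| x.1 | < N /\ h0 x.1 <= x.2 <= h1 x.1],
        continuous psi}].

(* The supremum is extended-real so that it would be -oo, rather than the
   default value 0 of the real-valued sup, if the set were empty. *)
Definition htilde0 psi (x1 : R) : \bar R :=
  ereal_sup [set x2%:E | x2 in
    [set y : R | h0 x1 <= y <= h1 x1 /\ psi (x1, y) = 0]].

End Minimization.

(* Main.v *)
(* Let [b(t) = Q (3 t^2 - 2 t^3)] for [t >= 0] and [b(t) = 0] for [t <= 0]: the Poiseuille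
   profile of the strip of width 1, extended by zero. With [g = sqrt (2 F)] it satisfies
   [b' = g(b)], so [b] is calibrated: [|grad psi|^2 / 2 + F(psi) >= g(psi) psi_2], with
   equality for [psi = b(x2)]. Put [T = 1] in case (ii) and [T = 1/2] in case (i). Replacing
   the minimizer [psi] by [b] where [psi > b(x2)] and [x2 < T], and by 0 where [psi < 0],
   gives an admissible function: on the lateral boundary this is the comparison
   [phibar <= b], and in case (i) uniqueness of the minimizer yields
   [psi(x1, 1 - x2) = Q - psi(x1, x2)], hence [psi = Q/2 = b] on [x2 = 1/2]. The energy does
   not increase, since with [Phi' = g] the function [pos (Phi psi - Phi b)] vanishes on the
   lower wall, so that the integral of its vertical derivative is nonnegative. By uniqueness
   the new function is [psi], whence [0 <= psi <= b(x2)] for [x2 < T], and [psi = 0] for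
   [x2 < 0]. *)

Require Import Defs.
From mathcomp Require Import all_boot all_order all_algebra.
From mathcomp Require Import all_classical all_reals all_analysis.
From mathcomp Require Import measurable_realfun ring lra.
Import Order.TTheory GRing.Theory Num.Theory.
Import numFieldNormedType.Exports.
Local Open Scope classical_set_scope.
Local Open Scope ring_scope.

Set Implicit Arguments.
Unset Strict Implicit.
Unset Printing Implicit Defensive.

(** * Smoothed positive parts and antiderivatives *)

(** On [[0, Q]] the function [f] is decreasing, so [F] is concave there, the energy is not convex
    and no comparison principle for the equation is at hand; minimality and uniqueness take its
    place. The calibration costs only the lower wall: at the upper end of each vertical segment
    [pos (Phi psi - Phi b)] enters with the favourable sign. The height 1/2 in case (i) is dictated
    by the lateral data: aligned at the midpoints, a narrower profile lies below the Poiseuille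
    profile in its lower half and, by symmetry, above it in the upper half. Elements of H^1 and
    their traces are accessible only through C^1 functions converging in H^1 and on the boundary.
    Truncations are therefore performed on the approximants, with [spos] in the role of the positive
    part, and carried to the limit in L^2. The function [g] is only Hoelder continuous of exponent
    1/2, which is why the limit lemma for products, [mul_limit], asks for a modulus of continuity
    weaker than a Lipschitz bound. *)

Section OneVariable.
Context {R : realType}.
Implicit Types (f : R -> R) (x t e : R).

Lemma is_derive_cvg f x (l : R) :
  h^-1 * (f (h + x) - f x) @[h --> 0^'] --> l -> is_derive x (1 : R) f l.
Proof.
move=> H.
have H' : (fun h : R => h^-1 *: ((f \o shift x) (h *: (1 : R)) - f x)) @ 0^' --> l.
  apply: cvg_trans H; apply: near_eq_cvg; near=> h => /=.
  by rewrite /GRing.scale /= mulr1.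
split; first exact: cvgP H'.
by apply: cvg_lim.
Unshelve. all: by end_near. Qed.

(** Meant for functions glued at a point, such as [pos t ^+ 2] and [flat]: a quadratic bound on the
    remainder settles differentiability there without one-sided limits. *)
Lemma is_derive_quad f x (l C : R) :
  (forall h, `|h| <= 1 -> `|f (h + x) - f x - h * l| <= C * h ^+ 2) ->
  is_derive x (1 : R) f l.
Proof.
move=> H; apply: is_derive_cvg.
have C0 : 0 <= C.
  have /H : `|1 : R| <= 1 by rewrite normr1.
  by rewrite expr1n mulr1; apply: le_trans.
apply/cvgrPdist_lt => e e0; near=> h.
have h0 : h != 0 by near: h; exact: nbhs_dnbhs_neq.
have hs : `|h| < e / (C + 1).
  near: h; apply: dnbhs0_lt; rewrite divr_gt0//; lra.
have h1 : `|h| <= 1 by near: h; apply: dnbhs0_le.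
rewrite distrC.
have -> : h^-1 * (f (h + x) - f x) - l = h^-1 * (f (h + x) - f x - h * l).
  by field.
rewrite normrM normfV.
have /le_lt_trans : `|h|^-1 * `|f (h + x) - f x - h * l| <= C * `|h|.
  rewrite mulrC ler_pdivrMr ?normr_gt0// -mulrA -expr2 real_normK ?num_real//.
  exact: H.
apply.
have : C * `|h| <= (C + 1) * `|h| by rewrite ler_wpM2r// lerDl.
move/le_lt_trans; apply.
by rewrite mulrC -ltr_pdivlMr// ltr_pwDr.
Unshelve. all: by end_near. Qed.

Definition pos t : R := Num.max t 0.

Lemma pos_ge0 t : 0 <= pos t. Proof. by rewrite le_max lexx orbT. Qed.
Lemma pos_id t : 0 <= t -> pos t = t. Proof. by move=> t0; apply/max_idPl. Qed.
Lemma pos0 t : t <= 0 -> pos t = 0. Proof. by move=> t0; apply/max_idPr. Qed.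
Lemma pos_case t : (0 <= t /\ pos t = t) \/ (t <= 0 /\ pos t = 0).
Proof.
by case: (leP 0 t) => t0; [left; rewrite pos_id|right; rewrite pos0 ?ltW].
Qed.

Lemma pos_lip s t : `|pos s - pos t| <= `|s - t|.
Proof.
have := ler_norm (s - t); have := ler_norm (t - s); rewrite -normrN opprB.
by case: (pos_case s) => -[s0 ->]; case: (pos_case t) => -[t0 ->] ? ?;
  rewrite ler_norml; lra.
Qed.

Lemma continuous_lip f (C : R) :
  (forall s t, `|f s - f t| <= C * `|s - t|) -> continuous f.
Proof.
move=> H x; apply/cvgrPdist_lt => e e0.
have C0 : 0 <= C.
  by have := H 1 0; rewrite subr0 normr1 mulr1; apply: le_trans.
near=> y; apply: le_lt_trans (H _ _) _.
have : `|x - y| < e / (C + 1).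
  near: y; apply: cvgr_dist_lt => //; rewrite divr_gt0//; lra.
rewrite ltr_pdivlMr; last lra.
by apply: le_lt_trans; rewrite mulrC ler_wpM2l// lerDl.
Unshelve. all: by end_near. Qed.

Lemma continuous_pos : continuous pos.
Proof. by apply: (@continuous_lip _ 1) => s t; rewrite mul1r pos_lip. Qed.

Lemma is_derive_pos2 x : is_derive x (1 : R) (fun t => pos t ^+ 2) (2 * pos x).
Proof.
apply: (@is_derive_quad _ _ _ 1) => h _; rewrite mul1r ler_norml.
case: (pos_case x) => -[x0 ->]; case: (pos_case (h + x)) => -[hx0 ->];
  by apply/andP; split; nra.
Qed.

Lemma pos3E t : pos t ^+ 3 = pos t ^+ 2 * t.
Proof. by case: (pos_case t) => -[t0 ->]; rewrite ?expr0n ?mul0r// exprSr. Qed.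

Lemma is_derive_pos3 x :
  is_derive x (1 : R) (fun t => pos t ^+ 3) (3 * pos x ^+ 2).
Proof.
have -> : (fun t => pos t ^+ 3) = (fun t => pos t ^+ 2 * t).
  by apply/funext => t; rewrite pos3E.
apply: is_derive_eq (is_deriveM (is_derive_pos2 x) (is_derive_id x (1 : R))) _; rewrite /GRing.scale /= mulr1.
by case: (pos_case x) => -[x0 ->]; ring.
Qed.

(* A C^1 approximation of [pos] that vanishes near [t <= 0]. *)
Definition spos e t := (pos (t - e) ^+ 2 - pos (t - 2 * e) ^+ 2) / (2 * e).
(** A ramp from 0 at [e] to 1 at [2 * e]. Its Lipschitz constant grows like [1 / e], so [e] has to
    be fixed before the quality of an approximant. *)
Definition spos' e t := (pos (t - e) - pos (t - 2 * e)) / e.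

Lemma is_derive_spos e x : 0 < e -> is_derive x (1 : R) (spos e) (spos' e x).
Proof.
move=> e0.
have D c : is_derive x (1 : R) (fun t => pos (t - c) ^+ 2) (2 * pos (x - c)).
  have H := @is_derive1_comp _ (fun t => pos t ^+ 2) (fun t => t - c) x _ _
     (is_derive_pos2 (x - c)) (is_deriveB (is_derive_id x (1:R)) (is_derive_cst c x (1 : R))).
  by apply: is_derive_eq H _; rewrite subr0 mulr1.
apply: is_derive_eq (is_deriveM (is_deriveB (D e) (D (2 * e))) (is_derive_cst ((2 * e)^-1) x (1 : R))) _; rewrite /GRing.scale /= /spos' mulr0 add0r.
by field; rewrite gt_eqF.
Qed.

Lemma spos'_lip e s t : 0 < e -> `|spos' e s - spos' e t| <= (2 / e) * `|s - t|.
Proof.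
move=> e0.
rewrite /spos' -mulrBl normrM normfV (gtr0_norm e0) mulrAC ler_pM2r ?invr_gt0//.
have H c : `|pos (s - c) - pos (t - c)| <= `|s - t|.
  by apply: le_trans (pos_lip _ _) _; rewrite (_ : s - c - (t - c) = s - t)//; ring.
apply: le_trans (_ : `|pos (s - e) - pos (t - e)| +
  `|pos (s - 2 * e) - pos (t - 2 * e)| <= _); last first.
  have := H e; have := H (2 * e); lra.
apply: le_trans (ler_normB _ _).
by rewrite le_eqVlt; apply/orP; left; apply/eqP; congr `|_|; ring.
Qed.

Lemma continuous_spos' e : 0 < e -> continuous (spos' e).
Proof. by move=> e0; exact: continuous_lip (fun s t => spos'_lip s t e0). Qed.

Lemma spos'_ge0 (e t : R) : 0 < e -> 0 <= spos' e t.
Proof.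
move=> e0.
rewrite divr_ge0// ?(ltW e0)//.
case: (pos_case (t - e)) => -[x0 ->]; case: (pos_case (t - 2 * e)) => -[hx0 ->]; lra.
Qed.

Lemma spos'_le1 (e t : R) : 0 < e -> spos' e t <= 1.
Proof.
move=> e0.
rewrite ler_pdivrMr// mul1r.
case: (pos_case (t - e)) => -[x0 ->]; case: (pos_case (t - 2 * e)) => -[hx0 ->]; lra.
Qed.

Lemma spos'_eq0 (e t : R) : 0 < e -> t <= e -> spos' e t = 0.
Proof. by move=> e0 te; rewrite /spos' !pos0 ?subrr ?mul0r//; lra. Qed.

Lemma spos'_eq1 (e t : R) : 0 < e -> 2 * e <= t -> spos' e t = 1.
Proof.
move=> e0 te; rewrite /spos' !pos_id; try lra.
by field; rewrite gt_eqF.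
Qed.

Lemma spos_eq0 (e t : R) : 0 < e -> t <= e -> spos e t = 0.
Proof. by move=> e0 te; rewrite /spos !pos0 ?subrr ?mul0r//; lra. Qed.

Lemma spos_ge0 (e t : R) : 0 < e -> 0 <= spos e t.
Proof.
move=> e0.
rewrite divr_ge0//; last lra.
by case: (pos_case (t - e)) => -[x0 ->]; case: (pos_case (t - 2 * e)) => -[hx0 ->]; nra.
Qed.

Lemma spos_le (e t : R) : 0 < e -> spos e t <= pos t.
Proof.
move=> e0.
rewrite ler_pdivrMr; last lra.
by case: (pos_case t) => -[t0 ->]; case: (pos_case (t - e)) => -[x0 ->];
  case: (pos_case (t - 2 * e)) => -[hx0 ->]; nra.
Qed.

Lemma spos_ge (e t : R) : 0 < e -> pos t - 2 * e <= spos e t.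
Proof.
move=> e0.
rewrite ler_pdivlMr; last lra.
by case: (pos_case t) => -[t0 ->]; case: (pos_case (t - e)) => -[x0 ->];
  case: (pos_case (t - 2 * e)) => -[hx0 ->]; nra.
Qed.

(** Integration starts at -1 so that 0 is an interior point: the profiles take the value 0, and a
    two-sided derivative is wanted there. *)
Lemma antiderivative f : continuous f ->
  exists A, [/\ forall x, -1 < x -> is_derive x (1 : R) A (f x), A 0 = 0 &
   forall x, 0 <= x -> A x = \int[lebesgue_measure]_(s in `[0, x]) f s].
Proof.
move=> cf.
have If (a b : R) : lebesgue_measure.-integrable `[a, b] (EFin \o f).
  apply: continuous_compact_integrable; first exact: segment_compact.
  exact: continuous_subspaceT.
pose B x := \int[lebesgue_measure]_(s in `[-1, x]) f s.
exists (fun x => B x - B 0); split.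
- move=> x x1.
  have [d1 d2] := @continuous_FTC1_closed R f (-1) x (x + 1) ltac:(lra) (If _ _) x1 (cf x).
  have : is_derive x (1 : R) B (f x).
    by split; [exact: d1|rewrite -d2 derive1E].
  move=> H; apply: is_derive_eq (is_deriveB H (is_derive_cst (B 0) x (1 : R))) _.
  by rewrite subr0.
- by rewrite subrr.
- move=> x x0; rewrite /B.
  rewrite (@Rintegral_itvB _ f (BLeft (-1)) (BRight x) 0) ?bnd_simp//.
  by rewrite Rintegral_itv_obnd_cbnd//; apply: integrableS (If 0 x) => //; exact: subset_itv_oc_cc.
Qed.

End OneVariable.

(** * The nonlinearity and the Poiseuille profile *)

Section Mean.
Context {R : realType}.
Implicit Types (f df : R -> R) (a b m : R).

Lemma mean_value_ge f df a b m : a <= b ->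
  (forall x, a < x < b -> is_derive x (1 : R) f (df x)) ->
  {within `[a, b], continuous f} ->
  (forall x, a < x < b -> m <= df x) -> m * (b - a) <= f b - f a.
Proof.
rewrite le_eqVlt => /predU1P[-> _ _ _|ab H cf m_le]; first by rewrite !subrr mulr0.
have [c + ->] := MVT ab (fun x xab => H x ltac:(by rewrite in_itv in xab)) cf.
by rewrite in_itv/= => /m_le; apply: ler_wpM2r; rewrite subr_ge0 ltW.
Qed.

Lemma mean_value_le f df a b m : a <= b ->
  (forall x, a < x < b -> is_derive x (1 : R) f (df x)) ->
  {within `[a, b], continuous f} ->
  (forall x, a < x < b -> df x <= m) -> f b - f a <= m * (b - a).
Proof.
rewrite le_eqVlt => /predU1P[-> _ _ _|ab H cf m_le]; first by rewrite !subrr mulr0.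
have [c + ->] := MVT ab (fun x xab => H x ltac:(by rewrite in_itv in xab)) cf.
by rewrite in_itv/= => /m_le; apply: ler_wpM2r; rewrite subr_ge0 ltW.
Qed.

Lemma is_derive_continuous f x d : is_derive x (1 : R) f d -> {for x, continuous f}.
Proof. by move=> H; apply/differentiable_continuous/derivable1_diffP. Qed.

End Mean.

Section Potential.
Context {R : realType}.
Variable Q : R.
Implicit Types (s t a b : R).
Local Notation P := (poiseuille Q).

Lemma poiseuille0 : P 0 = 0. Proof. by rewrite /poiseuille !expr0n/= !mulr0 subrr mulr0. Qed.
Lemma poiseuille1 : P 1 = Q. Proof. by rewrite /poiseuille !expr1n; ring. Qed.

Lemma is_derive_poiseuille t : is_derive t (1 : R) P (6 * Q * (t * (1 - t))).
Proof.
rewrite (_ : P = (fun t => Q * (3 * t ^+ 2 - 2 * t ^+ 3))); last by apply/funext.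
apply: is_derive_eq; rewrite /GRing.scale /=; ring.
Qed.

Lemma continuous_poiseuille : continuous P.
Proof. by move=> t; apply: is_derive_continuous (is_derive_poiseuille t). Qed.

(** The order 2 is the best possible, since the slope of [P] vanishes at 0 and 1. Read for the
    inverse function, this bound is the Hoelder continuity of [kap] with exponent 1/2. *)
Lemma poiseuille_gap a b : 0 < Q -> 0 <= a -> a <= b -> b <= 1 ->
  Q * (b - a) ^+ 2 <= P b - P a.
Proof.
move=> Q0 a0 ab b1; rewrite /poiseuille -mulrBr ler_pM2l// -subr_ge0.
rewrite (_ : _ - _ = 2 * (b - a) * (a * (1 - a) + b * (1 - b) + a * (1 - b))); last by ring.
by apply: mulr_ge0; [lra|rewrite !addr_ge0// mulr_ge0//; lra].
Qed.

Lemma poiseuille_bound t : 0 < Q -> 0 <= t <= 1 -> 0 <= P t <= Q.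
Proof.
move=> Q0 /andP[t0 t1].
have := poiseuille_gap Q0 (lexx 0) t0 t1; have := poiseuille_gap Q0 t0 t1 (lexx 1).
rewrite poiseuille0 poiseuille1.
have : 0 <= Q * (1 - t) ^+ 2 by rewrite mulr_ge0 ?sqr_ge0 ?ltW.
have : 0 <= Q * (t - 0) ^+ 2 by rewrite mulr_ge0 ?sqr_ge0 ?ltW.
lra.
Qed.

Lemma poiseuille_mono a b : 0 < Q -> 0 <= a -> a <= b -> b <= 1 -> P a <= P b.
Proof.
move=> Q0 a0 ab b1; rewrite -subr_ge0; apply: le_trans (poiseuille_gap Q0 a0 ab b1).
by rewrite mulr_ge0 ?sqr_ge0 ?ltW.
Qed.

Lemma poiseuille_mono_lt a b : 0 < Q -> 0 <= a -> a < b -> b <= 1 -> P a < P b.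
Proof.
move=> Q0 a0 ab b1; rewrite -subr_gt0; apply: lt_le_trans (poiseuille_gap Q0 a0 (ltW ab) b1).
by rewrite mulr_gt0// exprn_gt0// subr_gt0.
Qed.

Lemma poiseuille_sym t : P (1 - t) = Q - P t.
Proof. by rewrite /poiseuille; ring. Qed.

Lemma kappaK t : 0 < Q -> 0 <= t <= 1 -> kappa Q (P t) = t.
Proof.
move=> Q0 t01; apply: pinvKV; last by rewrite inE /= in_itv.
move=> u v; rewrite !inE /= !in_itv /= => /andP[u0 u1] /andP[v0 v1] uv.
by case: (ltgtP u v) => // h; [have := poiseuille_mono_lt Q0 u0 h v1|have := poiseuille_mono_lt Q0 v0 h u1];
  rewrite uv ltxx.
Qed.

Lemma poiseuille_onto s : 0 < Q -> 0 <= s <= Q -> exists2 t, 0 <= t <= 1 & P t = s.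
Proof.
move=> Q0 s0Q.
have := @IVT R P 0 1 s ler01 (continuous_subspaceT continuous_poiseuille).
rewrite poiseuille0 poiseuille1 min_l ?max_r ?(ltW Q0)// => /(_ s0Q) [t].
by rewrite in_itv /= => t01 <-; exists t.
Qed.

Definition clamp s := Num.max 0 (Num.min s Q).

Lemma clamp_case s : 0 < Q ->
  [\/ s <= 0 /\ clamp s = 0, 0 <= s <= Q /\ clamp s = s | Q <= s /\ clamp s = Q].
Proof.
move=> Q0; rewrite /clamp; case: (leP s Q) => sQ; case: (leP 0 s) => s0.
- by apply: Or32.
- by apply: Or31; rewrite ltW.
- by apply: Or33; rewrite ltW//; split => //; apply/max_idPr/ltW.
- by exfalso; lra.
Qed.

Lemma clamp_id s : 0 <= s <= Q -> clamp s = s.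
Proof. by move=> /andP[s0 sQ]; rewrite /clamp min_l// max_r. Qed.

Lemma clamp_bound s : 0 < Q -> 0 <= clamp s <= Q.
Proof. by move=> Q0; case: (clamp_case s Q0) => -[h ->]; lra. Qed.

Lemma clamp_lip s t : 0 < Q -> `|clamp s - clamp t| <= `|s - t|.
Proof.
move=> Q0; have := ler_norm (s - t); have := ler_norm (t - s).
rewrite -normrN opprB ler_norml.
by case: (clamp_case s Q0) => -[h ->]; case: (clamp_case t Q0) => -[h' ->]; lra.
Qed.

(** Constant extension of [kappa], which is meaningful only on [[0, Q]], to the whole line;
    approximants of the minimizer may leave [[0, Q]]. *)
Definition kap s := kappa Q (clamp s).

Lemma kapP s : 0 < Q -> 0 <= kap s <= 1 /\ P (kap s) = clamp s.
Proof.
move=> Q0; have [t t01 e] := poiseuille_onto Q0 (clamp_bound s Q0).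
by rewrite /kap -e kappaK.
Qed.

Lemma kap_poiseuille t : 0 < Q -> 0 <= t <= 1 -> kap (P t) = t.
Proof. by move=> Q0 t01; rewrite /kap clamp_id ?kappaK// poiseuille_bound. Qed.

Lemma kap_le0 s : 0 < Q -> s <= 0 -> kap s = 0.
Proof.
move=> Q0 s0; have k0 : kappa Q 0 = 0.
  by rewrite -[X in kappa Q X]poiseuille0 kappaK// lexx ler01.
rewrite /kap; case: (clamp_case s Q0) => -[h ->] //.
- by rewrite (_ : s = 0)//; lra.
- by exfalso; lra.
Qed.

Lemma kap_geQ s : 0 < Q -> Q <= s -> kap s = 1.
Proof.
move=> Q0 s0; have k1 : kappa Q Q = 1.
  by rewrite -[X in kappa Q X]poiseuille1 kappaK// lexx ler01.
rewrite /kap; case: (clamp_case s Q0) => -[h ->] //.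
- by exfalso; lra.
- by rewrite (_ : s = Q)//; lra.
Qed.

Lemma kap_holder s t : 0 < Q -> (kap s - kap t) ^+ 2 <= Q^-1 * `|s - t|.
Proof.
move=> Q0; rewrite ler_pdivlMl//.
apply: le_trans _ (clamp_lip _ _ Q0).
have [/andP[a0 a1] <-] := kapP s Q0; have [/andP[b0 b1] <-] := kapP t Q0.
wlog ab : s t a0 a1 b0 b1 / kap t <= kap s.
  move=> W; case: (leP (kap t) (kap s)) => h; first exact: W.
  by rewrite -sqrrN opprB -normrN opprB; apply: W => //; apply: ltW.
apply: le_trans (poiseuille_gap Q0 b0 ab a1) (ler_norm _).
Qed.

Lemma continuous_kap : 0 < Q -> continuous kap.
Proof.
move=> Q0 x; apply/cvgrPdist_lt => e e0; near=> y.
rewrite -(@ltr_pXn2r _ 2)// ?nnegrE ?(ltW e0)// real_normK ?num_real//.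
apply: le_lt_trans (kap_holder _ _ Q0) _; rewrite ltr_pdivrMl//.
by near: y; apply: cvgr_dist_lt => //; rewrite mulr_gt0// exprn_gt0.
Unshelve. all: by end_near. Qed.

(* [gF] is [sqrt (2 F)]; for the Poiseuille profile [P], [P' = gF P]. *)
Definition gF s := 6 * Q * (kap s * (1 - kap s)).

Lemma gF_ge0 s : 0 < Q -> 0 <= gF s.
Proof.
move=> Q0; have [/andP[a0 a1] _] := kapP s Q0.
by rewrite !mulr_ge0//; lra.
Qed.

Lemma gF_le s : 0 < Q -> gF s <= 6 * Q.
Proof.
move=> Q0; have [/andP[a0 a1] _] := kapP s Q0.
rewrite /gF -[leRHS]mulr1; apply: ler_wpM2l; first lra.
nra.
Qed.

Lemma gF_gt0 s : 0 < Q -> 0 < s < Q -> 0 < gF s.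
Proof.
move=> Q0 /andP[s0 sQ]; have [/andP[a0 a1] e] := kapP s Q0.
rewrite clamp_id in e; last by rewrite !ltW.
have k0 : 0 < kap s.
  by rewrite lt0r a0 andbT; apply: contraTneq s0 => k; rewrite -e k poiseuille0 ltxx.
have k1 : kap s < 1.
  by rewrite lt_neqAle a1 andbT; apply: contraTneq sQ => k; rewrite -e k poiseuille1 ltxx.
by rewrite !mulr_gt0//; lra.
Qed.

Lemma continuous_gF : 0 < Q -> continuous gF.
Proof.
move=> Q0 x; rewrite /gF; have c := @continuous_kap Q0 x.
by apply: cvgM; [exact: cvg_cst|apply: cvgM => //; apply: cvgB => //; exact: cvg_cst].
Qed.

Lemma gF_le0 s : 0 < Q -> s <= 0 -> gF s = 0.
Proof. by move=> Q0 s0; rewrite /gF kap_le0//; ring. Qed.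

Lemma gF_geQ s : 0 < Q -> Q <= s -> gF s = 0.
Proof. by move=> Q0 s0; rewrite /gF kap_geQ//; ring. Qed.

Lemma gF_holder s t : 0 < Q -> (gF s - gF t) ^+ 2 <= 36 * Q * `|s - t|.
Proof.
move=> Q0; have [/andP[a0 a1] _] := kapP s Q0; have [/andP[b0 b1] _] := kapP t Q0.
have H := kap_holder s t Q0.
have -> : 36 * Q * `|s - t| = (6 * Q) ^+ 2 * (Q^-1 * `|s - t|).
  by field; rewrite gt_eqF.
rewrite /gF -mulrBr exprMn; apply: ler_wpM2l; first exact: sqr_ge0.
apply: le_trans H.
rewrite (_ : _ - _ = (kap s - kap t) * (1 - kap s - kap t)); last by ring.
rewrite exprMn -[leRHS]mulr1; apply: ler_wpM2l; first exact: sqr_ge0.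
nra.
Qed.

Lemma gF_poiseuille t : 0 < Q -> 0 <= t <= 1 -> gF (P t) = 6 * Q * (t * (1 - t)).
Proof. by move=> Q0 t01; rewrite /gF kap_poiseuille. Qed.

Lemma gF_sym s : 0 < Q -> gF (Q - s) = gF s.
Proof.
move=> Q0.
suff e : kap (Q - s) = 1 - kap s by rewrite /gF e; ring.
have [k01 e] := kapP s Q0.
rewrite -[RHS](kap_poiseuille Q0); last lra.
rewrite poiseuille_sym e /kap; congr kappa.
rewrite [RHS]clamp_id; last by have := clamp_bound s Q0; lra.
by case: (clamp_case s Q0) => -[h ->]; case: (clamp_case (Q - s) Q0) => -[h' ->]; lra.
Qed.

(** Unlike [fhat], which jumps to 0 outside [[0, Q]], this extension of [f] is continuous and hence
    has differentiable primitives. *)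
Definition fc s := 6 * Q * (1 - 2 * kap s).

Lemma continuous_fc : 0 < Q -> continuous fc.
Proof.
move=> Q0 x; rewrite /fc; have c := @continuous_kap Q0 x.
apply: cvgM; first exact: cvg_cst.
by apply: cvgB; [exact: cvg_cst|apply: cvgM => //; exact: cvg_cst].
Qed.

Lemma fcE s : 0 <= s <= Q -> f Q s = fc s.
Proof. by move=> h; rewrite /f /fc /kap clamp_id. Qed.

Lemma potential_antiderivative : 0 < Q -> exists A : R -> R,
  [/\ forall s, -1 < s -> is_derive s (1 : R) A (fc s),
      forall s, 0 <= s <= Q -> A s = gF s ^+ 2 / 2 &
      forall s, 0 <= s -> A s = \int[lebesgue_measure]_(x in `[0, s]) fc x].
Proof.
move=> Q0; have [A [dA A0 iA]] := antiderivative (continuous_fc Q0).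
exists A; split => // s /(poiseuille_onto Q0) [t /andP[t0 t1] <-].
rewrite gF_poiseuille ?t0//.
(* Conservation of energy along the Poiseuille profile, a solution of P'' = f(P): [H] has derivative
   0 and vanishes at 0. *)
pose H t := A (P t) - (6 * Q * (t * (1 - t))) ^+ 2 / 2.
have dP (x : R) : is_derive x (1 : R) (fun t => (6 * Q * (t * (1 - t))) ^+ 2 / 2)
    (6 * Q * (1 - 2 * x) * (6 * Q * (x * (1 - x)))).
  by apply: is_derive_eq; rewrite /GRing.scale /= mulr0 add0r; field.
have dH (x : R) : 0 <= x <= 1 -> is_derive x (1 : R) H 0.
  move=> /andP[x0 x1].
  have Px : -1 < P x.
    have := @poiseuille_bound x Q0; rewrite x0 x1 => /(_ isT) /andP[h _]; lra.
  have AP := is_derive1_comp (dA (P x) Px) (is_derive_poiseuille x).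
  apply: is_derive_eq (is_deriveB AP (dP x)) _.
  by rewrite /fc kap_poiseuille ?x0 ?subrr.
have cH : {within `[0, t], continuous H}.
  apply: continuous_in_subspaceT => x; rewrite inE /= in_itv /= => /andP[x0 xt].
  by apply: is_derive_continuous; apply: dH; lra.
have dH' (x : R) : 0 < x < t -> is_derive x (1 : R) H ((fun=> 0) x) by move=> ?; apply: dH; lra.
have := mean_value_ge t0 dH' cH (fun x _ => lexx 0).
have := mean_value_le t0 dH' cH (fun x _ => lexx 0).
rewrite /H poiseuille0 A0; lra.
Qed.

(** Inside [[0, Q]] this is the first integral of the Poiseuille profile. Outside, both sides are 0:
    [fhat] vanishes there, and [F] has returned to 0 at [Q] because [gF] does. *)
Lemma F_gF s : 0 < Q -> F Q s = gF s ^+ 2 / 2.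
Proof.
move=> Q0; have [A [_ AE iA]] := potential_antiderivative Q0.
have mfhat : measurable_fun setT (fhat Q).
  rewrite (_ : fhat Q = fun s => fc s * \1_`[0, Q] s); last first.
    apply/funext => x; rewrite /fhat indicE /=.
    case: ifPn => h; first by rewrite mem_set ?mulr1 ?fcE// /= in_itv.
    by rewrite memNset ?mulr0// /= in_itv; exact/negP.
  apply: measurable_funM; first by apply: continuous_measurable_fun; exact: continuous_fc.
  exact: measurable_indic.
have ifhat (a b : R) : lebesgue_measure.-integrable `[a, b] (EFin \o fhat Q).
  apply: measurable_bounded_integrable => //.
  - have := @lebesgue_measure_itv R `[a, b]; rewrite /= => ->. by case: ifP => _; rewrite ?ltry// -EFinB ltry.
  - exact: measurable_funTS.
  - exists (6 * Q); split; first exact: num_real.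
    move=> M QM x _ /=; rewrite /fhat; case: ifPn => h; last by rewrite normr0; lra.
    rewrite fcE// /fc; have [/andP[k0 k1] _] := kapP x Q0.
    apply: ltW; apply: le_lt_trans QM; rewrite normrM ger0_norm; last lra.
    by rewrite -[leRHS]mulr1 ler_wpM2l ?ler_norml; lra.
have Fle t : 0 <= t <= Q ->
    \int[lebesgue_measure]_(x in `[0, t]) fhat Q x = gF t ^+ 2 / 2.
  move=> /andP[t0 tQ]; rewrite -AE ?t0// iA//; apply: eq_Rintegral => x.
  rewrite inE /= in_itv /= => /andP[x0 xt].
  by rewrite /fhat x0 (le_trans xt tQ) fcE// x0 (le_trans xt tQ).
rewrite /F; case: (leP 0 s) => s0; last first.
  rewrite gF_le0 ?ltW// expr0n /= mul0r.
  (* The endpoint 0 is removed from the interval because [fhat] jumps there: its value at 0 is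
     [6 * Q]. *)
  rewrite -Rintegral_itv_bndo_bndc; last first.
    by apply: integrableS (ifhat s 0) => //; exact: subset_itv_co_cc.
  rewrite (@eq_Rintegral _ _ _ _ _ (fun=> 0)) ?Rintegral_cst ?mul0r ?oppr0// => x.
  by rewrite inE /= in_itv /= /fhat => /andP[_ x0]; rewrite leNgt x0.
case: (leP s Q) => sQ; first by rewrite Fle ?s0.
have fhat0 : \int[lebesgue_measure]_(x in `]Q, s]) fhat Q x = 0.
  rewrite (@eq_Rintegral _ _ _ _ _ (fun=> 0)) ?Rintegral_cst ?mul0r// => x.
  rewrite inE /= in_itv /= /fhat => /andP[Qx _].
  by case: ifP => // /andP[_]; rewrite leNgt Qx.
have := @Rintegral_itvB _ (fhat Q) (BLeft 0) (BRight s) Q (ifhat 0 s).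
rewrite !bnd_simp (ltW Q0) (ltW sQ) => /(_ isT isT) /eqP.
rewrite subr_eq fhat0 add0r => /eqP ->.
by rewrite Fle ?lexx ?(ltW Q0)// !gF_geQ ?(ltW sQ).
Qed.

End Potential.

(** * The one-dimensional profiles *)

Section Profiles.
Context {R : realType}.
Implicit Types (phi : R -> R) (a b c d k s t x y z : R).

Lemma within_comp (A : set R) (phi B : R -> R) :
  {within A, continuous phi} -> (forall x, A x -> {for phi x, continuous B}) ->
  {within A, continuous (B \o phi)}.
Proof.
move=> /subspace_continuousP cphi cB; apply/subspace_continuousP => x Ax.
exact: (cvg_comp _ _ (cphi x Ax) (cB x Ax)).
Qed.

Variable Q : R.
Hypothesis Q0 : 0 < Q.
Local Notation P := (poiseuille Q).
Local Notation g := (gF Q).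

(** [B] is the time function of the equation phi' = m(phi): along a solution, [B (phi y)] grows with
    slope 1. The upper bound [K] makes [B] strictly increasing, so that inequalities between its
    values can be inverted. *)
Lemma antiderivative_inv (m : R -> R) (K : R) : continuous m ->
  (forall s, 0 < m s) -> (forall s, m s <= K) -> exists B : R -> R,
  [/\ forall s, -1 < s -> is_derive s (1 : R) B (m s)^-1,
      forall s, -1 < s -> {for s, continuous B} &
      forall s t, -1 < s -> -1 < t -> B s <= B t -> s <= t].
Proof.
move=> cm m0 mK.
have cm' : continuous (fun s => (m s)^-1).
  by move=> s; apply: cvgV; [rewrite gt_eqF|exact: cm].
have [B [dB _ _]] := antiderivative cm'.
have cB (s : R) : -1 < s -> {for s, continuous B}.
  by move=> s1; apply: is_derive_continuous (dB s s1).
exists B; split => // s t s1 t1 Bst; rewrite leNgt; apply/negP => ts.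
have K0 : 0 < K := lt_le_trans (m0 0) (mK 0).
have : K^-1 * (s - t) <= B s - B t.
  apply: (@mean_value_ge _ B (fun s => (m s)^-1)) => [|x /andP[tx _]||x _].
  - exact: ltW.
  - by apply: dB; apply: lt_trans tx.
  - apply: continuous_in_subspaceT => x; rewrite inE /= in_itv /= => /andP[tx _].
    by apply: cB; apply: lt_le_trans tx.
  - by rewrite lef_pV2// posrE.
have : 0 < K^-1 * (s - t) by rewrite mulr_gt0 ?invr_gt0 ?subr_gt0.
by move: Bst; lra.
Qed.

Section Profile.
Variables (d : R) (phi dphi : R -> R).
Hypothesis d1 : 0 < d <= 1.
Hypothesis phiQ : forall y, 0 <= y <= d -> 0 <= phi y <= Q.
Hypothesis phic : {within `[0, d], continuous phi}.
Hypothesis phid : forall y, 0 < y < d -> is_derive y (1 : R) phi (dphi y).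
Hypothesis phi0 : phi 0 = 0.

Lemma profile_comp_continuous (B : R -> R) y z : 0 <= y -> z <= d ->
  (forall s, -1 < s -> {for s, continuous B}) ->
  {within `[y, z], continuous (B \o phi)}.
Proof.
move=> y0 zd cB; apply: within_comp => [|x].
  by apply: continuous_subspaceW phic; apply: subset_itv; rewrite bnd_simp.
rewrite /= in_itv /= => /andP[yx xz]; apply: cB.
have := @phiQ x; rewrite (le_trans y0 yx) (le_trans xz zd) => /(_ isT) /andP[h _].
by apply: lt_le_trans h; rewrite ltrN10.
Qed.

Lemma profile_comp_derive (B : R -> R) (m : R -> R) y :
  (forall s, -1 < s -> is_derive s (1 : R) B (m s)^-1) -> 0 < y < d ->
  is_derive y (1 : R) (B \o phi) ((m (phi y))^-1 * dphi y).
Proof.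
move=> dB yd; apply: is_derive1_comp (phid yd); apply: dB.
have := @phiQ y; move: yd => /andP[/ltW -> /ltW ->] /(_ isT) /andP[h _].
by apply: lt_le_trans h; rewrite ltrN10.
Qed.

Lemma poiseuille_gtN1 t : 0 <= t <= 1 -> -1 < P t.
Proof. by move=> /(poiseuille_bound Q0) /andP[h _]; apply: lt_le_trans h; rewrite ltrN10. Qed.

Lemma poiseuille_comp_continuous (B : R -> R) a b : 0 <= a -> b <= 1 ->
  (forall s, -1 < s -> {for s, continuous B}) ->
  {within `[a, b], continuous (B \o P)}.
Proof.
move=> a0 b1 cB; apply: within_comp => [|x].
  by apply: continuous_subspaceT; exact: continuous_poiseuille.
rewrite /= in_itv /= => /andP[ax xb]; apply: cB; apply: poiseuille_gtN1.
by rewrite (le_trans a0 ax) (le_trans xb b1).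
Qed.

Lemma poiseuille_comp_derive (B : R -> R) (m : R -> R) t :
  (forall s, -1 < s -> is_derive s (1 : R) B (m s)^-1) -> 0 <= t <= 1 ->
  is_derive t (1 : R) (B \o P) ((m (P t))^-1 * g (P t)).
Proof.
move=> dB t01; rewrite (gF_poiseuille Q0 t01).
by apply: is_derive1_comp (is_derive_poiseuille Q t); apply: dB; exact: poiseuille_gtN1.
Qed.

Let maxg_gt0 k s : 0 < k -> 0 < Num.max (g s) k.
Proof. by move=> k0; rewrite lt_max k0 orbT. Qed.

Let maxg_le k s : Num.max (g s) k <= Num.max (6 * Q) k.
Proof. by rewrite ge_max !le_max (gF_le s Q0) lexx orbT. Qed.

Let maxg_cont k : continuous (fun s => Num.max (g s) k).
Proof. by move=> s; apply: continuous_max; [exact: continuous_gF|exact: cvg_cst]. Qed.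

(* Integrating [dphi / max g k >= 1] backwards from [z], against the same quotient
   for the Poiseuille profile, which is at most [1]. *)
Lemma profile_le_shifted k y z t : 0 < k ->
  (forall x, 0 < x < d -> g (phi x) <= dphi x /\ k <= dphi x) ->
  0 <= y -> y <= z -> z <= d -> t <= 1 -> 0 <= t - (z - y) -> phi z = P t ->
  phi y <= P (t - (z - y)).
Proof.
have [Q0' d1'] := (Q0, d1).
move=> k0 gk y0 yz zd t1 tzy phiz.
have yd : 0 <= y <= d by rewrite y0 (le_trans yz zd).
have [B [dB cB mB]] := antiderivative_inv (@maxg_cont k) (fun s => maxg_gt0 s k0) (@maxg_le k).
apply: mB.
- by have /andP[h _] := phiQ yd; apply: lt_le_trans h; rewrite ltrN10.
- by apply: poiseuille_gtN1; lra.
have h1 : 1 * (z - y) <= (B \o phi) z - (B \o phi) y.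
  apply: (@mean_value_ge _ _ (fun x => (Num.max (g (phi x)) k)^-1 * dphi x)) => //.
  - by move=> x xyz; apply: profile_comp_derive dB _; lra.
  - exact: profile_comp_continuous.
  - move=> x xyz; rewrite -ler_pdivrMl ?invr_gt0 ?maxg_gt0// invrK mulr1 ge_max.
    by have [|-> ->] := gk x; first lra.
have h2 : (B \o P) t - (B \o P) (t - (z - y)) <= 1 * (t - (t - (z - y))).
  apply: (@mean_value_le _ _ (fun x => (Num.max (g (P x)) k)^-1 * g (P x))) => //.
  - by lra.
  - by move=> x xyz; apply: poiseuille_comp_derive dB _; lra.
  - exact: poiseuille_comp_continuous.
  - move=> x xyz; rewrite -ler_pdivlMl ?invr_gt0 ?maxg_gt0// invrK mulr1.
    by rewrite le_max lexx.
by move: h1 h2; rewrite /= phiz; lra.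
Qed.

(** As [g] is not Lipschitz at 0, the problem phi' = g(phi), phi(0) = 0 has many solutions, [P]
    being the largest. Replacing [g] by [max g k] gives a finite time function at the price of
    starting from [P e] instead of 0, that is, of the weaker bound [P (y + e)]. *)
Lemma profile_le_poiseuille :
  (forall x, 0 < x < d -> dphi x <= g (phi x)) ->
  forall y, 0 <= y <= d -> phi y <= P y.
Proof.
have [Q0' d1'] := (Q0, d1).
move=> gphi y yd.
have [y1|y1] := leP 1 y.
  have -> : P y = Q by rewrite (_ : y = 1) ?poiseuille1//; lra.
  by have := phiQ yd; lra.
rewrite leNgt; apply/negP => lt.
(* Half of the supposed excess divided by [6 * Q], a bound for the slope of [P]: a shift by [e <= D]
   cannot make up for the excess. *)
pose D := (phi y - P y) / (6 * Q) / 2.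
have D0 : 0 < D by rewrite !divr_gt0 ?subr_gt0//; lra.
pose e := Num.min ((1 - y) / 2) D.
have e0 : 0 < e by rewrite lt_min D0 andbT; lra.
have ey : e <= (1 - y) / 2 by rewrite ge_min lexx.
have eD : e <= D by rewrite ge_min lexx orbT.
(* This constant is the slope of [P] at [e]. Since [y + e <= 1 - e], the slope of [P] is at least as
   large on the whole of [[e, y + e]], so the maximum with it is inactive there. *)
have k0 : 0 < 6 * Q * (e * (1 - e)) by rewrite !mulr_gt0//; lra.
have [B [dB cB mB]] := antiderivative_inv (@maxg_cont (6 * Q * (e * (1 - e))))
  (fun s => maxg_gt0 s k0) (@maxg_le _).
have phiy : phi y <= P (y + e).
  apply: mB.
  - by have /andP[h _] := phiQ yd; apply: lt_le_trans h; rewrite ltrN10.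
  - by apply: poiseuille_gtN1; lra.
  have h1 : (B \o phi) y - (B \o phi) 0 <= 1 * (y - 0).
    apply: (@mean_value_le _ _ (fun x => (Num.max (g (phi x)) (6 * Q * (e * (1 - e))))^-1 * dphi x)) => //.
    - by lra.
    - by move=> x xyz; apply: profile_comp_derive dB _; lra.
    - by apply: profile_comp_continuous => //; lra.
    - move=> x xyz; rewrite -ler_pdivlMl ?invr_gt0 ?maxg_gt0// invrK mulr1 le_max.
      by rewrite gphi//; lra.
  have h2 : 1 * (y + e - e) <= (B \o P) (y + e) - (B \o P) e.
    apply: (@mean_value_ge _ _ (fun x => (Num.max (g (P x)) (6 * Q * (e * (1 - e))))^-1 * g (P x))) => //.
    - by lra.
    - by move=> x xyz; apply: poiseuille_comp_derive dB _; lra.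
    - by apply: poiseuille_comp_continuous => //; lra.
    - move=> x xyz; rewrite -ler_pdivrMl ?invr_gt0 ?maxg_gt0// invrK mulr1.
      rewrite ge_max lexx gF_poiseuille//; last lra.
      by rewrite ler_pM2l; [nra|lra].
  have h3 : 0 * (e - 0) <= (B \o P) e - (B \o P) 0.
    apply: (@mean_value_ge _ _ (fun x => (Num.max (g (P x)) (6 * Q * (e * (1 - e))))^-1 * g (P x))) => //.
    - by lra.
    - by move=> x xyz; apply: poiseuille_comp_derive dB _; lra.
    - by apply: poiseuille_comp_continuous => //; lra.
    - by move=> x xyz; rewrite mulr_ge0 ?invr_ge0 ?gF_ge0// ltW ?maxg_gt0.
  by move: h1 h2 h3; rewrite /= phi0 poiseuille0; lra.
have : P (y + e) - P y <= 6 * Q * (y + e - y).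
  apply: (@mean_value_le _ _ (fun t => 6 * Q * (t * (1 - t)))) => //.
  - by lra.
  - by move=> x _; exact: is_derive_poiseuille.
  - by apply: continuous_subspaceT; exact: continuous_poiseuille.
  - by move=> x xy; rewrite -[leRHS]mulr1 ler_pM2l; [nra|lra].
have : 6 * Q * e <= 6 * Q * D by rewrite ler_pM2l//; lra.
have -> : 6 * Q * D = (phi y - P y) / 2 by rewrite /D; field; rewrite gt_eqF.
by move: lt phiy; lra.
Qed.

(** For [c > 0] the speed [sqrt (g ^ 2 + c)] stays away from 0, so the time function is finite and
    identifies the profile among all those of the same level [c]. *)
Lemma profile_flow c : 0 < c ->
  (forall x, 0 < x < d -> dphi x = Num.sqrt (g (phi x) ^+ 2 + c)) ->
  exists B : R -> R,
    [/\ forall s t, -1 < s -> -1 < t -> B s <= B t -> s <= t,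
        forall s, -1 < s -> is_derive s (1 : R) B (Num.sqrt (g s ^+ 2 + c))^-1,
        forall s, -1 < s -> {for s, continuous B} &
        forall y, 0 <= y <= d -> B (phi y) = B 0 + y].
Proof.
move=> c0 dphiE.
have m0 s : 0 < Num.sqrt (g s ^+ 2 + c) by rewrite sqrtr_gt0 ltr_wpDl// sqr_ge0.
have mK s : Num.sqrt (g s ^+ 2 + c) <= Num.sqrt ((6 * Q) ^+ 2 + c).
  by rewrite ler_wsqrtr// lerD2r ler_pXn2r ?nnegrE ?gF_ge0 ?gF_le// mulr_ge0// ltW.
have mc : continuous (fun s => Num.sqrt (g s ^+ 2 + c)).
  move=> s; apply: (@continuous_comp _ _ _ (fun s => g s ^+ 2 + c) Num.sqrt).
    apply: cvgD; last exact: cvg_cst.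
    by rewrite /= !expr2; apply: cvgM; exact: continuous_gF.
  exact: sqrt_continuous.
have [B [dB cB mB]] := antiderivative_inv mc m0 mK.
exists B; split => // y /andP[y0 yd].
have dBphi x : 0 < x < y -> is_derive x (1 : R) (B \o phi) ((fun=> 1) x).
  move=> xy; have xd : 0 < x < d.
    by move: xy => /andP[-> xy]; rewrite (lt_le_trans xy yd).
  apply: is_derive_eq (profile_comp_derive dB xd) _.
  by rewrite dphiE// mulVf// gt_eqF.
have cBphi := profile_comp_continuous (lexx 0) yd cB.
have := mean_value_ge y0 dBphi cBphi (fun x _ => lexx 1).
have := mean_value_le y0 dBphi cBphi (fun x _ => lexx 1).
by rewrite /= phi0; lra.
Qed.

End Profile.

(** * The profiles [phibar]: first integral, symmetry, comparison with the Poiseuille profile *)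

Section Phibar.
Variables (d : R) (phi : R -> R).
Hypothesis d1 : 0 < d <= 1.
Hypothesis phiP : is_phibar Q d phi.

Let phiQ y : 0 <= y <= d -> 0 <= phi y <= Q.
Proof. by case: phiP => h *; apply: h. Qed.

Let phic : {within `[0, d], continuous phi}.
Proof. by case: phiP => _ []. Qed.

Let phid y : 0 < y < d -> is_derive y (1 : R) phi (derive1 phi y).
Proof.
case: phiP => _ [_ [phi1 [_ dphi]]] _ _ _ yd.
by rewrite derive1E; have H := dphi y yd; rewrite derive_val.
Qed.

Let phi0 : phi 0 = 0. Proof. by case: phiP => _ _ _ _ []. Qed.
Let phi_d : phi d = Q. Proof. by case: phiP => _ _ _ _ []. Qed.

Let dphid y : 0 < y < d -> is_derive y (1 : R) (derive1 phi) (fc Q (phi y)).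
Proof.
case: phiP => _ _ ddphi eq _ yd.
rewrite -fcE; last by apply: phiQ; case/andP: yd => /ltW -> /ltW ->.
have [dd _] := ddphi y yd; have e := eq y yd; rewrite derive1E in e.
by split.
Qed.

Lemma phibar_first_integral : exists2 c, 0 <= c &
  forall x, 0 < x < d -> derive1 phi x ^+ 2 = g (phi x) ^+ 2 + c.
Proof.
have [A [dA AE _]] := potential_antiderivative Q0.
pose E y := derive1 phi y ^+ 2 - 2 * A (phi y).
have dE y : 0 < y < d -> is_derive y (1 : R) E 0.
  move=> yd; have phiy : -1 < phi y.
    have /andP[h _] := @phiQ y ltac:(by case/andP: yd => /ltW -> /ltW ->).
    by apply: lt_le_trans h; rewrite ltrN10.
  have h1 := dphid yd; have h2 := is_derive1_comp (dA _ phiy) (phid yd).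
  have -> : E = (derive1 phi ^+ 2) - 2 *: (A \o phi) by [].
  apply: is_derive_eq; rewrite /GRing.scale /=; ring.
have Ecst y z : 0 < y -> y <= z -> z < d -> E z = E y.
  move=> y0 yz zd.
  have dE' x : y < x < z -> is_derive x (1 : R) E ((fun=> 0) x).
    by move=> /andP[yx xz]; apply: dE; rewrite (lt_trans y0 yx) (lt_trans xz zd).
  have cE : {within `[y, z], continuous E}.
    apply: continuous_in_subspaceT => x; rewrite inE /= in_itv /= => /andP[yx xz].
    apply: is_derive_continuous; apply: dE.
    by rewrite (lt_le_trans y0 yx) (le_lt_trans xz zd).
  have := mean_value_ge yz dE' cE (fun x _ => lexx 0).
  have := mean_value_le yz dE' cE (fun x _ => lexx 0).
  by lra.
have /andP[d0 _] := d1.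
have EE y : 0 < y < d -> derive1 phi y ^+ 2 = g (phi y) ^+ 2 + E (d / 2).
  move=> yd; have -> : E (d / 2) = E y.
    case: (leP y (d / 2)) => h; first by apply: Ecst => //; lra.
    by apply/esym/Ecst; lra.
  rewrite /E AE; last by apply: phiQ; case/andP: yd => /ltW -> /ltW ->.
  by field.
exists (E (d / 2)) => //.
(* Near the left end [g (phi y)] tends to [g 0 = 0], so a negative level would make the square of
   the slope negative. *)
rewrite leNgt; apply/negP => E0.
have /(continuous_within_itvP phi d0)[_ + _] := phic; rewrite phi0 => phi_cvg.
have := cvg_comp _ _ phi_cvg (@continuous_gF _ _ Q0 0).
rewrite gF_le0// => /cvgrPdist_lt /(_ (Num.sqrt (- E (d / 2)))).
rewrite sqrtr_gt0 oppr_gt0 => /(_ E0) H.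
near (0 : R)^'+ => y.
have yd : 0 < y < d by apply/andP; split; near: y; [exact: nbhs_right_gt|exact: nbhs_right_lt].
have : `|0 - (g \o phi) y| < Num.sqrt (- E (d / 2)) by near: y.
rewrite sub0r normrN /= ger0_norm ?gF_ge0// => lt.
have : g (phi y) ^+ 2 < - E (d / 2).
  rewrite -[ltRHS]sqr_sqrtr ?oppr_ge0 ?(ltW E0)// ltr_pXn2r ?nnegrE ?gF_ge0 ?sqrtr_ge0//.
have := EE y yd; have := sqr_ge0 (derive1 phi y).
lra.
Unshelve. all: by end_near. Qed.

(** At a positive level the slope has no zero. It is positive somewhere, because [phi] climbs from 0
    to [Q], and by the intermediate value theorem it keeps this sign. *)
Lemma phibar_derive_sqrt c : 0 < c ->
  (forall x, 0 < x < d -> derive1 phi x ^+ 2 = g (phi x) ^+ 2 + c) ->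
  forall x, 0 < x < d -> derive1 phi x = Num.sqrt (g (phi x) ^+ 2 + c).
Proof.
move=> c0 H x xd; rewrite -H// sqrtr_sqr ger0_norm// leNgt; apply/negP => dx.
have /andP[d0 _] := d1.
have [x0 + ] := MVT d0 (fun x xab => @phid x ltac:(by rewrite in_itv in xab)) phic.
rewrite in_itv /= phi0 phi_d !subr0 => x0d e.
have dx0 : 0 < derive1 phi x0 by rewrite -(pmulr_lgt0 _ d0) -e.
have cd a b : 0 < a -> b < d -> {within `[a, b], continuous (derive1 phi)}.
  move=> a0 bd; apply: continuous_in_subspaceT => z; rewrite inE /= in_itv /= => /andP[az zb].
  by apply: is_derive_continuous; apply: dphid; rewrite (lt_le_trans a0 az) (le_lt_trans zb bd).
have [z zd ez] : exists2 z, 0 < z < d & derive1 phi z = 0.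
  have [xx0|x0x] := leP x x0.
  - have [|z] := @IVT R (derive1 phi) x x0 0 xx0 (cd x x0 ltac:(lra) ltac:(lra)).
    + by rewrite min_l ?max_r; lra.
    + by rewrite in_itv /= => zx ez; exists z => //; lra.
  - have [|z] := @IVT R (derive1 phi) x0 x 0 (ltW x0x) (cd x0 x ltac:(lra) ltac:(lra)).
    + by rewrite min_r ?max_l; lra.
    + by rewrite in_itv /= => zx ez; exists z => //; lra.
have := H z zd; rewrite ez expr0n /=.
by have := sqr_ge0 (g (phi z)); lra.
Qed.

(* The reflected profile [Q - phi (d - y)] solves the same problem. *)
Let psi y := Q - phi (d - y).

Let psiQ y : 0 <= y <= d -> 0 <= psi y <= Q.
Proof. by move=> yd; have := @phiQ (d - y); rewrite /psi; lra. Qed.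

Let psid y : 0 < y < d -> is_derive y (1 : R) psi (derive1 phi (d - y)).
Proof.
move=> yd; have yd' : 0 < d - y < d by lra.
have h1 := phid yd'.
have h2 : is_derive y (1 : R) (fun y => d - y) (-1).
  by apply: is_derive_eq (is_deriveB (is_derive_cst d y (1 : R)) (is_derive_id y (1 : R))) _; rewrite sub0r.
have h3 := @is_derive1_comp R phi (fun y => d - y) y _ _ h1 h2.
have -> : psi = cst Q - (phi \o (fun y => d - y)) by [].
by apply: is_derive_eq (is_deriveB (is_derive_cst Q y (1 : R)) h3) _; rewrite mulrN1 opprK add0r.
Qed.

Let psic : {within `[0, d], continuous psi}.
Proof.
have -> : psi = (fun s => Q - s) \o (phi \o (fun y => d - y)) by [].
apply: within_comp => [|x _]; last by apply: cvgB; [exact: cvg_cst|exact: cvg_id].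
have /subspace_continuousP cphi := phic.
apply/subspace_continuousP => x /=; rewrite in_itv /= => /andP[x0 xd].
have h : `[0, d]%classic (d - x) by rewrite /= in_itv /= subr_ge0 xd lerBlDl lerDr x0.
apply/cvgrPdist_lt => e e0; have /cvgrPdist_lt/(_ e e0) := cphi _ h.
rewrite !near_withinE !near_simpl => H.
have c : (fun y => d - y) @ x --> d - x by apply: cvgB; [exact: cvg_cst|exact: cvg_id].
have := c _ H; rewrite !near_simpl; apply: filterS => y /=.
rewrite !in_itv /= => H' /andP[y0 yd]; apply: H'.
by rewrite subr_ge0 yd lerBlDl lerDr y0.
Qed.

Let psi0 : psi 0 = 0. Proof. by rewrite /psi subr0 phi_d subrr. Qed.

(** At level 0 both [phi] and its reflection lie below [P]. Since [phi y + psi (d - y) = Q] and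
    [P y + P (d - y) <= Q], neither bound can be strict. *)
Lemma phibar_poiseuille :
  (forall x, 0 < x < d -> derive1 phi x ^+ 2 = g (phi x) ^+ 2 + 0) ->
  forall y, 0 <= y <= d -> phi y = P y /\ psi y = P y.
Proof.
have [Q0' /andP[d0' d1']] := (Q0, d1).
move=> H.
have D x : 0 < x < d -> derive1 phi x <= g (phi x).
  move=> /H; rewrite addr0 => e.
  by apply: le_trans (ler_norm _) _; rewrite -sqrtr_sqr e sqrtr_sqr ger0_norm// gF_ge0.
have l1 := profile_le_poiseuille d1 phiQ phic phid phi0 D.
have l2 := @profile_le_poiseuille d psi (fun y => derive1 phi (d - y)) d1 psiQ psic psid psi0.
have {}l2 : forall y, 0 <= y <= d -> psi y <= P y.
  by apply: l2 => x xd; rewrite /psi gF_sym//; apply: D; lra.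
have m a b : 0 <= a -> a <= b -> b <= 1 -> P a <= P b by exact: poiseuille_mono.
have s := poiseuille_sym Q.
move=> y yd; have yd' : 0 <= d - y <= d by lra.
have := l1 y yd; have := l2 y yd; have := l1 _ yd'; have := l2 _ yd'.
rewrite /psi subKr; have := m y (1 - d + y); have := m (d - y) (1 - y).
rewrite (_ : 1 - d + y = 1 - (d - y)); last by ring.
rewrite !s => h1 h2.
have {}h1 : P (d - y) <= Q - P y by apply: h1; lra.
have {}h2 : P y <= Q - P (d - y) by apply: h2; lra.
lra.
Qed.

(** At a positive level [phi] and its reflection satisfy [B = B 0 + y] along the profile for the
    same injective time function [B]; at level 0 both are [P]. *)
Lemma phibar_sym y : 0 <= y <= d -> phi (d - y) = Q - phi y.
Proof.
have [Q0' /andP[d0' d1']] := (Q0, d1).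
move=> yd; have [c c0 E] := phibar_first_integral.
move: c0; rewrite le_eqVlt => /predU1P[c0|c0].
  rewrite -c0 in E; have [e1 e2] := phibar_poiseuille E yd.
  by rewrite e1 -e2 /psi; ring.
have dphiE := phibar_derive_sqrt c0 E.
have [B [mB dB cB BE]] := profile_flow phiQ phic phid phi0 c0 dphiE.
suff e : B (psi y) = B (phi y).
  suff : psi y = phi y by rewrite /psi; lra.
  have gtN1 (s : R) : 0 <= s <= Q -> -1 < s by lra.
  have [h1 h2] := (gtN1 _ (psiQ yd), gtN1 _ (phiQ yd)).
  by apply/eqP; rewrite eq_le; apply/andP; split; apply: mB => //; rewrite e.
rewrite BE//; move: yd => /andP[y0 yd].
have dBpsi x : 0 < x < y -> is_derive x (1 : R) (B \o psi) ((fun=> 1) x).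
  move=> xy; have xd : 0 < x < d by lra.
  apply: is_derive_eq (@profile_comp_derive d psi _ psiQ psid B _ x dB xd) _.
  rewrite /psi gF_sym// dphiE; last lra.
  by rewrite mulVf// gt_eqF// sqrtr_gt0 ltr_wpDl// sqr_ge0.
have cBpsi := profile_comp_continuous psiQ psic (lexx 0) yd cB.
have := mean_value_ge y0 dBpsi cBpsi (fun x _ => lexx 1).
have := mean_value_le y0 dBpsi cBpsi (fun x _ => lexx 1).
by rewrite /= psi0; lra.
Qed.

(** The two profiles are aligned at the top, where both equal [Q]; going down, [phi] loses height at
    least as fast as [P] because phi' >= g(phi). This serves case (ii), where the upper wall is at
    height 1. *)
Lemma phibar_le_top y : 0 <= y <= d -> phi y <= P (y + 1 - d).
Proof.
have [Q0' /andP[d0' d1']] := (Q0, d1).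
move=> yd; have [c c0 E] := phibar_first_integral.
move: c0; rewrite le_eqVlt => /predU1P[c0|c0].
  rewrite -c0 in E; have [-> _] := phibar_poiseuille E yd.
  by apply: poiseuille_mono => //; lra.
have dphiE := phibar_derive_sqrt c0 E.
rewrite (_ : y + 1 - d = 1 - (d - y)); last by ring.
apply: (@profile_le_shifted d phi (derive1 phi) d1 phiQ phic phid (Num.sqrt c)) => //; try lra.
- by rewrite sqrtr_gt0.
- move=> x /dphiE ->; split.
    rewrite -[leLHS]ger0_norm ?gF_ge0// -sqrtr_sqr ler_wsqrtr// lerDl ltW//.
  by rewrite ler_wsqrtr// lerDr sqr_ge0.
- by rewrite phi_d poiseuille1.
Qed.

(** The same argument with the profiles aligned at their midpoints, where both equal [Q / 2] by
    symmetry. This serves case (i). *)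
Lemma phibar_le_middle y : 0 <= y <= d / 2 -> phi y <= P (y + (1 - d) / 2).
Proof.
have [Q0' /andP[d0' d1']] := (Q0, d1).
move=> yd; have [c c0 E] := phibar_first_integral.
have yd2 : 0 <= y <= d by lra.
move: c0; rewrite le_eqVlt => /predU1P[c0|c0].
  rewrite -c0 in E; have [-> _] := phibar_poiseuille E yd2.
  by apply: poiseuille_mono => //; lra.
have dphiE := phibar_derive_sqrt c0 E.
rewrite (_ : y + (1 - d) / 2 = 1 / 2 - (d / 2 - y)); last by field.
apply: (@profile_le_shifted d phi (derive1 phi) d1 phiQ phic phid (Num.sqrt c)) => //; try lra.
- by rewrite sqrtr_gt0.
- move=> x /dphiE ->; split.
    rewrite -[leLHS]ger0_norm ?gF_ge0// -sqrtr_sqr ler_wsqrtr// lerDl ltW//.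
  by rewrite ler_wsqrtr// lerDr sqr_ge0.
- have := @phibar_sym (d / 2) ltac:(lra).
  rewrite (_ : d - d / 2 = d / 2); last by field.
  by rewrite /poiseuille; lra.
Qed.

End Phibar.

End Profiles.

(** * Square-integrable functions *)

Section SquareIntegrable.
Context {R : realType} {dT : measure_display} {T : measurableType dT}.
Variables (mu : {measure set T -> \bar R}) (D : set T).
Hypothesis mD : measurable D.
Implicit Types (u v m g : T -> R) (c C : R).

Local Notation Int u := (mu.-integrable D (EFin \o u)).

Definition sq_int u := measurable_fun D u /\ Int (fun x => u x ^+ 2).

Lemma integrable_measurable u : Int u -> measurable_fun D u.
Proof. by move=> /integrableP[/measurable_EFinP]. Qed.

Lemma integrable_dominated u g : measurable_fun D u -> Int g ->
  (forall x, D x -> `|u x| <= g x) -> Int u.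
Proof.
move=> mu_ ig ug; apply: le_integrable ig => //; first exact/measurable_EFinP.
by move=> x Dx /=; rewrite lee_fin (le_trans (ug x Dx))// ler_norm.
Qed.

Lemma eq_integrable_on u v : (forall x, D x -> u x = v x) -> Int u -> Int v.
Proof.
move=> uv; apply: eq_integrable => // x /set_mem Dx.
by rewrite /= uv.
Qed.

Lemma integrable_add u v : Int u -> Int v -> Int (fun x => u x + v x).
Proof. by move=> iu iv; have := integrableD mD iu iv; apply: eq_integrable. Qed.

Lemma integrable_scale c u : Int u -> Int (fun x => c * u x).
Proof. by move=> iu; have := integrableZl mD c iu; apply: eq_integrable. Qed.

Lemma integrable_sub u v : Int u -> Int v -> Int (fun x => u x - v x).
Proof. by move=> iu iv; have := integrableB mD iu iv; apply: eq_integrable. Qed.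

Lemma Rint_add u v : Int u -> Int v ->
  \int[mu]_(x in D) (u x + v x) = \int[mu]_(x in D) u x + \int[mu]_(x in D) v x.
Proof. by move=> iu iv; rewrite RintegralD. Qed.

Lemma Rint_sub u v : Int u -> Int v ->
  \int[mu]_(x in D) (u x - v x) = \int[mu]_(x in D) u x - \int[mu]_(x in D) v x.
Proof. by move=> iu iv; rewrite RintegralB. Qed.

Lemma Rint_scale c u : Int u ->
  \int[mu]_(x in D) (c * u x) = c * \int[mu]_(x in D) u x.
Proof. by move=> iu; rewrite RintegralZl. Qed.

Lemma Rint_le u v : Int u -> Int v -> (forall x, D x -> u x <= v x) ->
  \int[mu]_(x in D) u x <= \int[mu]_(x in D) v x.
Proof. by move=> iu iv uv; apply: le_Rintegral. Qed.

Lemma Rint_norm u v : Int u -> Int v -> (forall x, D x -> `|u x| <= v x) ->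
  `|\int[mu]_(x in D) u x| <= \int[mu]_(x in D) v x.
Proof.
move=> iu iv uv; apply: le_trans (le_normr_Rintegral mD iu) _.
by apply: Rint_le => //; exact: integrable_norm.
Qed.

Lemma Rint_EFin u : Int u -> (\int[mu]_(x in D) (u x)%:E)%E = (\int[mu]_(x in D) u x)%:E.
Proof. by move=> iu; rewrite /Rintegral fineK//; exact: integrable_fin_num. Qed.

Lemma lt_integrable u : measurable_fun D u -> (forall x, D x -> 0 <= u x) ->
  (\int[mu]_(x in D) (u x)%:E < +oo)%E -> Int u.
Proof.
move=> mu_ u0 h; apply/integrableP; split; first exact/measurable_EFinP.
by under eq_integral => x /set_mem Dx do rewrite /= ger0_norm ?u0//.
Qed.

Lemma integrable_lt u : Int u -> (\int[mu]_(x in D) (u x)%:E < +oo)%E.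
Proof. by move=> iu; rewrite Rint_EFin// ltry. Qed.

Lemma sq_int_measurable u : sq_int u -> measurable_fun D u. Proof. by case. Qed.

Lemma sq_int_dominated u v : measurable_fun D u -> sq_int v ->
  (forall x, D x -> `|u x| <= `|v x|) -> sq_int u.
Proof.
move=> mu_ [mv iv] uv; split => //.
apply: integrable_dominated iv _; first exact: measurable_funX.
by move=> x Dx; rewrite normrX -[leRHS]real_normK ?num_real// ler_pXn2r ?nnegrE ?uv.
Qed.

Lemma sq_int_mul u v : sq_int u -> sq_int v -> Int (fun x => u x * v x).
Proof.
move=> [mu_ iu] [mv iv].
apply: integrable_dominated (integrable_add iu iv) _; first exact: measurable_funM.
by move=> x _; rewrite ler_norml; apply/andP; split; nra.
Qed.

Lemma sq_int_add u v : sq_int u -> sq_int v -> sq_int (fun x => u x + v x).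
Proof.
move=> su sv; have [[mu_ iu] [mv iv]] := (su, sv); split; first exact: measurable_funD.
have := integrable_add (integrable_add iu iv) (integrable_scale 2 (sq_int_mul su sv)).
by apply: eq_integrable_on => x _; ring.
Qed.

Lemma sq_int_scale c u : sq_int u -> sq_int (fun x => c * u x).
Proof.
move=> [mu_ iu]; split; first exact: measurable_funM.
by have := integrable_scale (c ^+ 2) iu; apply: eq_integrable_on => x _; ring.
Qed.

Lemma sq_int_sub u v : sq_int u -> sq_int v -> sq_int (fun x => u x - v x).
Proof.
move=> su sv; have := sq_int_add su (sq_int_scale (-1) sv).
by rewrite (_ : (fun x => u x + -1 * v x) = (fun x => u x - v x))//; apply/funext => x; ring.
Qed.

Lemma eq_sq_int u v : (forall x, D x -> u x = v x) -> sq_int u -> sq_int v.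
Proof.
move=> uv [mu_ iu]; split.
  by apply: eq_measurable_fun mu_ => x /set_mem /uv.
by apply: eq_integrable_on iu => x /uv ->.
Qed.

Hypothesis Dfin : (mu D < +oo)%E.

Lemma integrable_const c : Int (fun=> c).
Proof.
apply: measurable_bounded_integrable => //.
exists `|c|; split; first exact: num_real.
by move=> M cM x _ /=; exact: ltW.
Qed.

Lemma integrable_bounded u C : measurable_fun D u ->
  (forall x, D x -> `|u x| <= C) -> Int u.
Proof. by move=> mu_; apply: integrable_dominated => //; exact: integrable_const. Qed.

Lemma sq_int_bounded u C : measurable_fun D u ->
  (forall x, D x -> `|u x| <= C) -> sq_int u.
Proof.
move=> mu_ uC; split => //; apply: (@integrable_bounded _ (C ^+ 2)).
  exact: measurable_funX.
move=> x Dx; rewrite normrX ler_pXn2r ?nnegrE ?uC//.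
exact: le_trans (normr_ge0 (u x)) (uC x Dx).
Qed.

Lemma sq_int_integrable u : sq_int u -> Int u.
Proof.
move=> su; have := sq_int_mul su (@sq_int_bounded (fun=> 1) 1 _ _).
rewrite (_ : (fun x => u x * 1) = u); last by apply/funext => x; rewrite mulr1.
by apply=> [|x _]; [exact: measurable_cst|rewrite normr1].
Qed.

Lemma Rint_dominated_cvg (u_ : nat -> T -> R) u g :
  (forall n, measurable_fun D (u_ n)) -> Int g ->
  (forall n x, D x -> `|u_ n x| <= g x) ->
  (forall x, D x -> u_ n x @[n --> \oo] --> u x) ->
  Int u /\ (\int[mu]_(x in D) u_ n x) @[n --> \oo] --> \int[mu]_(x in D) u x.
Proof.
move=> mu_ ig ug uu.
have mu0 : measurable_fun D u by apply: measurable_fun_cvg uu.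
have [] := @dominated_convergence _ T R mu D mD (fun n => EFin \o u_ n) (EFin \o u) (EFin \o g).
- by move=> n; exact/measurable_EFinP.
- exact/measurable_EFinP.
- by apply: aeW => x Dx; apply/fine_cvgP; split; [exact: nearW|exact: uu].
- exact: ig.
- by apply: aeW => x n Dx /=; rewrite lee_fin ug.
move=> iu _ cu; split => //; apply: fine_cvg.
by rewrite -(Rint_EFin iu).
Qed.

(** Dominated convergence along integer thresholds. The threshold [M] stands in for a bound on the
    unbounded factor in [mul_limit]. *)
Lemma sq_int_tail u c : sq_int u -> 0 < c -> exists2 M, 0 < M &
  \int[mu]_(x in D) (u x ^+ 2 * (M < `|u x|)%R%:R) < c.
Proof.
move=> [mu_ iu] c0.
pose v n x := u x ^+ 2 * (n.+1%:R < `|u x|)%R%:R.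
have mv n : measurable_fun D (v n).
  apply: measurable_funM; first exact: measurable_funX.
  rewrite (_ : (fun x => _) = (fun b : bool => b%:R : R) \o (fun x => n.+1%:R < `|u x|))//.
  apply: measurableT_comp => //; apply: measurable_fun_ltr => //.
  exact: measurableT_comp.
have [||_ cv] := @Rint_dominated_cvg v (fun=> 0) (fun x => u x ^+ 2) mv iu.
- move=> n x _; rewrite /v ger0_norm; last by rewrite mulr_ge0 ?sqr_ge0.
  by rewrite ler_piMr ?sqr_ge0//; case: (_ < _).
- move=> x _; apply: cvg_near_cst.
  near=> n; rewrite /v (_ : (_ < _) = false) ?mulr0//.
  apply/negbTE; rewrite -leNgt.
  have : (Num.truncn `|u x| <= n)%N by near: n; exact: nbhs_infty_ge.
  move=> h; apply: ltW; apply: lt_le_trans (truncnS_gt _) _.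
  by rewrite ler_nat.
move: cv; rewrite Rintegral_cst// mul0r => /cvgrPdist_lt/(_ c c0).
move=> [n _ /(_ n (leqnn n))]; rewrite /= sub0r normrN => h.
exists n.+1%:R => //; apply: le_lt_trans h; exact: ler_norm.
Unshelve. all: by end_near. Qed.

End SquareIntegrable.

(** * Continuously differentiable functions on the plane *)

Section Plane.
Context {R : realType}.
Implicit Types (u v w : R * R -> R) (x y : R * R) (s t a b c : R).

Local Notation plane := (measurableTypeR R * measurableTypeR R)%type.
Local Notation leb2 := (@lebesgue_measure R \x @lebesgue_measure R)%E.
Local Notation leb := (@lebesgue_measure R).

Lemma rational_box (U : set (R * R)) x : open U -> U x ->
  exists i : rat * rat * nat,
    (`|x.1 - ratr i.1.1| < i.2.+1%:R^-1 /\ `|x.2 - ratr i.1.2| < i.2.+1%:R^-1) /\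
    forall y, `|y.1 - ratr i.1.1| <= i.2.+1%:R^-1 ->
      `|y.2 - ratr i.1.2| <= i.2.+1%:R^-1 -> U y.
Proof.
move=> oU Ux.
have /nbhs_ballP[e /= e0 eU] : nbhs x U by exact: open_nbhs_nbhs.
pose n := Num.truncn (2 / e); pose r : R := n.+1%:R^-1.
have r0 : 0 < r by rewrite invr_gt0.
have re : r + r < e.
  have : 2 / e < n.+1%:R by exact: truncnS_gt.
  rewrite -(ltr_pM2l r0) [r * _.+1%:R]mulVf// mulrA ltr_pdivrMr// mul1r; lra.
have near_rat t : exists q : rat, `|t - ratr q| < r.
  have /rat_in_itvoo[q] : t - r < t + r by lra.
  by rewrite in_itv /= => tq; exists q; rewrite ltr_norml; lra.
have [p1 h1] := near_rat x.1; have [p2 h2] := near_rat x.2.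
exists (p1, p2, n); split => // y y1 y2; apply: eU.
split; rewrite /= -ball_normE /=.
  apply: le_lt_trans (ler_distD (ratr p1) _ _) _; apply: lt_trans re.
  by rewrite ltr_leD// distrC.
apply: le_lt_trans (ler_distD (ratr p2) _ _) _; apply: lt_trans re.
by rewrite ltr_leD// distrC.
Qed.

(** The plane carries the product sigma-algebra, so an open set has to be written as a countable
    union of rational squares. *)
Lemma open_measurable_plane (U : set (R * R)) : open U ->
  measurable (U : set plane).
Proof.
move=> oU.
pose V (i : rat * rat * nat) : set plane :=
  ball (ratr i.1.1 : R) i.2.+1%:R^-1 `*` ball (ratr i.1.2 : R) i.2.+1%:R^-1.
have -> : U = \bigcup_i (if `[<V i `<=` U>] then V i else set0).
  apply/seteqP; split => [x Ux|x [i _]]; last by case: ifP => // /asboolP VU /VU.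
  have [i [[x1 x2] iU]] := rational_box oU Ux.
  exists i => //; rewrite (asboolT (_ : V _ `<=` U)).
    by split; rewrite /= /ball /= distrC.
  move=> y [/=]; rewrite -!ball_normE /= => y1 y2; apply: iU; apply: ltW; by rewrite distrC.
apply: countable_bigcupT_measurable => // i; case: ifP => // _.
by apply: measurableX; exact: measurable_ball.
Qed.

Lemma continuous_measurable_plane u : continuous u ->
  measurable_fun setT (u : plane -> measurableTypeR R).
Proof.
move=> cu; apply: (measurability _ (RGenOInfty.measurableE R)).
move=> _ [_ [t ->] <-]; rewrite setTI; apply: open_measurable_plane.
by apply: open_comp => [x _|]; [exact: cu|exact: interval_open].
Qed.

Lemma continuous2_bounded u c : continuous u ->
  exists C, forall x, `|x.1| <= c -> `|x.2| <= c -> `|u x| <= C.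
Proof.
move=> cu; pose K := `[- c, c]%classic `*` `[- c, c]%classic : set (R * R).
have cK : compact K by apply: compact_setX; exact: segment_compact.
have : compact (u @` K).
  by apply: continuous_compact => //; exact: continuous_subspaceT.
move=> /compact_bounded[C [_ HC]]; exists (C + 1) => x x1 x2.
apply: (HC (C + 1)); first by rewrite ltrDl.
by exists x => //; split; rewrite /= in_itv /= -ler_norml.
Qed.

(** The partial derivatives are arguments, and are derivatives in one real variable, so that the
    chain and product rules yield the gradient as an explicit formula. *)
Definition C1 u u1 u2 :=
  [/\ continuous u, continuous u1, continuous u2,
      forall x, is_derive x.1 (1 : R) (fun t => u (t, x.2)) (u1 x) &
      forall x, is_derive x.2 (1 : R) (fun t => u (x.1, t)) (u2 x)].

Lemma partial1E u x : (fun h : R => h^-1 *: ((u \o shift x) (h *: ((1, 0) : R * R)) - u x)) =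
  (fun h : R => h^-1 *: (((fun t => u (t, x.2)) \o shift x.1) (h *: (1 : R)) - u (x.1, x.2))).
Proof.
apply/funext => h /=; rewrite -surjective_pairing; congr (_ *: (u _ - _)).
apply/pair_equal_spec; split => //.
by rewrite (_ : (_ *: _).2 = h * 0)// mulr0 add0r.
Qed.

Lemma partial2E u x : (fun h : R => h^-1 *: ((u \o shift x) (h *: ((0, 1) : R * R)) - u x)) =
  (fun h : R => h^-1 *: (((fun t => u (x.1, t)) \o shift x.2) (h *: (1 : R)) - u (x.1, x.2))).
Proof.
apply/funext => h /=; rewrite -surjective_pairing; congr (_ *: (u _ - _)).
apply/pair_equal_spec; split => //.
by rewrite (_ : (_ *: _).1 = h * 0)// mulr0 add0r.
Qed.

Lemma partial1P u x d : is_derive x ((1, 0) : R * R) u d <->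
  is_derive x.1 (1 : R) (fun t => u (t, x.2)) d.
Proof.
by split=> -[]; rewrite /derivable /derive ?partial1E => h1 h2; split; rewrite /derivable /derive ?partial1E.
Qed.

Lemma partial2P u x d : is_derive x ((0, 1) : R * R) u d <->
  is_derive x.2 (1 : R) (fun t => u (x.1, t)) d.
Proof.
by split=> -[]; rewrite /derivable /derive ?partial2E => h1 h2; split; rewrite /derivable /derive ?partial2E.
Qed.

Lemma C1_dx u u1 u2 : C1 u u1 u2 -> dx1 u = u1 /\ dx2 u = u2.
Proof.
case=> _ _ _ d1 d2; split; apply/funext => x.
  by have /partial1P[_ <-] := d1 x.
by have /partial2P[_ <-] := d2 x.
Qed.

Lemma Ck_C1 u : Ck 1 u -> C1 u (dx1 u) (dx2 u).
Proof.
case=> cu du c1 c2; split => // x.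
  by apply/partial1P; apply: DeriveDef => //; case: (du x).
by apply/partial2P; apply: DeriveDef => //; case: (du x).
Qed.

Lemma C1_Ck u u1 u2 : C1 u u1 u2 -> Ck 1 u.
Proof.
move=> c; have [e1 e2] := C1_dx c; case: c => cu c1 c2 d1 d2.
split; rewrite ?e1 ?e2 //= => x; split.
  by have /partial1P[] := d1 x.
by have /partial2P[] := d2 x.
Qed.

Lemma C1_comp (s s' : R -> R) u u1 u2 : (forall t, is_derive t (1 : R) s (s' t)) ->
  continuous s' -> C1 u u1 u2 ->
  C1 (fun x => s (u x)) (fun x => s' (u x) * u1 x) (fun x => s' (u x) * u2 x).
Proof.
move=> ds cs' [cu c1 c2 d1 d2].
have cs : continuous s by move=> t; apply: is_derive_continuous (ds t).
have cs'u : continuous (s' \o u) by move=> x; apply: continuous_comp; [exact: cu|exact: cs'].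
split => x.
- by apply: (@continuous_comp _ _ _ u s); [exact: cu|exact: cs].
- by apply: (@cvgM _ _ _ _ (s' \o u)); [exact: cs'u|exact: c1].
- by apply: (@cvgM _ _ _ _ (s' \o u)); [exact: cs'u|exact: c2].
- have h := is_derive1_comp (ds (u (x.1, x.2))) (d1 x).
  by rewrite -surjective_pairing in h.
- have h := is_derive1_comp (ds (u (x.1, x.2))) (d2 x).
  by rewrite -surjective_pairing in h.
Qed.

Lemma C1_add u u1 u2 v v1 v2 : C1 u u1 u2 -> C1 v v1 v2 ->
  C1 (fun x => u x + v x) (fun x => u1 x + v1 x) (fun x => u2 x + v2 x).
Proof.
move=> [cu c1 c2 d1 d2] [cv c1' c2' d1' d2']; split => x;
  first [by apply: cvgD; [exact: cu|exact: cv]|by apply: cvgD; [exact: c1|exact: c1']|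
         by apply: cvgD; [exact: c2|exact: c2']|exact: is_deriveD].
Qed.

Lemma C1_scale c u u1 u2 : C1 u u1 u2 ->
  C1 (fun x => c * u x) (fun x => c * u1 x) (fun x => c * u2 x).
Proof.
move=> [cu c1 c2 d1 d2]; split => x;
  first [by apply: cvgM; [exact: cvg_cst|exact: cu]|by apply: cvgM; [exact: cvg_cst|exact: c1]|
         by apply: cvgM; [exact: cvg_cst|exact: c2]|exact: is_deriveZ].
Qed.

Lemma C1_cst c : C1 (fun=> c) (fun=> 0) (fun=> 0).
Proof. by split => x; [exact: cvg_cst..|exact: is_derive_cst|exact: is_derive_cst]. Qed.

Lemma eq_C1 u u1 u2 v v1 v2 : u =1 v -> u1 =1 v1 -> u2 =1 v2 ->
  C1 u u1 u2 -> C1 v v1 v2.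
Proof. by move=> /funext -> /funext -> /funext ->. Qed.

Lemma C1_sub u u1 u2 v v1 v2 : C1 u u1 u2 -> C1 v v1 v2 ->
  C1 (fun x => u x - v x) (fun x => u1 x - v1 x) (fun x => u2 x - v2 x).
Proof.
move=> hu hv; apply: eq_C1 (C1_add hu (C1_scale (-1) hv)) => x; ring.
Qed.

Lemma C1_mul u u1 u2 v v1 v2 : C1 u u1 u2 -> C1 v v1 v2 ->
  C1 (fun x => u x * v x) (fun x => u1 x * v x + u x * v1 x)
     (fun x => u2 x * v x + u x * v2 x).
Proof.
move=> [cu c1 c2 d1 d2] [cv c1' c2' d1' d2']; split => x.
- by apply: cvgM; [exact: cu|exact: cv].
- by apply: cvgD; apply: cvgM; [exact: c1|exact: cv|exact: cu|exact: c1'].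
- by apply: cvgD; apply: cvgM; [exact: c2|exact: cv|exact: cu|exact: c2'].
- apply: is_derive_eq (is_deriveM (d1 x) (d1' x)) _.
  by rewrite /GRing.scale /= -surjective_pairing addrC [u1 x * _]mulrC.
- apply: is_derive_eq (is_deriveM (d2 x) (d2' x)) _.
  by rewrite /GRing.scale /= -surjective_pairing addrC [u2 x * _]mulrC.
Qed.

Lemma C1_snd (b b' : R -> R) : (forall t, is_derive t (1 : R) b (b' t)) ->
  continuous b' -> C1 (fun x => b x.2) (fun=> 0) (fun x => b' x.2).
Proof.
move=> db cb'; have cb : continuous b by move=> t; apply: is_derive_continuous (db t).
split => x.
- by apply: (@continuous_comp _ _ _ snd b); [exact: cvg_snd|exact: cb].
- exact: cvg_cst.
- by apply: (@continuous_comp _ _ _ snd b'); [exact: cvg_snd|exact: cb'].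
- exact: (is_derive_cst (b x.2)).
- exact: db.
Qed.

(** The reflection in the axis [x.2 = 1/2], which preserves the nozzle in case (i). *)
Definition flip_snd x : R * R := (x.1, 1 - x.2).

Lemma continuous_flip_snd : continuous flip_snd.
Proof.
move=> x; apply: (@cvg_pair _ _ _ _ (nbhs x.1) (nbhs (1 - x.2)) _ _ _ fst (fun z => 1 - z.2)); first exact: cvg_fst.
apply: (@continuous_comp _ _ _ snd (fun t => 1 - t)); first exact: cvg_snd.
by apply: is_derive_continuous (is_deriveB (is_derive_cst (1 : R) x.2 (1 : R)) (is_derive_id x.2 (1 : R))).
Qed.

Lemma C1_flip_snd u u1 u2 : C1 u u1 u2 ->
  C1 (fun x => u (flip_snd x)) (fun x => u1 (flip_snd x)) (fun x => - u2 (flip_snd x)).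
Proof.
have c v : continuous v -> continuous (v \o flip_snd).
  by move=> cv x; apply: continuous_comp; [exact: continuous_flip_snd|exact: cv].
move=> [cu c1 c2 d1 d2]; split => [||x|x|x]; [exact: c|exact: c|..].
- by apply: cvgN; exact: (c u2 c2).
- exact: (d1 (flip_snd x)).
- have h2 : is_derive x.2 (1 : R) (fun t => 1 - t) (-1).
    by apply: is_derive_eq (is_deriveB (is_derive_cst (1 : R) x.2 (1 : R)) (is_derive_id x.2 (1 : R))) _; rewrite sub0r.
  apply: is_derive_eq (@is_derive1_comp R (fun t => u (x.1, t)) (fun t => 1 - t) x.2 _ _ (d2 (flip_snd x)) h2) _.
  by rewrite mulrN1.
Qed.

Lemma cvg_pair_cst a b : (fun t => (t, b)) @ a --> ((a, b) : R * R).
Proof.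
by apply: (@cvg_pair _ _ _ _ (nbhs a) (nbhs b) _ _ _ id (cst b)); [exact: cvg_id|exact: cvg_cst].
Qed.

Lemma cvg_cst_pair a b : (fun t => (a, t)) @ b --> ((a, b) : R * R).
Proof.
by apply: (@cvg_pair _ _ _ _ (nbhs a) (nbhs b) _ _ _ (cst a) id); [exact: cvg_cst|exact: cvg_id].
Qed.

Lemma C1_local u u1 u2 :
  (forall x, exists v v1 v2, C1 v v1 v2 /\
     \forall y \near x, [/\ v y = u y, v1 y = u1 y & v2 y = u2 y]) ->
  C1 u u1 u2.
Proof.
move=> H.
have cvg_local (v w : R * R -> R) x : v @ x --> v x -> (\forall y \near x, v y = w y) -> w @ x --> w x.
  move=> cv e; have ex := nbhs_singleton e.
  rewrite -ex; apply: cvg_trans cv; apply: near_eq_cvg.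
  by apply: filterS e => y ->.
split => x; have [v [v1 [v2 [[cv c1 c2 d1 d2] e]]]] := H x.
- by apply: cvg_local (cv x) _; apply: filterS e => y [].
- by apply: cvg_local (c1 x) _; apply: filterS e => y [].
- by apply: cvg_local (c2 x) _; apply: filterS e => y [].
- have [_ <- _] := nbhs_singleton e; apply: near_eq_is_derive (d1 x).
  have c := @cvg_pair_cst x.1 x.2; rewrite -surjective_pairing in c.
  apply: (@filterS _ (nbhs x.1) _ _ _ _ (c _ e)) => t []; exact: id.
- have [_ _ <-] := nbhs_singleton e; apply: near_eq_is_derive (d2 x).
  have c := @cvg_cst_pair x.1 x.2; rewrite -surjective_pairing in c.
  apply: (@filterS _ (nbhs x.2) _ _ _ _ (c _ e)) => t []; exact: id.
Qed.

(* Cutting a function off along a horizontal line on which its argument vanishes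
   keeps it C^1, because [spos] is zero near zero. *)
Lemma C1_cut z z1 z2 e t : 0 < e -> C1 z z1 z2 -> (forall s, z (s, t) = 0) ->
  C1 (fun x => (x.2 < t)%R%:R * spos e (z x))
     (fun x => (x.2 < t)%R%:R * (spos' e (z x) * z1 x))
     (fun x => (x.2 < t)%R%:R * (spos' e (z x) * z2 x)).
Proof.
move=> e0 cz zt; apply: C1_local => x.
have c2 : {for x, continuous (snd : R * R -> R)} by exact: cvg_snd.
have [xt|tx|xt] := ltgtP x.2 t.
- exists (fun x => spos e (z x)), (fun x => spos' e (z x) * z1 x), (fun x => spos' e (z x) * z2 x).
  split; first by apply: C1_comp => // [s|]; [exact: is_derive_spos|exact: continuous_spos'].
  have : \forall y \near x, y.2 < t by exact: cvgr_lt c2 _ xt.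
  by apply: filterS => y ->; rewrite !mul1r.
- exists (fun=> 0), (fun=> 0), (fun=> 0); split; first exact: C1_cst.
  have : \forall y \near x, t < y.2 by exact: cvgr_gt c2 _ tx.
  by apply: filterS => y ty; rewrite ltNge (ltW ty) /= !mul0r.
- exists (fun=> 0), (fun=> 0), (fun=> 0); split; first exact: C1_cst.
  have zx : z x = 0 by rewrite (surjective_pairing x) xt zt.
  have : \forall y \near x, z y < e.
    by case: cz => /(_ x) cz _ _ _ _; apply: cvgr_lt cz _ _; rewrite zx.
  by apply: filterS => y /ltW ze; rewrite spos_eq0// spos'_eq0// !mul0r !mulr0.
Qed.

End Plane.

(** * Smooth bump functions *)

Section Bump.
Context {R : realType}.
Implicit Types (p q : R -> R) (a b c t : R) (k n : nat).

Fixpoint smooth k p : Prop :=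
  if k is k'.+1 then
    exists p', (forall t, is_derive t (1 : R) p (p' t)) /\ smooth k' p'
  else continuous p.

Lemma smoothW k p : smooth k.+1 p -> smooth k p.
Proof.
elim: k p => [|k IH] p [p' [dp sp']].
  by move=> t; apply: is_derive_continuous (dp t).
by exists p'; split => //; exact: IH.
Qed.

Lemma smooth_add k p q : smooth k p -> smooth k q -> smooth k (fun t => p t + q t).
Proof.
elim: k p q => [|k IH] p q /=.
  by move=> cp cq t; apply: cvgD; [exact: cp|exact: cq].
move=> [p' [dp sp']] [q' [dq sq']]; exists (fun t => p' t + q' t); split; last exact: IH.
by move=> t; exact: is_deriveD.
Qed.

Lemma smooth_scale k c p : smooth k p -> smooth k (fun t => c * p t).
Proof.
elim: k p => [|k IH] p /=.
  by move=> cp t; apply: cvgM; [exact: cvg_cst|exact: cp].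
move=> [p' [dp sp']]; exists (fun t => c * p' t); split; last exact: IH.
by move=> t; exact: is_deriveZ.
Qed.

Lemma smooth_mul k p q : smooth k p -> smooth k q -> smooth k (fun t => p t * q t).
Proof.
elim: k p q => [|k IH] p q.
  by move=> cp cq t; apply: cvgM; [exact: cp|exact: cq].
move=> sp sq; have [p' [dp sp']] := sp; have [q' [dq sq']] := sq.
exists (fun t => p' t * q t + p t * q' t); split.
  move=> t; apply: is_derive_eq (is_deriveM (dp t) (dq t)) _.
  by rewrite /GRing.scale /= addrC [p' t * _]mulrC.
by apply: smooth_add; apply: IH => //; exact: smoothW.
Qed.

Lemma smooth_affine k a b p : smooth k p -> smooth k (fun t => p (a * t + b)).
Proof.
have da t : is_derive t (1 : R) (fun t => a * t + b) a.
  apply: is_derive_eq (is_deriveD (is_deriveZ a (is_derive_id t (1 : R))) (is_derive_cst b t (1 : R))) _.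
  by rewrite addr0 /GRing.scale /= mulr1.
elim: k p => [|k IH] p /=.
  move=> cp t; apply: (@continuous_comp _ _ _ (fun t => a * t + b) p); last exact: cp.
  exact: is_derive_continuous (da t).
move=> [p' [dp sp']]; exists (fun t => a * p' (a * t + b)); split.
  move=> t; apply: is_derive_eq (@is_derive1_comp R p (fun t => a * t + b) t _ _ (dp _) (da t)) _.
  by rewrite mulrC.
by apply: smooth_scale; exact: IH.
Qed.

(** The powers of [1 / t] make the span of this family closed under differentiation, which reduces
    smoothness to differentiability. *)
Definition flat n t : R := if 0 < t then t^-1 ^+ n * expR (- t^-1) else 0.

(** Keep only the term of degree [n + 2] in the exponential series at [1 / t]. The resulting
    quadratic bound is what [is_derive_quad] asks for at 0. *)
Lemma flat_le n t : `|flat n t| <= (n.+2)`!%:R * t ^+ 2.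
Proof.
rewrite /flat; case: ifPn => [t0|_]; last by rewrite normr0 mulr_ge0 ?sqr_ge0.
have s0 : 0 < t^-1 by rewrite invr_gt0.
rewrite ger0_norm ?mulr_ge0 ?exprn_ge0 ?expR_ge0 ?(ltW s0)//.
have : t^-1 ^+ n.+2 / (n.+2)`!%:R <= expR t^-1.
  have := @expR_ge1Dxn R t^-1 n.+1 (ltW s0).
  by apply: le_trans; rewrite lerDr.
rewrite ler_pdivrMr ?ltr0n ?fact_gt0// expRN => h.
rewrite ler_pdivrMr ?expR_gt0// -mulrA.
rewrite (_ : t^-1 ^+ n = t ^+ 2 * t^-1 ^+ n.+2); last first.
  by rewrite -(addn2 n) exprD mulrCA -exprMn mulfV ?expr1n ?mulr1// gt_eqF.
by rewrite [leRHS]mulrCA ler_pM2l ?exprn_gt0// [_ * expR _]mulrC.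
Qed.

Lemma is_derive_flat n t :
  is_derive t (1 : R) (flat n) (flat n.+2 t + - n%:R * flat n.+1 t).
Proof.
have [t0|t0|->] := ltgtP t 0.
- apply: (@near_eq_is_derive _ _ _ (fun=> 0)).
    have : \forall s \near t, s < 0 by exact: lt_nbhsl.
    by apply: filterS => s s0; rewrite /flat ltNge (ltW s0).
  by rewrite /flat !ltNge !(ltW t0) /= mulr0 addr0; exact: is_derive_cst.
- apply: (@near_eq_is_derive _ _ _ (fun s : R^o => (s^-1 ^+ n * expR (- s^-1) : R^o))).
    have : \forall s \near t, 0 < s by exact: lt_nbhsr.
    by apply: filterS => s s0; rewrite /flat s0.
  rewrite /flat !t0.
  have dV : is_derive t (1 : R) (fun s => s^-1) (- t ^- 2).
    have := is_deriveV (lt0r_neq0 t0) (is_derive_id t (1 : R)).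
    by move=> h; apply: is_derive_eq h _; rewrite /GRing.scale /= mulr1.
  have dE := is_derive1_comp (is_derive_expR _) (is_deriveN dV).
  have dX := is_deriveX n dV; rewrite exprfctE in dX.
  apply: is_derive_eq (is_deriveM dX dE) _.
  rewrite /GRing.scale /= -exprVn (_ : (- _) t = - t^-1)//.
  by case: (n) => [|m]; rewrite ?exprS /=; ring.
- rewrite /flat ltxx mulr0 addr0 -/(flat n).
  apply: (@is_derive_quad _ _ _ _ (n.+2)`!%:R) => h _.
  by rewrite addr0 mulr0 subr0 {2}/flat ltxx subr0; exact: flat_le.
Qed.

Lemma smooth_flat k n : smooth k (flat n).
Proof.
elim: k n => [|k IH] n; first by move=> t; apply: is_derive_continuous (is_derive_flat n t).
exists (fun t => flat n.+2 t + - n%:R * flat n.+1 t); split; first exact: is_derive_flat.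
by apply: smooth_add => //; exact: smooth_scale.
Qed.

(** Growing [n] steepens both ends: the bumps take values in [[0, 1]], vanish outside []a, b[] and
    tend pointwise to its indicator. *)
Definition itv_bump a b n t : R :=
  flat 0 (n.+1%:R * t + - (n.+1%:R * a)) * flat 0 (- n.+1%:R * t + n.+1%:R * b).

Lemma smooth_bump k a b n : smooth k (itv_bump a b n).
Proof. by apply: smooth_mul; apply: smooth_affine; exact: smooth_flat. Qed.

Lemma flat0_bound t : 0 <= flat 0 t <= 1.
Proof.
rewrite /flat; case: ifP => t0; last by rewrite lexx ler01.
rewrite expr0 mul1r expR_ge0 /= -expR0 ler_expR oppr_le0 invr_ge0.
exact: ltW.
Qed.

Lemma flat0_eq0 t : t <= 0 -> flat 0 t = 0.
Proof. by move=> t0; rewrite /flat ltNge t0. Qed.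

Lemma itv_bump_bound a b n t : 0 <= itv_bump a b n t <= 1.
Proof.
have /andP[h1 h2] := flat0_bound (n.+1%:R * t + - (n.+1%:R * a)).
have /andP[h3 h4] := flat0_bound (- n.+1%:R * t + n.+1%:R * b).
by rewrite mulr_ge0// mulr_ile1.
Qed.

Lemma itv_bump_eq0 a b n t : ~~ (a < t < b) -> itv_bump a b n t = 0.
Proof.
have n0 : 0 < n.+1%:R :> R by [].
rewrite negb_and -!leNgt => /orP[h|h]; rewrite /itv_bump.
  by rewrite flat0_eq0 ?mul0r// subr_le0 ler_pM2l.
by rewrite [X in _ * X]flat0_eq0 ?mulr0// addrC mulNr subr_le0 ler_pM2l.
Qed.

Lemma flat0_cvg a : 0 < a -> flat 0 (n.+1%:R * a) @[n --> \oo] --> (1 : R).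
Proof.
move=> a0.
have -> : (fun n => flat 0 (n.+1%:R * a)) = (fun n => expR (- ((n.+1%:R)^-1 * a^-1))).
  by apply/funext => n; rewrite /flat mulr_gt0// expr0 mul1r invfM.
rewrite -[X in _ --> X]expR0.
apply: (cvg_comp _ expR _ (@continuous_expR R 0)).
rewrite -oppr0; apply: cvgN; rewrite -(mul0r a^-1).
by apply: cvgM; [exact: cvg_harmonic|exact: cvg_cst].
Qed.

Lemma itv_bump_cvg a b t : itv_bump a b n t @[n --> \oo] --> ((a < t < b)%R%:R : R).
Proof.
have [/andP[h1 h2]|h] := boolP (a < t < b); last first.
  by apply: cvg_near_cst; apply: nearW => n; rewrite itv_bump_eq0.
rewrite -[X in _ --> X]mulr1; apply: cvgM.
  under eq_fun do rewrite -mulrBr.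
  by apply: flat0_cvg; rewrite subr_gt0.
under eq_fun do rewrite addrC mulNr -mulrBr.
by apply: flat0_cvg; rewrite subr_gt0.
Qed.

End Bump.

(** * Weak gradients *)

Section WeakGradient.
Context {R : realType}.
Implicit Types (u v w phi : R * R -> R) (D : set (R * R)) (x y : R * R) (s t a b c : R).
Local Notation plane := (measurableTypeR R * measurableTypeR R)%type.
Local Notation leb2 := (@lebesgue_measure R \x @lebesgue_measure R)%E.
Local Notation leb := (@lebesgue_measure R).

Lemma integral_derive (F f : R -> R) a b : a <= b ->
  (forall t, is_derive t (1 : R) F (f t)) -> continuous f ->
  (\int[leb]_(t in `[a, b]) (f t)%:E = (F b - F a)%R%:E)%E.
Proof.
rewrite le_eqVlt => /predU1P[<- _ _|ab dF cf].
  by rewrite set_itv1 integral_set1 subrr.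
have cF t : {for t, continuous F} by exact: is_derive_continuous (dF t).
rewrite EFinB; apply: continuous_FTC2 => //.
- exact: continuous_subspaceT.
- split=> [t _||].
  + by have [] := dF t.
  + by apply: cvg_at_right_filter; exact: cF.
  + by apply: cvg_at_left_filter; exact: cF.
- by move=> t _; rewrite derive1E; have [_] := dF t.
Qed.

Definition box c : set plane := `[- c, c]%classic `*` `[- c, c]%classic.

Lemma measurable_box c : measurable (box c).
Proof. by apply: measurableX; exact: measurable_itv. Qed.

Lemma box_finite c : (leb2 (box c) < +oo)%E.
Proof.
rewrite product_measure1E; [|exact: measurable_itv|exact: measurable_itv].
have h : (leb `[(- c)%R, c]%classic < +oo)%E.
  have := @lebesgue_measure_itv R `[- c, c]; rewrite /= => ->.
  by case: ifP => _; rewrite ?ltry// -EFinB ltry.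
by rewrite lte_mul_pinfty// ge0_fin_numE.
Qed.

Lemma boxP c x : box c x <-> `|x.1| <= c /\ `|x.2| <= c.
Proof. by rewrite /box /= !in_itv /= -!ler_norml. Qed.

Lemma integrable_boxed w c : continuous w ->
  (forall x, ~ box c x -> w x = 0) -> leb2.-integrable setT (EFin \o w).
Proof.
move=> cw w0.
have [C wC] := continuous2_bounded c cw.
have -> : EFin \o w = (EFin \o w) \_ (box c).
  apply/funext => x; rewrite patchE; case: ifPn => // /negP xb.
  by rewrite /= w0// => h; apply: xb; rewrite inE.
apply/(integrable_mkcond _ (measurable_box c)).
apply: (@integrable_bounded _ _ _ _ _ (measurable_box c) (box_finite c) _ C).
  by apply: measurable_funTS; exact: continuous_measurable_plane.
by move=> x /boxP[x1 x2]; exact: wC.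
Qed.

Lemma Rint_partial_boxed w w1 w2 c : C1 w w1 w2 ->
  (forall x, ~ box c x -> w x = 0) ->
  (forall x, ~ box c x -> w1 x = 0) ->
  (forall x, ~ box c x -> w2 x = 0) ->
  \int[leb2]_x w1 x = 0 /\ \int[leb2]_x w2 x = 0.
Proof.
move=> [cw cw1 cw2 d1 d2] w0 w10 w20.
have zero (g g' : R -> R) : (forall t, is_derive t (1 : R) g (g' t)) -> continuous g' ->
    (forall t, c < `|t| -> g t = 0) -> (forall t, c < `|t| -> g' t = 0) ->
    (\int[leb]_t (g' t)%:E = 0)%E.
  (* The endpoints must lie strictly outside the box, where [g] vanishes, and [e] must be
     nonnegative even if [c] is negative. *)
  move=> dg cg' g0 g'0; pose e := `|c| + 1.
  have ce t : e <= `|t| -> c < `|t|.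
    by apply: lt_le_trans; rewrite /e; have := ler_norm c; lra.
  have e0 : 0 <= e by rewrite /e; have := normr_ge0 c; lra.
  transitivity (\int[leb]_(t in `[(- e)%R, e]) (g' t)%:E)%E.
    rewrite [RHS]integral_mkcond; apply: eq_integral => t _; rewrite patchE.
    case: ifPn => // /negP h; rewrite g'0//; apply: ce; rewrite leNgt; apply/negP => h'.
    by apply: h; rewrite inE /= in_itv /= -ler_norml ltW.
  rewrite (integral_derive _ dg cg'); last by lra.
  by rewrite !g0 ?subrr//; apply: ce; rewrite ?normrN ger0_norm.
have box1 x : c < `|x.1| -> ~ box c x by move=> h /boxP[]; rewrite leNgt h.
have box2 x : c < `|x.2| -> ~ box c x by move=> h /boxP[_]; rewrite leNgt h.
split; rewrite /Rintegral.
- rewrite -(integral21_prod_meas1 (integrable_boxed cw1 w10)).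
  rewrite /fubini_G integral0_eq// => t _.
  apply: (zero (fun s => w (s, t))) => [s|s|s h|s h].
  + exact: (d1 (s, t)).
  + by apply: (@continuous_comp _ _ _ (fun s => (s, t)) w1); [exact: cvg_pair_cst|exact: cw1].
  + by apply: w0; exact: box1.
  + by apply: w10; exact: box1.
- rewrite -(integral12_prod_meas1 (integrable_boxed cw2 w20)).
  rewrite /fubini_F integral0_eq// => t _.
  apply: (zero (fun s => w (t, s))) => [s|s|s h|s h].
  + exact: (d2 (t, s)).
  + by apply: (@continuous_comp _ _ _ (fun s => (t, s)) w2); [exact: cvg_cst_pair|exact: cw2].
  + by apply: w0; exact: box2.
  + by apply: w20; exact: box2.
Qed.

Lemma test_fun_support D phi : test_fun D phi -> exists (K : set (R * R)) c,
  [/\ K `<=` D, forall x, K x -> box c x &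
      forall x, ~ K x -> [/\ phi x = 0, dx1 phi x = 0 & dx2 phi x = 0]].
Proof.
move=> [_ cK KD]; set K := closure _ in cK KD.
have [M [_ HM]] := compact_bounded cK.
exists K, (M + 1); split => // x.
  move=> Kx; have /= := HM (M + 1) ltac:(by rewrite ltrDl) x Kx.
  rewrite /Num.norm /= => h; apply/boxP.
  by split; apply: le_trans h; rewrite le_max lexx ?orbT.
move=> nKx.
have oK : open (~` K) by apply: closed_openC; exact: closed_closure.
have e : \forall y \near x, phi y = 0.
  have : nbhs x (~` K) by exact: open_nbhs_nbhs.
  apply: filterS => y nKy; apply: contrapT => /eqP h; apply: nKy.
  exact: subset_closure.
split; first exact: nbhs_singleton e.
- rewrite /dx1 (@near_eq_derive _ _ _ _ (fun=> 0)) ?derive_cst//.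
- rewrite /dx2 (@near_eq_derive _ _ _ _ (fun=> 0)) ?derive_cst//.
Qed.

Lemma test_fun_C1 D phi : test_fun D phi -> C1 phi (dx1 phi) (dx2 phi).
Proof. by case=> /(_ 1%N) /Ck_C1. Qed.

Lemma Rint_supported D w : (forall x, ~ D x -> w x = 0) ->
  \int[leb2]_(x in D) w x = \int[leb2]_x w x.
Proof.
move=> w0; rewrite Rintegral_mkcond; congr (Rintegral _ _ _).
apply/funext => x; rewrite patchE; case: ifPn => // /negP xD.
by rewrite w0// => h; apply: xD; rewrite inE.
Qed.

Lemma Rint_by_parts D v v1 v2 phi : C1 v v1 v2 -> test_fun D phi ->
  (\int[leb2]_(x in D) (v x * dx1 phi x) = - \int[leb2]_(x in D) (v1 x * phi x)) /\
  (\int[leb2]_(x in D) (v x * dx2 phi x) = - \int[leb2]_(x in D) (v2 x * phi x)).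
Proof.
move=> cv tphi; have [K [c [KD Kc K0]]] := test_fun_support tphi.
have cphi := test_fun_C1 tphi.
have out x : ~ D x -> [/\ phi x = 0, dx1 phi x = 0 & dx2 phi x = 0].
  by move=> nDx; apply: K0 => /KD.
have outb x : ~ box c x -> [/\ phi x = 0, dx1 phi x = 0 & dx2 phi x = 0].
  by move=> nDx; apply: K0 => /Kc.
rewrite !(@Rint_supported D); try by move=> x /out[h1 h2 h3]; rewrite ?h1 ?h2 ?h3 mulr0.
have [i1 i2] : \int[leb2]_x (v1 x * phi x + v x * dx1 phi x) = 0 /\
    \int[leb2]_x (v2 x * phi x + v x * dx2 phi x) = 0.
  by apply: (Rint_partial_boxed (C1_mul cv cphi)) => x /outb[h1 h2 h3];
    rewrite ?h1 ?h2 ?h3 !mulr0 ?addr0.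
have [cv0 cv1 cv2 _ _] := cv; have [cp0 cp1 cp2 _ _] := cphi.
have I (p q : R * R -> R) : continuous p -> continuous q -> (forall x, ~ box c x -> q x = 0) ->
    leb2.-integrable setT (EFin \o (fun x => p x * q x)).
  move=> cp cq q0; apply: (@integrable_boxed _ c) => [x|x /q0 ->]; last by rewrite mulr0.
  by apply: cvgM; [exact: cp|exact: cq].
split; apply/eqP; rewrite -addr_eq0 addrC -Rint_add ?i1 ?i2//; try exact: measurableT;
  by apply: I => // x /outb[].
Qed.

Section Bounded.
Variables (D : set plane) (c0 : R).
Hypothesis mD : measurable D.
Hypothesis Dbox : forall x, D x -> box c0 x.

Lemma bounded_finite : (leb2 D < +oo)%E.
Proof.
by apply: le_lt_trans (box_finite c0); apply: le_measure; rewrite ?inE//; exact: measurable_box.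
Qed.

Lemma L2P u : L2 D u <-> sq_int leb2 D u.
Proof.
split=> [[mu_ iu]|[mu_ iu]]; split => //.
- apply: lt_integrable => //; first exact: measurable_funX.
  by move=> x _; exact: sqr_ge0.
- exact: integrable_lt.
Qed.

Lemma continuous_sq_int w : continuous w -> sq_int leb2 D w.
Proof.
move=> cw; have [C wC] := continuous2_bounded c0 cw.
apply: (@sq_int_bounded _ _ _ _ _ mD bounded_finite _ C).
  by apply: measurable_funTS; exact: continuous_measurable_plane.
by move=> x /Dbox /boxP[x1 x2]; exact: wC.
Qed.

Lemma test_fun_bounded phi : test_fun D phi -> exists2 C, 0 < C & forall x,
  [/\ `|phi x| <= C, `|dx1 phi x| <= C & `|dx2 phi x| <= C].
Proof.
move=> tphi; have [K [c [KD Kc K0]]] := test_fun_support tphi.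
have [cp0 cp1 cp2 _ _] := test_fun_C1 tphi.
have [C h] := continuous2_bounded c cp0; have [C1 h1] := continuous2_bounded c cp1.
have [C2 h2] := continuous2_bounded c cp2.
exists (`|C| + `|C1| + `|C2| + 1).
  by rewrite ltr_wpDl// !addr_ge0.
move=> x; have [C0 C10 C20] := And3 (normr_ge0 C) (normr_ge0 C1) (normr_ge0 C2).
have [a0 a1 a2] := And3 (ler_norm C) (ler_norm C1) (ler_norm C2).
have [/Kc/boxP[x1 x2]|/K0[-> -> ->]] := EM (K x); last by rewrite normr0; split; lra.
by have := h x x1 x2; have := h1 x x1 x2; have := h2 x x1 x2; split; lra.
Qed.

Definition gap u (G : R * R -> R * R) v v1 v2 x :=
  (v x - u x) ^+ 2 + (v1 x - (G x).1) ^+ 2 + (v2 x - (G x).2) ^+ 2.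

Lemma integrable_gap u G v v1 v2 : sq_int leb2 D u ->
  sq_int leb2 D (fun x => (G x).1) -> sq_int leb2 D (fun x => (G x).2) ->
  C1 v v1 v2 -> leb2.-integrable D (EFin \o gap u G v v1 v2).
Proof.
move=> su s1 s2 [cv c1 c2 _ _].
have [_ h0] := sq_int_sub mD (continuous_sq_int cv) su.
have [_ h1] := sq_int_sub mD (continuous_sq_int c1) s1.
have [_ h2] := sq_int_sub mD (continuous_sq_int c2) s2.
exact: (integrable_add mD (integrable_add mD h0 h1) h2).
Qed.

Definition approximable u G := forall e, 0 < e -> exists v v1 v2,
  C1 v v1 v2 /\ \int[leb2]_(x in D) gap u G v v1 v2 x < e.

(** Integration by parts holds for C^1 functions and is continuous in L^2. This replaces the chain
    rule in Sobolev spaces: to differentiate a truncation of the minimizer it is enough to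
    approximate it. *)
Lemma approximable_weak_gradient u G : sq_int leb2 D u ->
  sq_int leb2 D (fun x => (G x).1) -> sq_int leb2 D (fun x => (G x).2) ->
  approximable u G -> weak_gradient D u G.
Proof.
move=> su s1 s2 app; split; [exact/L2P|exact/L2P|exact/L2P|] => phi tphi.
have [C C0 Cphi] := test_fun_bounded tphi.
have [cp0 cp1 cp2 _ _] := test_fun_C1 tphi.
have m0 : 0 <= fine (leb2 D) by rewrite fine_ge0.
have key (g psi dpsi : R * R -> R) : sq_int leb2 D g -> continuous psi -> continuous dpsi ->
    (forall x, `|psi x| <= C /\ `|dpsi x| <= C) ->
    (forall e, 0 < e -> exists v w, [/\ continuous v, continuous w,
      \int[leb2]_(x in D) ((v x - u x) ^+ 2 + (w x - g x) ^+ 2) < e &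
      \int[leb2]_(x in D) (v x * dpsi x) = - \int[leb2]_(x in D) (w x * psi x)]) ->
    \int[leb2]_(x in D) (u x * dpsi x) = - \int[leb2]_(x in D) (g x * psi x).
  move=> sg cpsi cdpsi bd H; apply/eqP; rewrite -subr_eq0 opprK -normr_le0.
  apply/ler_addgt0Pr => e e0; rewrite add0r.
  (* Young's inequality in the form [|z| <= k / 2 + z ^ 2 / k] stands in for Cauchy-Schwarz. With
     this [k], the measure term and the distance term contribute at most [e / 2] each. *)
  pose k := e / (2 * C * (fine (leb2 D) + 1)).
  have k0 : 0 < k by rewrite divr_gt0// !mulr_gt0//; lra.
  have [v [w [cv cw vw ibp]]] := H (k * (e / (2 * C))) ltac:(by apply: mulr_gt0 => //; apply: divr_gt0 => //; lra).
  have spsi := continuous_sq_int cpsi; have sdpsi := continuous_sq_int cdpsi.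
  have sv := continuous_sq_int cv; have sw := continuous_sq_int cw.
  have I1 := sq_int_mul mD su sdpsi; have I2 := sq_int_mul mD sg spsi.
  have I3 := sq_int_mul mD sv sdpsi; have I4 := sq_int_mul mD sw spsi.
  have [_ J1] := sq_int_sub mD sv su; have [_ J2] := sq_int_sub mD sw sg.
  have J := integrable_add mD J1 J2.
  have -> : \int[leb2]_(x in D) (u x * dpsi x) + \int[leb2]_(x in D) (g x * psi x) =
     \int[leb2]_(x in D) (u x * dpsi x + g x * psi x - (v x * dpsi x + w x * psi x)).
    rewrite Rint_sub ?Rint_add ?ibp//; last 2 first.
    - exact: integrable_add.
    - exact: integrable_add.
    ring.
  apply: le_trans (Rint_norm mD (integrable_sub mD (integrable_add mD I1 I2) (integrable_add mD I3 I4))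
    (integrable_scale mD C (integrable_add mD (integrable_const mD bounded_finite k) (integrable_scale mD k^-1 J))) _) _.
    move=> x _; have [b1 b2] := bd x.
    rewrite (_ : _ - _ = (u x - v x) * dpsi x + (g x - w x) * psi x); last by ring.
    apply: le_trans (ler_normD _ _) _; rewrite !normrM.
    have : `|u x - v x| + `|g x - w x| <= k + k^-1 * ((v x - u x) ^+ 2 + (w x - g x) ^+ 2).
      have Y (z : R) : `|z| <= k / 2 + k^-1 * z ^+ 2.
        rewrite -(ler_pM2l k0) mulrDr mulVKf ?gt_eqF// -real_normK ?num_real//.
        have := sqr_ge0 (k / 2 - `|z|); have := sqr_ge0 k; nra.
      have := Y (u x - v x); have := Y (g x - w x).
      rewrite -(sqrrN (u x - v x)) -(sqrrN (g x - w x)) !opprB; lra.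
    move=> h; apply: le_trans (_ : C * (`|u x - v x| + `|g x - w x|) <= _); last by rewrite ler_pM2l.
    by rewrite mulrDr lerD// mulrC ler_wpM2r.
  rewrite Rint_scale//; last first.
    exact: (integrable_add mD (integrable_const mD bounded_finite k) (integrable_scale mD k^-1 J)).
  rewrite Rint_add//; [|exact: (integrable_const mD bounded_finite k)|exact: integrable_scale].
  rewrite Rint_scale// Rintegral_cst//.
  have h1 : k * (fine (leb2 D) + 1) = e / (2 * C) by rewrite /k; field; rewrite !gt_eqF//; lra.
  have h2 : k^-1 * \int[leb2]_(x in D) ((v x - u x) ^+ 2 + (w x - g x) ^+ 2) <= e / (2 * C).
    by rewrite ler_pdivrMl// ltW.
  have h3 : k * fine (leb2 D) <= e / (2 * C) by rewrite -h1 ler_pM2l//; lra.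
  apply: le_trans (_ : C * (e / (2 * C) + e / (2 * C)) <= _); first by rewrite ler_pM2l// lerD.
  by rewrite le_eqVlt; apply/orP; left; apply/eqP; field; rewrite gt_eqF.
have sub v v1 v2 e : C1 v v1 v2 -> \int[leb2]_(x in D) gap u G v v1 v2 x < e ->
    \int[leb2]_(x in D) ((v x - u x) ^+ 2 + (v1 x - (G x).1) ^+ 2) < e /\
    \int[leb2]_(x in D) ((v x - u x) ^+ 2 + (v2 x - (G x).2) ^+ 2) < e.
  move=> cv; have ig := integrable_gap su s1 s2 cv; case: cv => cv c1 c2 _ _ le.
  have [_ J0] := sq_int_sub mD (continuous_sq_int cv) su.
  have [_ J1] := sq_int_sub mD (continuous_sq_int c1) s1.
  have [_ J2] := sq_int_sub mD (continuous_sq_int c2) s2.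
  by split; apply: le_lt_trans le; apply: Rint_le => //;
    [exact: integrable_add| |exact: integrable_add|] => x _; rewrite /gap;
    have := sqr_ge0 (v2 x - (G x).2); have := sqr_ge0 (v1 x - (G x).1); lra.
split; apply: key => //; try by move=> x; have [] := Cphi x.
- move=> e /app[v [v1 [v2 [cv ve]]]]; exists v, v1.
  have [h1 h2] := sub _ _ _ _ cv ve; have [ibp _] := Rint_by_parts cv tphi.
  by case: cv.
- move=> e /app[v [v1 [v2 [cv ve]]]]; exists v, v2.
  have [h1 h2] := sub _ _ _ _ cv ve; have [_ ibp] := Rint_by_parts cv tphi.
  by case: cv.
Qed.

End Bounded.

End WeakGradient.

(** * Uniqueness of weak gradients *)

Section Uniqueness.
Context {R : realType}.
Implicit Types (u v w h phi : R * R -> R) (x y : R * R) (s t a b c : R).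
Local Notation plane := (measurableTypeR R * measurableTypeR R)%type.
Local Notation leb2 := (@lebesgue_measure R \x @lebesgue_measure R)%E.

Lemma ae_imply (P P' : plane -> Prop) : (forall x, P x -> P' x) ->
  {ae leb2, forall x, P x} -> {ae leb2, forall x, P' x}.
Proof. by move=> PP'; apply: negligibleS => x; apply: contra_not; exact: PP'. Qed.

Lemma smooth_continuous k (p : R -> R) : smooth k p -> continuous p.
Proof. by elim: k p => [//|k IH] p /smoothW /IH. Qed.

Lemma C1_tensor (p p' q q' : R -> R) : (forall t, is_derive t (1 : R) p (p' t)) ->
  (forall t, is_derive t (1 : R) q (q' t)) -> continuous p' -> continuous q' ->
  C1 (fun x => p x.1 * q x.2) (fun x => p' x.1 * q x.2) (fun x => p x.1 * q' x.2).
Proof.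
move=> dp dq cp' cq'.
have cp : continuous p by move=> t; apply: is_derive_continuous (dp t).
have cq : continuous q by move=> t; apply: is_derive_continuous (dq t).
have c (g k : R -> R) : continuous g -> continuous k ->
    continuous (fun x : R * R => g x.1 * k x.2).
  move=> cg ck x; apply: cvgM.
    by apply: (@continuous_comp _ _ _ fst g); [exact: cvg_fst|exact: cg].
  by apply: (@continuous_comp _ _ _ snd k); [exact: cvg_snd|exact: ck].
split => [|||x|x]; try exact: c.
- apply: is_derive_eq (is_deriveM (dp x.1) (is_derive_cst (q x.2) x.1 (1 : R))) _.
  by rewrite /GRing.scale /= mulr0 add0r mulrC.
- apply: is_derive_eq (is_deriveM (is_derive_cst (p x.1) x.2 (1 : R)) (dq x.2)) _.
  by rewrite /GRing.scale /= mulr0 addr0.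
Qed.

(** The partials of p(x_1) q(x_2) are again products of this kind, which closes the induction; the
    extra order of smoothness lets [C1_tensor] apply at every stage. *)
Lemma Ck_tensor k (p q : R -> R) : smooth k.+1 p -> smooth k.+1 q ->
  Ck k (fun x => p x.1 * q x.2).
Proof.
elim: k p q => [|k IH] p q sp sq.
  have [p' [dp cp']] := sp; have [q' [dq cq']] := sq.
  by have [] := C1_tensor dp dq cp' cq'.
have [p' [dp sp']] := sp; have [q' [dq sq']] := sq.
have {}sp' : smooth k.+1 p' := sp'; have {}sq' : smooth k.+1 q' := sq'.
have C := C1_tensor dp dq (smooth_continuous sp') (smooth_continuous sq').
have [e1 e2] := C1_dx C; have [cu du _ _] := C1_Ck C.
by split => //; rewrite ?e1 ?e2; apply: IH => //; exact: smoothW.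
Qed.

Lemma test_fun_bump (D : set (R * R)) a1 b1 a2 b2 n :
  (forall x, a1 <= x.1 <= b1 -> a2 <= x.2 <= b2 -> D x) ->
  test_fun D (fun x => itv_bump a1 b1 n x.1 * itv_bump a2 b2 n x.2).
Proof.
move=> abD; set phi := (phi in test_fun _ phi).
pose K : set (R * R) := `[a1, b1]%classic `*` `[a2, b2]%classic.
have cK : compact K by apply: compact_setX; exact: segment_compact.
have hK : closed K by apply: compact_closed => //; exact: norm_hausdorff.
have sub : closure [set x | phi x != 0] `<=` K.
  move=> x; rewrite closureE; apply; split => // y /= phiy.
  split; rewrite /= in_itv /=; apply: contraNT phiy => h; apply/eqP; rewrite /phi.
    rewrite itv_bump_eq0 ?mul0r//; apply: contra h => /andP[/ltW -> /ltW ->]//.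
  rewrite [X in _ * X]itv_bump_eq0 ?mulr0//; apply: contra h => /andP[/ltW -> /ltW ->]//.
split.
- by move=> k; apply: Ck_tensor; exact: smooth_bump.
- by apply: subclosed_compact sub => //; exact: closed_closure.
- by move=> x /sub[]; rewrite /= !in_itv /=; exact: abD.
Qed.

Definition open_box a1 b1 a2 b2 : set plane := `]a1, b1[%classic `*` `]a2, b2[%classic.

Lemma measurable_open_box a1 b1 a2 b2 : measurable (open_box a1 b1 a2 b2).
Proof. by apply: measurableX; exact: measurable_itv. Qed.

Section Zero.
Variables (D : set plane) (c0 : R).
Hypothesis mD : measurable D.
Hypothesis Dbox : forall x, D x -> box c0 x.
Variable h : R * R -> R.
Hypothesis sh : sq_int leb2 D h.
Hypothesis h0 : forall phi, test_fun D phi -> \int[leb2]_(x in D) (h x * phi x) = 0.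

Let ih : leb2.-integrable D (EFin \o h).
Proof. exact: sq_int_integrable mD (bounded_finite mD Dbox) _ sh. Qed.

Let ih_indic (X : set plane) : measurable X ->
  leb2.-integrable D (EFin \o (fun x => h x * \1_X x)).
Proof.
move=> mX; apply: (integrable_dominated mD _ (integrable_norm ih)).
  by apply: measurable_funM; [case: sh|exact: measurable_indic].
by move=> x _; rewrite normrM ler_piMr//= indicE; case: (_ \in _); rewrite ?normr1 ?normr0.
Qed.

(** The products of bumps are test functions bounded by 1 that tend to the indicator of the
    rectangle, so dominated convergence applies. *)
Lemma Rint_open_box a1 b1 a2 b2 :
  (forall x, a1 <= x.1 <= b1 -> a2 <= x.2 <= b2 -> D x) ->
  \int[leb2]_(x in D) (h x * \1_(open_box a1 b1 a2 b2) x) = 0.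
Proof.
move=> abD.
pose phi n x := itv_bump a1 b1 n x.1 * itv_bump a2 b2 n x.2.
have tphi n : test_fun D (phi n) by exact: test_fun_bump.
have [||||_ cv] := @Rint_dominated_cvg _ _ _ leb2 D mD (fun n x => h x * phi n x)
    (fun x => h x * \1_(open_box a1 b1 a2 b2) x) (fun x => `|h x|).
- move=> n; apply: measurable_funM; first by case: sh.
  apply: measurable_funTS; apply: continuous_measurable_plane.
  by have [] := test_fun_C1 (tphi n).
- exact: integrable_norm.
- move=> n x _; rewrite normrM ler_piMr//.
  have /andP[p0 p1] := itv_bump_bound a1 b1 n x.1; have /andP[q0 q1] := itv_bump_bound a2 b2 n x.2.
  by rewrite /phi ger0_norm; [exact: mulr_ile1|exact: mulr_ge0].
- move=> x _; apply: cvgM; first exact: cvg_cst.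
  have -> : \1_(open_box a1 b1 a2 b2) x = (a1 < x.1 < b1)%R%:R * (a2 < x.2 < b2)%R%:R :> R.
    rewrite indicE -natrM mulnb; congr (_ %:R); congr nat_of_bool.
    by apply/idP/andP; rewrite inE /open_box /= !in_itv.
  by apply: cvgM; exact: itv_bump_cvg.
have e0 : (fun n => \int[leb2]_(x in D) (h x * phi n x)) = (fun=> 0).
  by apply/funext => n; exact: h0.
rewrite e0 in cv.
exact: (cvg_unique _ cv (cvg_cst 0)).
Qed.

(* Products of half lines form a pi-system generating the Borel sets of the
   plane, and their traces on an open box are open boxes. *)
Definition half (a : option R) : set R := if a is Some t then `]t, +oo[%classic else setT.
Definition quadrants : set (set plane) := [set X | exists (a b : option R), X = half a `*` half b].

Lemma halfI (a b : option R) : exists c : option R, half a `&` half b = half c.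
Proof.
case: a => [s|]; last by exists b; rewrite setTI.
case: b => [t|]; last by exists (Some s); rewrite setIT.
exists (Some (Num.max s t)); apply/seteqP; split => x /=; rewrite !in_itv /= !andbT gt_max.
  by move=> [-> ->].
by move=> /andP[].
Qed.

Lemma setI_quadrants : setI_closed quadrants.
Proof.
move=> _ _ [a [b ->]] [a' [b' ->]]; have [c ec] := halfI a a'; have [d ed] := halfI b b'.
by exists c, d; rewrite -ec -ed; apply/seteqP; split => x /= => [[[? ?] [? ?]]|[[? ?] [? ?]]].
Qed.

Lemma half_box (a : option R) s t : s < t -> exists2 l, s <= l & half a `&` `]s, t[%classic = `]l, t[%classic.
Proof.
move=> st; case: a => [r|]; last by exists s => //; rewrite setTI.
exists (Num.max r s); first by rewrite le_max lexx orbT.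
apply/seteqP; split => x /=; rewrite !in_itv /= ?andbT gt_max.
  by move=> [-> /andP[-> ->]].
by move=> /andP[/andP[-> ->] ->].
Qed.

Lemma measurable_quadrants X : measurable (X : set plane) -> <<s quadrants >> X.
Proof.
rewrite measurable_prod_measurableType.
apply: smallest_sub; first exact: smallest_sigma_algebra.
move=> _ [A mA] [B mB] <-.
pose Y := g_sigma_algebraType quadrants.
have mfst : measurable_fun setT (fst : Y -> measurableTypeR R).
  apply: (measurability _ (RGenOInfty.measurableE R)).
  move=> _ [_ [t ->] <-]; rewrite setTI; apply: sub_sigma_algebra.
  by exists (Some t), None; apply/seteqP; split => x //= [].
have msnd : measurable_fun setT (snd : Y -> measurableTypeR R).
  apply: (measurability _ (RGenOInfty.measurableE R)).
  move=> _ [_ [t ->] <-]; rewrite setTI; apply: sub_sigma_algebra.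
  by exists None, (Some t); apply/seteqP; split => x //= [].
have -> : A `*` B = (fst @^-1` A) `&` (snd @^-1` B) by [].
have h1 := mfst measurableT A mA; have h2 := msnd measurableT B mB.
rewrite !setTI in h1 h2.
exact: (@measurableI _ Y).
Qed.

(** Dynkin's argument: the sets [X] for which the integral vanishes form a lambda-system that
    contains the quadrants. *)
Lemma Rint_open_box_setI a1 b1 a2 b2 (X : set plane) : a1 < b1 -> a2 < b2 ->
  (forall x, a1 <= x.1 <= b1 -> a2 <= x.2 <= b2 -> D x) -> measurable X ->
  \int[leb2]_(x in D) (h x * \1_(X `&` open_box a1 b1 a2 b2) x) = 0.
Proof.
move=> ab1 ab2 abD mX; set B := open_box a1 b1 a2 b2.
have mB : measurable B by exact: measurable_open_box.
pose H : set (set plane) := [set X | measurable X /\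
  \int[leb2]_(x in D) (h x * \1_(X `&` B) x) = 0].
suff : H X by case.
apply: (@lambda_system_subset _ _ setI_quadrants setT H) (measurable_quadrants mX) => //.
- split => //.
  + by split => //; rewrite setTI; exact: Rint_open_box.
  + move=> A A' A'A [mA eA] [mA' eA']; split; first exact: measurableD.
    transitivity (\int[leb2]_(x in D) (h x * \1_(A `&` B) x - h x * \1_(A' `&` B) x)); last first.
      by rewrite Rint_sub// ?eA ?eA' ?subrr//; apply: ih_indic; exact: measurableI.
    apply: eq_Rintegral => x _; rewrite -mulrBr; congr (_ * _); rewrite !indicE.
    rewrite (in_setI x (A `\` A') B) (in_setI x A B) (in_setI x A' B) in_setD; case: (boolP (x \in A')) => xA'; last by rewrite andbT subr0.
    have -> : x \in A by move: xA'; rewrite !inE => /A'A.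
    by rewrite /= subrr.
  + move=> F ndF HF; have mF i : measurable (F i) by case: (HF i).
    split; first exact: bigcupT_measurable.
    have mFB i : measurable (F i `&` B) by exact: measurableI.
    have [||||_ cv] := @Rint_dominated_cvg _ _ _ leb2 D mD (fun n x => h x * \1_(F n `&` B) x)
      (fun x => h x * \1_(\bigcup_i F i `&` B) x) (fun x => `|h x|).
    * by move=> n; apply: integrable_measurable (ih_indic _).
    * exact: integrable_norm.
    * move=> n x _; rewrite normrM ler_piMr//= indicE.
      by case: (_ \in _); rewrite ?normr1 ?normr0.
    * move=> x _; apply: cvg_near_cst.
      have [[[n _ Fnx] Bx]|nFx] := EM ((\bigcup_i F i `&` B) x).
        near=> m; congr (_ * _); rewrite !indicE !mem_set//; first by split => //; exists n.
        split => //; have nm : (n <= m)%N by near: m; exact: nbhs_infty_ge.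
        by have /subsetPset := ndF _ _ nm; apply.
      apply: nearW => n; rewrite !indicE (memNset nFx) memNset// => -[Fnx Bx].
      by apply: nFx; split => //; exists n.
    have e0 : (fun n => \int[leb2]_(x in D) (h x * \1_(F n `&` B) x)) = (fun=> 0).
      by apply/funext => n; case: (HF n).
    rewrite e0 in cv.
    exact: (cvg_unique _ cv (cvg_cst 0)).
- move=> _ [a [b ->]]; split.
    apply: measurableX; rewrite /half.
    + by case: (a) => [t|] //; exact: measurable_itv.
    + by case: (b) => [t|] //; exact: measurable_itv.
  have [l al el] := half_box a ab1; have [m am em] := half_box b ab2.
  have -> : (half a `*` half b) `&` B = open_box l b1 m b2.
    rewrite /open_box -el -em; apply/seteqP.
    by split => x /= => [[[? ?] [? ?]]|[[? ?] [? ?]]].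
  apply: Rint_open_box => x /andP[lx xb] /andP[mx xb'].
  by apply: abD; rewrite ?xb ?xb' ?(le_trans al lx) ?(le_trans am mx).
Unshelve. all: by end_near. Qed.

(** The fundamental lemma of the calculus of variations. On each rational square inside [D] every
    set integral of [h] is 0, so [h] vanishes almost everywhere there, and countably many such
    squares cover [D]. *)
Lemma test_fun_zero_ae : open (D : set (R * R)) -> {ae leb2, forall x, D x -> h x = 0}.
Proof.
move=> oD.
pose N (i : rat * rat * nat) : set plane :=
  let r : R := i.2.+1%:R^-1 in
  open_box (ratr i.1.1 - r) (ratr i.1.1 + r) (ratr i.1.2 - r) (ratr i.1.2 + r).
pose good (i : rat * rat * nat) := forall y : R * R,
  `|y.1 - ratr i.1.1| <= i.2.+1%:R^-1 -> `|y.2 - ratr i.1.2| <= i.2.+1%:R^-1 -> D y.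
have zero i : good i -> {ae leb2, forall x, D x -> h x * \1_(N i) x = 0}.
  move=> gi; set r : R := i.2.+1%:R^-1; have r0 : 0 < r by rewrite invr_gt0.
  have mN : measurable (N i) by exact: measurable_open_box.
  have H : ae_eq leb2 D (EFin \o (fun x => h x * \1_(N i) x)) (cst 0%E).
    apply: integral_ae_eq => //; first exact: ih_indic.
    move=> E ED mE; rewrite [RHS]integral0_eq//.
    have iE := ih_indic (measurableI _ _ mE mN).
    have := @Rint_open_box_setI (ratr i.1.1 - r) (ratr i.1.1 + r) (ratr i.1.2 - r)
      (ratr i.1.2 + r) E.
    rewrite -/(N i) => /(_ ltac:(lra) ltac:(lra)) Z.
    have {}Z : \int[leb2]_(x in D) (h x * \1_(E `&` N i) x) = 0.
      by apply: Z => // x x1 x2; apply: gi; rewrite -/r ler_norml; lra.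
    transitivity (\int[leb2]_(x in D) (h x * \1_(E `&` N i) x)%:E)%E.
      rewrite integral_mkcond [RHS]integral_mkcond; apply: eq_integral => x _.
      rewrite !patchE; case: ifPn => xE.
        rewrite (_ : x \in D) /= ?indicE ?in_setI ?xE//.
        by move: xE; rewrite !inE; exact: ED.
      by case: ifP => //; rewrite indicE in_setI (negbTE xE) mulr0.
    by rewrite (Rint_EFin mD iE) Z.
  by apply: ae_imply H => x Hx Dx; have [] := Hx Dx.
have zero' i : {ae leb2, forall x, good i -> N i x -> D x -> h x = 0}.
  have [/zero H|ngi] := EM (good i); last by apply: aeW => x /ngi.
  apply: ae_imply H => x Hx _ Nx Dx; have := Hx Dx.
  by rewrite indicE mem_set ?mulr1.
(* The squares are numbered by the natural numbers so that the countably many null sets can be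
   united. *)
pose Z (n : nat) := if unpickle n is Some i then fun x => good i -> N i x -> D x -> h x = 0
  else fun=> True.
have /ae_foralln H : forall n, \forall x \ae leb2, Z n x.
  by move=> n; rewrite /Z; case: unpickle => [i|]; [exact: zero'|exact: aeW].
apply: ae_imply H => x HZ Dx.
have [i [[x1 x2] gi]] := rational_box oD Dx.
have := HZ (pickle i); rewrite /Z pickleK; apply => //.
have aux (s t r : R) : `|s - t| < r -> t - r < s < t + r.
  by rewrite ltr_norml; lra.
by split; rewrite /= in_itv /=; exact: aux.
Qed.

End Zero.

Lemma weak_gradient_unique (D : set plane) c u (G G' : R * R -> R * R) :
  measurable D -> open (D : set (R * R)) -> (forall x, D x -> box c x) ->
  weak_gradient D u G -> weak_gradient D u G' ->
  {ae leb2, forall x, D x -> G x = G' x}.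
Proof.
move=> mD oD Dc [_ /(L2P mD) g1 /(L2P mD) g2 wG] [_ /(L2P mD) g1' /(L2P mD) g2' wG'].
have key (k k' : R * R -> R) : sq_int leb2 D k -> sq_int leb2 D k' ->
    (forall phi, test_fun D phi -> \int[leb2]_(x in D) (k x * phi x) =
      \int[leb2]_(x in D) (k' x * phi x)) ->
    {ae leb2, forall x, D x -> k x = k' x}.
  move=> sk sk' e; have := test_fun_zero_ae mD Dc (sq_int_sub mD sk sk') _ oD.
  move=> H; apply: ae_imply (H _) => [x Hx /Hx/eqP|phi tphi]; first by rewrite subr_eq0 => /eqP.
  have [cp _ _ _ _] := test_fun_C1 tphi; have sp := continuous_sq_int mD Dc cp.
  transitivity (\int[leb2]_(x in D) (k x * phi x - k' x * phi x)).
    by apply: eq_Rintegral => x _; rewrite mulrBl.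
  by rewrite Rint_sub ?e ?subrr//; exact: sq_int_mul.
have h1 := key _ _ g1 g1' _; have h2 := key _ _ g2 g2' _.
have {}h1 : {ae leb2, forall x, D x -> (G x).1 = (G' x).1}.
  by apply: h1 => phi tphi; have [] := wG phi tphi; have [] := wG' phi tphi; move=> -> _ /oppr_inj.
have {}h2 : {ae leb2, forall x, D x -> (G x).2 = (G' x).2}.
  by apply: h2 => phi tphi; have [_] := wG phi tphi; have [_] := wG' phi tphi; move=> -> /oppr_inj.
apply: negligibleS (negligibleU h1 h2) => x /=.
move=> /not_implyP[Dx ne]; apply: contrapT => /not_orP[/contrapT e1 /contrapT e2].
by apply: ne; rewrite (surjective_pairing (G x)) (surjective_pairing (G' x)) e1 ?e2.
Qed.

End Uniqueness.

(** * Limits of compositions in L2 *)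

Section Limits.
Context {R : realType} {dT : measure_display} {T : measurableType dT}.
Variables (mu : {measure set T -> \bar R}) (D : set T).
Hypothesis mD : measurable D.
Hypothesis Dfin : (mu D < +oo)%E.
Implicit Types (u v p q z g : T -> R) (c C e k L : R).

Local Notation Int u := (mu.-integrable D (EFin \o u)).
Local Notation sqi := (sq_int mu D).
Local Notation dist2 u v := (\int[mu]_(x in D) (u x - v x) ^+ 2).

Lemma dist2_integrable u v : sqi u -> sqi v -> Int (fun x => (u x - v x) ^+ 2).
Proof. by move=> su sv; have [] := sq_int_sub mD su sv. Qed.

Lemma dist2_ge0 u v : 0 <= dist2 u v.
Proof. by apply: Rintegral_ge0 => x _; exact: sqr_ge0. Qed.

Lemma dist2_add u v u' v' : sqi u -> sqi v -> sqi u' -> sqi v' ->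
  dist2 (fun x => u x + u' x) (fun x => v x + v' x) <= 2 * dist2 u v + 2 * dist2 u' v'.
Proof.
move=> su sv su' sv'.
rewrite -!Rint_scale ?Rint_add//; try exact: dist2_integrable;
  try by apply: integrable_scale => //; exact: dist2_integrable.
rewrite -Rint_add//; try by apply: integrable_scale => //; exact: dist2_integrable.
apply: Rint_le => //.
- by apply: dist2_integrable; exact: sq_int_add.
- by apply: integrable_add => //; apply: integrable_scale => //; exact: dist2_integrable.
- by move=> x _; have := sqr_ge0 ((u x - v x) - (u' x - v' x)); nra.
Qed.

Lemma dist2_triangle u v w : sqi u -> sqi v -> sqi w ->
  dist2 u w <= 2 * dist2 u v + 2 * dist2 v w.
Proof.
move=> su sv sw.
rewrite -!Rint_scale//; try exact: dist2_integrable.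
rewrite -Rint_add//; try by apply: integrable_scale => //; exact: dist2_integrable.
apply: Rint_le => //.
- exact: dist2_integrable.
- by apply: integrable_add => //; apply: integrable_scale => //; exact: dist2_integrable.
- by move=> x _; have := sqr_ge0 ((u x - v x) - (v x - w x)); nra.
Qed.

(** Pointwise [|z| <= e + z ^ 2 / e], in place of Cauchy-Schwarz; [e] stays free to be balanced
    against the distance. *)
Lemma Rint_dist2 u v e : sqi u -> sqi v -> 0 < e ->
  `|\int[mu]_(x in D) u x - \int[mu]_(x in D) v x| <=
  e * (fine (mu D)) + e^-1 * dist2 u v.
Proof.
move=> su sv e0.
have iu := sq_int_integrable mD Dfin su; have iv := sq_int_integrable mD Dfin sv.
have id := dist2_integrable su sv.
rewrite -Rint_sub//.
apply: le_trans (Rint_norm mD (integrable_sub mD iu iv)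
   (integrable_add mD (integrable_const mD Dfin e) (integrable_scale mD e^-1 id)) _) _.
  move=> x _; rewrite -(ler_pM2l e0) mulrDr mulVKf ?gt_eqF//.
  rewrite -[(u x - v x) ^+ 2]real_normK ?num_real//.
  by have := sqr_ge0 (e - `|u x - v x|); have := sqr_ge0 e; have := sqr_ge0 `|u x - v x|; nra.
rewrite Rint_add//; [|exact: (integrable_const mD Dfin e)|exact: integrable_scale].
by rewrite Rint_scale// Rintegral_cst.
Qed.

Lemma measurable_comp_cont (M : R -> R) u : continuous M -> measurable_fun D u ->
  measurable_fun D (fun x => M (u x)).
Proof. by move=> cM mu_; apply: (measurableT_comp (continuous_measurable_fun cM) mu_). Qed.

Lemma sq_int_comp_mul (M : R -> R) C u v : continuous M -> (forall s, `|M s| <= C) ->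
  measurable_fun D u -> sqi v -> sqi (fun x => M (u x) * v x).
Proof.
move=> cM MC mu_ sv; apply: sq_int_dominated (sq_int_scale mD C sv) _ => //.
  by apply: measurable_funM; [exact: measurable_comp_cont|case: sv].
move=> x _; rewrite !normrM ler_wpM2r//.
exact: le_trans (MC _) (ler_norm _).
Qed.

(** Write the difference as [M p * (q - g) + (M p - M z) * g]. The first term is controlled by the
    bound on [M]. In the second, the part where [|g| > m] is a small tail, and on the rest the
    modulus of [M] is multiplied by at most [m ^ 2]. The modulus hypothesis covers both the
    Lipschitz [spos'] and the Hoelder continuous [gF]. *)
Lemma mul_limit (M : R -> R) C z g : continuous M -> (forall s, `|M s| <= C) ->
  (forall k, 0 < k -> exists L, forall s t, (M s - M t) ^+ 2 <= k + L * (s - t) ^+ 2) ->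
  sqi z -> sqi g -> forall e, 0 < e -> exists2 d, 0 < d & forall p q, sqi p -> sqi q ->
    dist2 p z < d -> dist2 q g < d ->
    dist2 (fun x => M (p x) * q x) (fun x => M (z x) * g x) < e.
Proof.
move=> cM MC modM sz sg e e0.
have C0 : 0 <= C by apply: le_trans (MC 0).
pose e' := e / (64 * (C ^+ 2 + 1)).
have C21 : 0 < C ^+ 2 + 1 by rewrite ltr_wpDl// sqr_ge0.
have e'0 : 0 < e' by rewrite divr_gt0// mulr_gt0.
have [m m0 tail] := sq_int_tail mD sg e'0.
have fD : 0 <= fine (mu D) by exact: fine_ge0.
(* Each of the four terms of the final bound is at most [e / 8]; [k], and with it [L], is chosen
   after the truncation level [m], on which it depends. *)
pose k := e / (16 * m ^+ 2 * (fine (mu D) + 1)).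
have k0 : 0 < k by rewrite divr_gt0// !mulr_gt0// ?exprn_gt0// ltr_wpDl.
have [L HL] := modM k k0.
pose L' := `|L| + 1; have L'0 : 0 < L' by rewrite ltr_wpDl.
pose d := Num.min (e / (16 * (C ^+ 2 + 1))) (e / (16 * L' * m ^+ 2)).
have d0 : 0 < d by rewrite lt_min !divr_gt0// !mulr_gt0// exprn_gt0.
exists d => // p q sp sq dp dq.
pose T2 x := g x ^+ 2 * (m < `|g x|)%R%:R.
have iT2 : Int T2.
  apply: (integrable_dominated mD _ (proj2 sg)).
    apply: measurable_funM; first by apply: measurable_funX; case: sg.
    rewrite (_ : (fun x => _) = (fun b : bool => b%:R : R) \o (fun x => m < `|g x|))//.
    apply: measurableT_comp => //; apply: measurable_fun_ltr => //.
    by apply: measurableT_comp => //; case: sg.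
  move=> x _; rewrite ger0_norm; last by rewrite mulr_ge0 ?sqr_ge0.
  by rewrite ler_piMr ?sqr_ge0//; case: (_ < _).
have ip := dist2_integrable sp sz; have iq := dist2_integrable sq sg.
have i1 := integrable_scale mD (2 * C ^+ 2) iq.
have i2 := integrable_scale mD (8 * C ^+ 2) iT2.
have i3 := integrable_const mD Dfin (2 * m ^+ 2 * k).
have i4 := integrable_scale mD (2 * m ^+ 2 * L') ip.
have i34 := integrable_add mD i3 i4; have i12 := integrable_add mD i1 i2.
have sM1 := sq_int_comp_mul cM MC (proj1 sp) sq.
have sM2 := sq_int_comp_mul cM MC (proj1 sz) sg.
apply: le_lt_trans (Rint_le mD (dist2_integrable sM1 sM2) (integrable_add mD i12 i34) _) _.
  move=> x _; rewrite (_ : _ - _ = M (p x) * (q x - g x) + (M (p x) - M (z x)) * g x); last by ring.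
  set a := M (p x) * _; set b := _ * g x.
  have : (a + b) ^+ 2 <= 2 * a ^+ 2 + 2 * b ^+ 2 by have := sqr_ge0 (a - b); nra.
  have M2 s : M s ^+ 2 <= C ^+ 2.
    by rewrite -real_normK ?num_real// ler_pXn2r ?nnegrE// MC.
  have : a ^+ 2 <= C ^+ 2 * (q x - g x) ^+ 2.
    by rewrite exprMn ler_wpM2r ?sqr_ge0.
  have : b ^+ 2 <= 4 * C ^+ 2 * T2 x + m ^+ 2 * (k + L' * (p x - z x) ^+ 2).
    have HL' : (M (p x) - M (z x)) ^+ 2 <= k + L' * (p x - z x) ^+ 2.
      apply: le_trans (HL _ _) _; rewrite lerD2l ler_wpM2r ?sqr_ge0//.
      by apply: le_trans (ler_norm _) _; rewrite lerDl.
    have kL : 0 <= k + L' * (p x - z x) ^+ 2 by apply: le_trans HL'; exact: sqr_ge0.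
    rewrite /b exprMn /T2; case: (ltP m `|g x|) => gm.
      rewrite mulr1; apply: le_trans (_ : 4 * C ^+ 2 * g x ^+ 2 <= _).
        rewrite ler_wpM2r ?sqr_ge0//.
        have := M2 (p x); have := M2 (z x); have := sqr_ge0 (M (p x) + M (z x)); nra.
      by rewrite lerDl mulr_ge0// sqr_ge0.
    rewrite mulr0 mulr0 add0r mulrC; apply: ler_pM; rewrite ?sqr_ge0//.
    by rewrite -[leLHS]real_normK ?num_real// ler_pXn2r ?nnegrE// ltW.
  lra.
rewrite Rint_add// Rint_add// Rint_add// Rintegral_cst// !Rint_scale//.
have h1 : 2 * C ^+ 2 * dist2 q g <= e / 8.
  apply: le_trans (_ : 2 * (C ^+ 2 + 1) * (e / (16 * (C ^+ 2 + 1))) <= _); last first.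
    by rewrite le_eqVlt; apply/orP; left; apply/eqP; field; rewrite gt_eqF.
  apply: ler_pM; rewrite ?dist2_ge0//; first by rewrite mulr_ge0 ?sqr_ge0.
    by rewrite ler_pM2l// lerDl.
  by apply: ltW; apply: lt_le_trans dq _; rewrite ge_min lexx.
have h2 : 8 * C ^+ 2 * \int[mu]_(x in D) T2 x <= e / 8.
  apply: le_trans (_ : 8 * (C ^+ 2 + 1) * e' <= _); last first.
    by rewrite le_eqVlt; apply/orP; left; apply/eqP; rewrite /e'; field; rewrite gt_eqF.
  apply: ler_pM; rewrite ?(ltW tail)//; first by rewrite mulr_ge0 ?sqr_ge0.
    by apply: Rintegral_ge0 => x _; rewrite mulr_ge0 ?sqr_ge0.
  by rewrite ler_pM2l// lerDl.
have h3 : 2 * m ^+ 2 * k * fine (mu D) <= e / 8.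
  apply: le_trans (_ : 2 * m ^+ 2 * k * (fine (mu D) + 1) <= _).
    by rewrite ler_wpM2l ?lerDl// mulr_ge0 ?(ltW k0)// mulr_ge0 ?sqr_ge0.
  by rewrite le_eqVlt; apply/orP; left; apply/eqP; rewrite /k; field; rewrite !gt_eqF// ltr_wpDl.
have h4 : 2 * m ^+ 2 * L' * dist2 p z <= e / 8.
  apply: le_trans (_ : 2 * m ^+ 2 * L' * (e / (16 * L' * m ^+ 2)) <= _); last first.
    by rewrite le_eqVlt; apply/orP; left; apply/eqP; field; rewrite !gt_eqF.
  rewrite ler_pM2l; last by rewrite !mulr_gt0// exprn_gt0.
  by apply: ltW; apply: lt_le_trans dp _; rewrite ge_min lexx orbT.
lra.
Qed.

(** The pointwise limit of [spos'] as its parameter tends to 0, hence the value 0 at 0. It is the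
    factor by which the gradient of [z] is multiplied in that of [pos z]. *)
Definition step (t : R) : R := (0 < t)%R%:R.

Lemma measurable_step : measurable_fun setT step.
Proof.
rewrite (_ : step = (fun b : bool => b%:R : R) \o (fun t => 0 < t))//.
by apply: measurableT_comp => //; apply: measurable_fun_ltr.
Qed.

Lemma sq_int_step_mul z g : measurable_fun D z -> sqi g -> sqi (fun x => step (z x) * g x).
Proof.
move=> mz sg; apply: (sq_int_dominated mD _ sg).
  by apply: measurable_funM; [exact: (measurableT_comp measurable_step)|case: sg].
move=> x _; rewrite normrM ler_piMl// /step.
by case: (_ < _); rewrite ?normr1 ?normr0.
Qed.

Lemma spos'_norm (e t : R) : 0 < e -> `|spos' e t| <= 1.
Proof. by move=> e0; rewrite ger0_norm ?spos'_le1 ?spos'_ge0. Qed.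

Lemma step_limit z g : measurable_fun D z -> sqi g -> forall e, 0 < e ->
  \forall n \near \oo,
    dist2 (fun x => spos' n.+1%:R^-1 (z x) * g x) (fun x => step (z x) * g x) < e.
Proof.
move=> mz sg e e0.
have n0 n : 0 < n.+1%:R^-1 :> R by rewrite invr_gt0.
pose w n x := (spos' n.+1%:R^-1 (z x) * g x - step (z x) * g x) ^+ 2.
have sw n : sqi (fun x => spos' n.+1%:R^-1 (z x) * g x).
  by apply: (@sq_int_comp_mul _ 1) => //; [exact: continuous_spos'|move=> s; exact: spos'_norm].
have iw n : Int (w n) by apply: dist2_integrable => //; exact: sq_int_step_mul.
have [||||_ cv] := @Rint_dominated_cvg _ _ _ mu D mD w (fun=> 0) (fun x => g x ^+ 2).
- by move=> n; exact: integrable_measurable (iw n).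
- by case: sg.
- move=> n x _; rewrite /w -mulrBl exprMn normrM !ger0_norm ?sqr_ge0//.
  rewrite ler_piMl ?sqr_ge0//.
  have := spos'_ge0 (z x) (n0 n); have := spos'_le1 (z x) (n0 n).
  by rewrite /step; case: (_ < _) => /=; nra.
- move=> x _; apply: cvg_near_cst.
  case: (leP (z x) 0) => zx.
    apply: nearW => n; rewrite /w spos'_eq0// ?(le_trans zx (ltW (n0 n)))//.
    by rewrite /step ltNge zx mul0r subrr expr0n.
  near=> n; rewrite /w spos'_eq1// /step ?zx ?mul1r ?subrr ?expr0n//.
  rewrite mulrC ler_pdivrMl// -ler_pdivrMr//.
  apply: ltW; apply: lt_le_trans (truncnS_gt _) _.
  by rewrite ler_nat ltnS; near: n; exact: nbhs_infty_ge.
rewrite Rintegral_cst// mul0r in cv.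
have /cvgrPdist_lt/(_ e e0) := cv.
apply: filterS => n; rewrite sub0r normrN; apply: le_lt_trans; exact: ler_norm.
Unshelve. all: by end_near. Qed.

Lemma spos_dist (e s t : R) : 0 < e -> (spos e s - pos t) ^+ 2 <= 8 * e ^+ 2 + 2 * (s - t) ^+ 2.
Proof.
move=> e0; have h1 := spos_le s e0; have h2 := spos_ge s e0.
have := pos_lip s t; rewrite ler_norml => /andP[h3 h4].
have a : `|spos e s - pos t| <= 2 * e + `|s - t| by rewrite ler_norml; lra.
rewrite -[leLHS]real_normK ?num_real// -[(s - t) ^+ 2]real_normK ?num_real//.
apply: le_trans (_ : (2 * e + `|s - t|) ^+ 2 <= _).
  by rewrite ler_pXn2r ?nnegrE// addr_ge0// mulr_ge0// ltW.
have := sqr_ge0 (2 * e - `|s - t|); nra.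
Qed.

Lemma spos'_modulus (e k : R) : 0 < e -> 0 < k -> exists L, forall s t : R,
  (spos' e s - spos' e t) ^+ 2 <= k + L * (s - t) ^+ 2.
Proof.
move=> e0 k0; exists ((2 / e) ^+ 2) => s t.
rewrite -[leLHS]real_normK ?num_real// -[(s - t) ^+ 2]real_normK ?num_real// -exprMn.
apply: le_trans (_ : (2 / e * `|s - t|) ^+ 2 <= _); last by rewrite lerDr ltW.
by rewrite ler_pXn2r ?nnegrE ?spos'_lip// mulr_ge0// divr_ge0// ltW.
Qed.

Lemma measurable_pos u : measurable_fun D u -> measurable_fun D (fun x => pos (u x)).
Proof. by apply: measurable_comp_cont; exact: continuous_pos. Qed.

Lemma continuous_spos (e : R) : 0 < e -> continuous (spos e).
Proof. by move=> e0 t; apply: is_derive_continuous (is_derive_spos t e0). Qed.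

Lemma sq_int_pos u : sqi u -> sqi (fun x => pos (u x)).
Proof.
move=> su; apply: (sq_int_dominated mD _ su); first by apply: measurable_pos; case: su.
by move=> x _; have := pos_lip (u x) 0; rewrite [pos 0]pos0// !subr0.
Qed.

Lemma sq_int_spos (e : R) u : 0 < e -> sqi u -> sqi (fun x => spos e (u x)).
Proof.
move=> e0 su; apply: sq_int_dominated (sq_int_pos su) _ => //.
  by apply: measurable_comp_cont; [exact: continuous_spos|case: su].
by move=> x _; rewrite !ger0_norm ?pos_ge0 ?spos_ge0 ?spos_le.
Qed.

Lemma sq_int_spos'_mul (e : R) u g : 0 < e -> measurable_fun D u -> sqi g ->
  sqi (fun x => spos' e (u x) * g x).
Proof.
move=> e0 mu_ sg; apply: (@sq_int_comp_mul _ 1) => //; first exact: continuous_spos'.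
by move=> s; exact: spos'_norm.
Qed.

(** Two nested limits: [e] is fixed first, so that smoothing changes [pos z] and its gradient
    little; only then is [d] chosen, since it depends on the Lipschitz constant [2 / e] of
    [spos' e]. *)
Lemma pos_limit z g1 g2 : sqi z -> sqi g1 -> sqi g2 -> forall c, 0 < c ->
  exists e d, [/\ 0 < e, 0 < d & forall p q1 q2, sqi p -> sqi q1 -> sqi q2 ->
    dist2 p z < d -> dist2 q1 g1 < d -> dist2 q2 g2 < d ->
    [/\ dist2 (fun x => spos e (p x)) (fun x => pos (z x)) < c,
        dist2 (fun x => spos' e (p x) * q1 x) (fun x => step (z x) * g1 x) < c &
        dist2 (fun x => spos' e (p x) * q2 x) (fun x => step (z x) * g2 x) < c]].
Proof.
move=> sz sg1 sg2 c c0.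
have c4 : 0 < c / 4 by rewrite divr_gt0.
have mz : measurable_fun D z by case: sz.
have fD : 0 <= fine (mu D) by exact: fine_ge0.
have [n [s1 s2 s3]] : exists n, [/\
    dist2 (fun x => spos' n.+1%:R^-1 (z x) * g1 x) (fun x => step (z x) * g1 x) < c / 4,
    dist2 (fun x => spos' n.+1%:R^-1 (z x) * g2 x) (fun x => step (z x) * g2 x) < c / 4 &
    8 * n.+1%:R^-1 ^+ 2 * fine (mu D) <= c / 2].
  near \oo => n; exists n; split.
  - by near: n; exact: step_limit.
  - by near: n; exact: step_limit.
  - have h : 16 * fine (mu D) / c <= n.+1%:R.
      apply: ltW; apply: lt_le_trans (truncnS_gt _) _.
      by rewrite ler_nat ltnS; near: n; exact: nbhs_infty_ge.
    rewrite ler_pdivrMr// in h.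
    have r1 : n.+1%:R^-1 <= 1 :> R by rewrite invf_le1// ler1n.
    have r0 : 0 < n.+1%:R^-1 :> R by rewrite invr_gt0.
    have rr : n.+1%:R^-1 * n.+1%:R = 1 :> R by rewrite mulVf.
    have : n.+1%:R^-1 * (16 * fine (mu D)) <= c.
      by rewrite -[leRHS](@mulKf _ n.+1%:R _)// ler_pM2l.
    have : n.+1%:R^-1 ^+ 2 * fine (mu D) <= n.+1%:R^-1 * fine (mu D).
      by rewrite ler_wpM2r// expr2 ler_piMr// ltW.
    move: (n.+1%:R^-1) (fine (mu D)) => r F h2 h3; nra.
set e := n.+1%:R^-1 in s1 s2 s3; have e0 : 0 < e by rewrite invr_gt0.
have M := mul_limit (continuous_spos' e0) (fun s => spos'_norm s e0) (fun k => spos'_modulus e0) sz.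
have [d1 d10 D1] := M _ sg1 _ c4; have [d2 d20 D2] := M _ sg2 _ c4.
exists e, (Num.min (Num.min d1 d2) (c / 8)); split => //.
  by rewrite !lt_min d10 d20 divr_gt0.
move=> p q1 q2 sp sq1 sq2; rewrite !lt_min => /andP[/andP[p1 p2] p3].
move=> /andP[/andP[a1 _] _] /andP[/andP[_ b2] _].
have mp : measurable_fun D p by case: sp.
split.
- have i := dist2_integrable sp sz.
  apply: le_lt_trans (Rint_le mD (dist2_integrable (sq_int_spos e0 sp) (sq_int_pos sz))
    (integrable_add mD (integrable_const mD Dfin (8 * e ^+ 2)) (integrable_scale mD 2 i)) _) _.
    by move=> x _; exact: spos_dist.
  rewrite Rint_add//; [|exact: (integrable_const mD Dfin (8 * e ^+ 2))|exact: integrable_scale].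
  by rewrite Rint_scale// Rintegral_cst//; lra.
- apply: le_lt_trans (dist2_triangle _ (sq_int_spos'_mul e0 mz sg1) _) _.
  + exact: sq_int_spos'_mul.
  + exact: sq_int_step_mul.
  + have := D1 p q1 sp sq1 p1 a1; lra.
- apply: le_lt_trans (dist2_triangle _ (sq_int_spos'_mul e0 mz sg2) _) _.
  + exact: sq_int_spos'_mul.
  + exact: sq_int_step_mul.
  + have := D2 p q2 sp sq2 p2 b2; lra.
Unshelve. all: by end_near. Qed.

End Limits.

(** * The barrier *)

Section Barrier.
Context {R : realType}.
Variable Q : R.
Hypothesis Q0 : 0 < Q.
Implicit Types (s t k : R).
Local Notation P := (poiseuille Q).
Local Notation g := (gF Q).

(** A Hoelder bound of exponent 1/2 takes this form through [a <= k + a ^ 2 / k], applied to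
    [a = 36 * Q * |s - t|]. *)
Lemma gF_modulus k : 0 < k -> exists L, forall s t,
  (g s - g t) ^+ 2 <= k + L * (s - t) ^+ 2.
Proof.
move=> k0; exists (k^-1 * (36 * Q) ^+ 2) => s t.
apply: le_trans (gF_holder s t Q0) _.
rewrite -(ler_pM2l k0) mulrDr -[k^-1 * _ * _]mulrA mulVKf ?gt_eqF//.
rewrite -[(s - t) ^+ 2]real_normK ?num_real// -exprMn.
set a := 36 * Q * _; have := sqr_ge0 (k - a); have := sqr_ge0 k; have := sqr_ge0 a.
nra.
Qed.

(** [antiderivative] only reaches to the right of -1. Since [g] vanishes on the negative axis, the
    primitive is 0 between -1 and 0 and can be continued by 0. *)
Lemma Phi_exists : exists Phi : R -> R,
  (forall s, is_derive s (1 : R) Phi (g s)) /\ Phi 0 = 0.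
Proof.
have [A [dA A0 _]] := antiderivative (continuous_gF Q0).
have Aneg s : -1 < s -> s <= 0 -> A s = 0.
  move=> s1 s0.
  have dA' x : s < x < 0 -> is_derive x (1 : R) A (g x).
    by move=> /andP[sx _]; apply: dA; exact: lt_trans sx.
  have cA : {within `[s, 0], continuous A}.
    apply: continuous_in_subspaceT => x; rewrite inE /= in_itv /= => /andP[sx _].
    by apply: is_derive_continuous (dA x _); exact: lt_le_trans sx.
  have h1 : 0 * (0 - s) <= A 0 - A s.
    by apply: (mean_value_ge s0 dA' cA) => x _; exact: gF_ge0.
  have h2 : A 0 - A s <= 0 * (0 - s).
    by apply: (mean_value_le s0 dA' cA) => x /andP[_ /ltW x0]; rewrite gF_le0.
  by move: h1 h2; rewrite A0; lra.
exists (fun s => if - 2^-1 < s then A s else 0); split; last first.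
  by rewrite A0; case: ifP.
move=> s; have [s0|s0] := ltP (- 2^-1) s.
- apply: (@near_eq_is_derive _ _ _ A); last by apply: dA; lra.
  have : \forall t \near s, - 2^-1 < t by exact: lt_nbhsr.
  by apply: filterS => t ->.
- have sneg : s < 0 by lra.
  rewrite (gF_le0 Q0 (ltW sneg)).
  apply: (@near_eq_is_derive _ _ _ (fun=> 0 : R)).
  have : \forall t \near s, t < 0 by exact: lt_nbhsl.
  apply: filterS => t t0; case: ifP => // h; rewrite Aneg ?(ltW t0)//.
  by apply: lt_trans h; lra.
Qed.

Section Phi.
Variable Phi : R -> R.
Hypothesis dPhi : forall s, is_derive s (1 : R) Phi (g s).

Let within_Phi s t : {within `[s, t], continuous Phi}.
Proof. by apply: continuous_subspaceT => x; exact: is_derive_continuous (dPhi x). Qed.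

Lemma Phi_le s t : s <= t -> Phi s <= Phi t.
Proof.
move=> st; rewrite -subr_ge0 -(mul0r (t - s)).
by apply: (mean_value_ge st (fun x _ => dPhi x)) => // x _; exact: gF_ge0.
Qed.

Lemma Phi_lip s t : `|Phi s - Phi t| <= 6 * Q * `|s - t|.
Proof.
wlog st : s t / t <= s.
  move=> W; case: (leP t s) => h; first exact: W.
  by rewrite distrC (distrC s); apply: W; exact: ltW.
rewrite !ger0_norm ?subr_ge0 ?Phi_le//.
by apply: (mean_value_le st (fun x _ => dPhi x)) => // x _; exact: gF_le.
Qed.

(** Ensures that the set [psi > b], where the minimizer is corrected, is also the set
    [Phi psi > Phi b] that appears in the calibration, as long as [b] stays below [Q]. *)
Lemma Phi_lt s t : 0 <= s -> s < Q -> s < t -> Phi s < Phi t.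
Proof.
(* Beyond [Q] the derivative [g] is 0, so the strict increase has to be gained before [Q]. *)
move=> s0 sQ st; pose r := Num.min t Q.
have sr : s < r by rewrite lt_min st.
apply: lt_le_trans (Phi_le (_ : r <= t)); last by rewrite ge_min lexx.
have [c + e] := MVT sr (fun x _ => dPhi x) (@within_Phi s r).
rewrite in_itv /= => /andP[sc cr]; rewrite -subr_gt0 e mulr_gt0 ?subr_gt0//.
by apply: gF_gt0 => //; rewrite (le_lt_trans s0 sc) (lt_le_trans cr)// ge_min lexx orbT.
Qed.

End Phi.

Definition barrier t : R := Q * (3 * pos t ^+ 2 - 2 * pos t ^+ 3).
Definition barrier' t : R := 6 * Q * (pos t - pos t ^+ 2).

Lemma is_derive_barrier t : is_derive t (1 : R) barrier (barrier' t).
Proof.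
have h := is_deriveB (is_deriveZ (3 : R) (is_derive_pos2 t)) (is_deriveZ (2 : R) (is_derive_pos3 t)).
apply: is_derive_eq (is_deriveZ Q h) _.
by rewrite /GRing.scale /= /barrier'; ring.
Qed.

Lemma continuous_barrier' : continuous barrier'.
Proof.
move=> t; apply: cvgM; first exact: cvg_cst.
by apply: cvgB; [exact: continuous_pos|rewrite /= !expr2; apply: cvgM; exact: continuous_pos].
Qed.

Lemma barrierE t : barrier t = P (pos t). Proof. by []. Qed.

Lemma pos_le1 t : t <= 1 -> 0 <= pos t <= 1.
Proof. by move=> t1; rewrite pos_ge0 ge_max t1 ler01. Qed.

Lemma gF_barrier t : t <= 1 -> g (barrier t) = barrier' t.
Proof. by move=> t1; rewrite barrierE gF_poiseuille ?pos_le1// /barrier'; ring. Qed.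

Lemma barrier_ge0 t : t <= 1 -> 0 <= barrier t.
Proof. by move=> t1; have /andP[] := poiseuille_bound Q0 (pos_le1 t1). Qed.

Lemma barrier_ltQ t : t < 1 -> barrier t < Q.
Proof.
move=> t1; rewrite barrierE -[ltRHS]poiseuille1; apply: poiseuille_mono_lt => //.
  exact: pos_ge0.
by rewrite gt_max t1 ltr01.
Qed.

Lemma barrier_pos t : 0 <= t -> barrier t = P t.
Proof. by move=> t0; rewrite barrierE pos_id. Qed.

Lemma barrier_le0 t : t <= 0 -> barrier t = 0.
Proof. by move=> t0; rewrite barrierE pos0// poiseuille0. Qed.

End Barrier.

(** * Traces on the boundary of the truncated nozzle *)

Section Geometry.
Context {R : realType}.
Implicit Types (u v w b : R * R -> R) (x y : R * R) (s t e : R).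
Local Notation plane := (measurableTypeR R * measurableTypeR R)%type.
Local Notation leb := (@lebesgue_measure R).
Local Notation leb2 := (@lebesgue_measure R \x @lebesgue_measure R)%E.

Variables (h0 h1 : R -> R) (N : R).
Hypotheses (ch0 : continuous h0) (ch1 : continuous h1) (N0 : 0 < N).
Local Notation D := (trunc_nozzle h0 h1 N).

Lemma continuous_fst_comp (k : R -> R) : continuous k -> continuous (fun x : R * R => k x.1).
Proof. by move=> ck x; apply: (@continuous_comp _ _ _ fst k); [exact: cvg_fst|exact: ck]. Qed.

Lemma open_pos_set (k : R * R -> R) : continuous k -> open [set x | 0 < k x].
Proof.
move=> ck; have -> : [set x | 0 < k x] = k @^-1` `]0, +oo[%classic.
  by apply/seteqP; split => x /=; rewrite in_itv /= andbT.
by apply: open_comp => [x _|]; [exact: ck|exact: interval_open].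
Qed.

Lemma open_trunc_nozzle : open (D : set (R * R)).
Proof.
have -> : D = [set x | 0 < x.2 - h0 x.1] `&` [set x | 0 < h1 x.1 - x.2] `&` [set x | 0 < N - `|x.1|].
  apply/seteqP; split => x /=; rewrite /trunc_nozzle /nozzle /= !subr_gt0.
    by move=> [/andP[a b] c].
  by move=> [[-> ->] ->].
have csnd : continuous (snd : R * R -> R) by move=> x; exact: cvg_snd.
apply: openI; first apply: openI; apply: open_pos_set => x.
- by apply: cvgB; [exact: csnd|exact: (continuous_fst_comp ch0)].
- by apply: cvgB; [exact: (continuous_fst_comp ch1)|exact: csnd].
- apply: cvgB; first exact: cvg_cst.
  exact: (@continuous_fst_comp Num.norm (@norm_continuous _ R)).
Qed.

Lemma measurable_trunc_nozzle : measurable (D : set plane).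
Proof. exact: open_measurable_plane open_trunc_nozzle. Qed.

Lemma trunc_nozzle_bounded : exists c, forall x, D x -> box c x.
Proof.
have bd (k : R -> R) : continuous k -> exists C, forall t, `|t| <= N -> `|k t| <= C.
  move=> ck; have [C HC] := @continuous2_bounded R (fun x => k x.1) N (continuous_fst_comp ck).
  by exists C => t tN; apply: (HC (t, 0)) => //=; rewrite normr0 ltW.
have [C0 b0] := bd _ ch0; have [C1 b1] := bd _ ch1.
exists (N + `|C0| + `|C1|) => x [/andP[x0 x1] xN]; apply/boxP.
have xN' : `|x.1| <= N by exact: ltW.
have := b0 _ xN'; have := b1 _ xN'; rewrite !ler_norml => /andP[a1 a2] /andP[a3 a4].
have := ler_norm C0; have := ler_norm C1; have := normr_ge0 C0; have := normr_ge0 C1.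
move: xN' x0 x1; rewrite ler_norml /= => xN' x0 x1 *.
by have N0' := N0; split; lra.
Qed.

Definition bdry_measurable w :=
  [/\ measurable_fun `]- N, N[%classic (fun t => w (t, h0 t)),
      measurable_fun `]- N, N[%classic (fun t => w (t, h1 t)),
      measurable_fun `]h0 (- N), h1 (- N)[%classic (fun t => w (- N, t)) &
      measurable_fun `]h0 N, h1 N[%classic (fun t => w (N, t))].

Definition bdry_forall (p : R * R -> Prop) :=
  [/\ forall t, - N < t < N -> p (t, h0 t),
      forall t, - N < t < N -> p (t, h1 t),
      forall t, h0 (- N) < t < h1 (- N) -> p (- N, t) &
      forall t, h0 N < t < h1 N -> p (N, t)].

Lemma continuous_bdry_measurable w : continuous w -> bdry_measurable w.
Proof.
move=> cw; have pr (k : R -> R) : continuous k -> continuous (fun t => (t, k t) : R * R).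
  by move=> ck t; apply: (@cvg_pair _ _ _ _ (nbhs t) (nbhs (k t)) _ _ _ id k); [exact: cvg_id|exact: ck].
have m (c : R -> R * R) (I : set R) : continuous c -> measurable_fun I (fun t => w (c t)).
  move=> cc; apply: measurable_funTS; apply: continuous_measurable_fun => t.
  by apply: continuous_comp; [exact: cc|exact: cw].
split; apply: m => //; [exact: pr|exact: pr|..] => t; exact: cvg_cst_pair.
Qed.

Lemma bdry_measurable_sub v w : bdry_measurable v -> bdry_measurable w ->
  bdry_measurable (fun x => v x - w x).
Proof. by move=> [? ? ? ?] [? ? ? ?]; split; apply: measurable_funB. Qed.

Let sq_le (I : set R) (p q : R -> R) : measurable I -> measurable_fun I p -> measurable_fun I q ->
  (forall t, I t -> `|p t| <= `|q t|) ->
  (\int[leb]_(t in I) (p t ^+ 2)%:E <= \int[leb]_(t in I) (q t ^+ 2)%:E)%E.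
Proof.
move=> mI mp mq pq; apply: ge0_le_integral => //.
- by move=> t _; rewrite lee_fin sqr_ge0.
- by apply/measurable_EFinP; exact: measurable_funX.
- by apply/measurable_EFinP; exact: measurable_funX.
- move=> t It; rewrite lee_fin -[leLHS]real_normK ?num_real// -[leRHS]real_normK ?num_real//.
  by rewrite ler_pXn2r ?nnegrE ?pq.
Qed.

Let sq_add (I : set R) (p q : R -> R) : measurable I -> measurable_fun I p -> measurable_fun I q ->
  (\int[leb]_(t in I) ((p t + q t) ^+ 2)%:E <= 2%:E * \int[leb]_(t in I) (p t ^+ 2)%:E +
    2%:E * \int[leb]_(t in I) (q t ^+ 2)%:E)%E.
Proof.
move=> mI mp mq.
have mp2 : measurable_fun I (fun t => (p t ^+ 2)%:E) by apply/measurable_EFinP; exact: measurable_funX.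
have mq2 : measurable_fun I (fun t => (q t ^+ 2)%:E) by apply/measurable_EFinP; exact: measurable_funX.
rewrite -!ge0_integralZl_EFin//; try by move=> t _; rewrite lee_fin sqr_ge0.
rewrite -ge0_integralD//; try by move=> t _; rewrite -EFinM lee_fin mulr_ge0 ?sqr_ge0.
- apply: ge0_le_integral => //.
  + by move=> t _; rewrite lee_fin sqr_ge0.
  + by apply/measurable_EFinP; apply: measurable_funX; exact: measurable_funD.
  + by apply: emeasurable_funD; apply: measurable_funeM.
  + move=> t _; rewrite -!EFinM -EFinD lee_fin.
    by have := sqr_ge0 (p t - q t); nra.
- exact: measurable_funeM.
- exact: measurable_funeM.
Qed.

Let sq_ge0 (I : set R) (p : R -> R) : (0 <= \int[leb]_(t in I) (p t ^+ 2)%:E)%E.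
Proof. by apply: integral_ge0 => t _; rewrite lee_fin sqr_ge0. Qed.

Lemma bdry_norm2_le v w : bdry_measurable v -> bdry_measurable w ->
  bdry_forall (fun x => `|v x| <= `|w x|) ->
  (bdry_norm2 h0 h1 N v <= bdry_norm2 h0 h1 N w)%E.
Proof.
move=> [? ? ? ?] [? ? ? ?] [a1 a2 a3 a4]; rewrite /bdry_norm2.
apply: leeD; first apply: leeD; first apply: leeD; apply: sq_le => //;
  by move=> t /=; rewrite in_itv /=; [exact: a1|exact: a2|exact: a3|exact: a4].
Qed.

Lemma bdry_norm2_ge0 w : (0 <= bdry_norm2 h0 h1 N w)%E.
Proof. by rewrite /bdry_norm2; do 3 (apply: adde_ge0 => //; try exact: sq_ge0). Qed.

Let addeACA4 (a b c d a' b' c' d' : \bar R) :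
  ((a + a') + (b + b') + (c + c') + (d + d') = (a + b + c + d) + (a' + b' + c' + d'))%E.
Proof. by rewrite (addeACA a) (addeACA (a + b)) (addeACA (a + b + c)). Qed.

Let muleD4 (a b c d : \bar R) : (0 <= a -> 0 <= b -> 0 <= c -> 0 <= d ->
  2%:E * (a + b + c + d) = 2%:E * a + 2%:E * b + 2%:E * c + 2%:E * d)%E.
Proof. by move=> a0 b0 c0 d0; rewrite !ge0_muleDr ?adde_ge0. Qed.

Lemma bdry_norm2_add v w : bdry_measurable v -> bdry_measurable w ->
  (bdry_norm2 h0 h1 N (fun x => v x + w x)%R <=
   2%:E * bdry_norm2 h0 h1 N v + 2%:E * bdry_norm2 h0 h1 N w)%E.
Proof.
move=> [? ? ? ?] [? ? ? ?]; rewrite /bdry_norm2.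
rewrite !muleD4; try exact: sq_ge0.
apply: le_trans (leeD (leeD (leeD (sq_add _ _ _) (sq_add _ _ _)) (sq_add _ _ _)) (sq_add _ _ _)) _ => //.
by rewrite addeACA4.
Qed.

Lemma bdry_norm2_add_lt v w e e' : bdry_measurable v -> bdry_measurable w ->
  (bdry_norm2 h0 h1 N v < e%:E)%E -> (bdry_norm2 h0 h1 N w < e'%:E)%E ->
  (bdry_norm2 h0 h1 N (fun x => v x + w x)%R < (2 * e + 2 * e')%R%:E)%E.
Proof.
move=> mv mw ve we; apply: le_lt_trans (bdry_norm2_add mv mw) _.
by rewrite (EFinD (2 * e)) (EFinM 2 e) (EFinM 2 e') lteD// lte_pmul2l.
Qed.

End Geometry.

(** * Traces in terms of approximation by C^1 functions *)

Section Trace.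
Context {R : realType}.
Implicit Types (u v w b g psi : R * R -> R) (G : R * R -> R * R) (x y : R * R) (s t e a c : R).
Local Notation plane := (measurableTypeR R * measurableTypeR R)%type.
Local Notation leb2 := (@lebesgue_measure R \x @lebesgue_measure R)%E.
Variables (h0 h1 : R -> R) (N : R).
Hypotheses (ch0 : continuous h0) (ch1 : continuous h1) (N0 : 0 < N).
Local Notation D := (trunc_nozzle h0 h1 N).
Local Notation sqi := (sq_int leb2 D).
Local Notation bnorm := (bdry_norm2 h0 h1 N).

Let mD : measurable (D : set plane).
Proof. exact: (measurable_trunc_nozzle N ch0 ch1). Qed.

Let Dbox := trunc_nozzle_bounded ch0 ch1 N0.

Definition trace_approx u G b e v v1 v2 :=
  [/\ C1 v v1 v2, \int[leb2]_(x in D) gap u G v v1 v2 x < e &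
      (bnorm (fun x => v x - b x)%R < e%:E)%E].

Definition sq_int_pair G := sqi (fun x => (G x).1) /\ sqi (fun x => (G x).2).

Lemma weak_gradient_sq_int u G : weak_gradient D u G -> sqi u /\ sq_int_pair G.
Proof. by case=> /(L2P mD) su /(L2P mD) s1 /(L2P mD) s2 _. Qed.

(** An epsilon form composes more easily than sequences; the sequence is recovered by choosing an
    approximant for each [1 / (n + 1)]. *)
Lemma has_trace_approx u b : has_trace h0 h1 N u b <->
  exists2 G, weak_gradient D u G &
    forall e, 0 < e -> exists v v1 v2, trace_approx u G b e v v1 v2.
Proof.
have [c Dc] := Dbox.
have dE u' G v : weak_gradient D u' G -> C1 v (dx1 v) (dx2 v) ->
    H1_dist2 D u' G v = (\int[leb2]_(x in D) gap u' G v (dx1 v) (dx2 v) x)%:E.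
  move=> /weak_gradient_sq_int[su [s1 s2]] cv.
  exact: (Rint_EFin mD (integrable_gap mD Dc su s1 s2 cv)).
have near_lt (w : nat -> \bar R) e : 0 < e -> w n @[n --> \oo] --> 0%E ->
    \forall n \near \oo, (w n < e%:E)%E.
  by move=> e0 cw; have := cw _ (@open_ereal_lt' _ 0%E e%:E ltac:(by rewrite lte_fin)).
split=> [[G [v [wG cv dv bv]]]|[G wG app]]; exists G => //.
- move=> e e0; near \oo => n.
  have cvn := Ck_C1 (cv n).
  exists (v n), (dx1 (v n)), (dx2 (v n)); split => //.
    rewrite -lte_fin -dE//; near: n; exact: near_lt.
  by near: n; exact: near_lt.
- have /choice[v Hv] : forall n, exists v : R * R -> R, exists v1 v2, trace_approx u G b n.+1%:R^-1 v v1 v2.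
    by move=> n; apply: app; rewrite invr_gt0.
  have to0 (w : nat -> \bar R) : (forall n, 0 <= w n)%E -> (forall n, w n < (n.+1%:R^-1)%:E)%E ->
      w n @[n --> \oo] --> 0%E.
    move=> w0 wn; apply: (@squeeze_cvge _ _ _ _ (fun=> 0%E) _ (fun n => (n.+1%:R^-1)%:E)).
    + by apply: nearW => n; rewrite w0 ltW.
    + exact: cvg_cst.
    + by apply: cvg_EFin; [exact: nearW|exact: cvg_harmonic].
  exists v; split => //.
  + by move=> n; have [v1 [v2 [/C1_Ck]]] := Hv n.
  + apply: to0 => n; first by apply: integral_ge0 => x _; rewrite lee_fin !addr_ge0 ?sqr_ge0.
    have [v1 [v2 [cvn dvn _]]] := Hv n; have [e1 e2] := C1_dx cvn.
    by rewrite dE ?e1 ?e2// lte_fin.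
  + apply: to0 => n; first exact: bdry_norm2_ge0.
    by have [v1 [v2 []]] := Hv n.
Unshelve. all: by end_near. Qed.

Let oD : open (D : set (R * R)).
Proof. exact: open_trunc_nozzle. Qed.

Let Dfin : (leb2 D < +oo)%E.
Proof. by have [c Dc] := Dbox; exact: bounded_finite mD Dc. Qed.

(** The weak-gradient identity is left out on purpose: it follows from the approximation, so a
    competitor only has to be approximated. *)
Definition traced u G b := [/\ sqi u, sq_int_pair G &
  forall e, 0 < e -> exists v v1 v2, trace_approx u G b e v v1 v2].

Lemma traced_weak_gradient u G b : traced u G b -> weak_gradient D u G.
Proof.
have [c Dc] := Dbox; move=> [su [s1 s2] app].
apply: (approximable_weak_gradient mD Dc) => // e /app[v [v1 [v2 [cv gv _]]]].
by exists v, v1, v2.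
Qed.

Lemma has_traceP u b : has_trace h0 h1 N u b <-> exists G, traced u G b.
Proof.
rewrite has_trace_approx; split=> [[G wG app]|[G tG]]; exists G.
- by have [su sG] := weak_gradient_sq_int wG; split.
- exact: traced_weak_gradient tG.
- by case: tG.
Qed.

Let sq_lin a c s t : `|a| <= 1 -> `|c| <= 1 -> (a * s + c * t) ^+ 2 <= 2 * s ^+ 2 + 2 * t ^+ 2.
Proof.
rewrite !ler_norml => /andP[a0 a1] /andP[c0 c1].
have a2 : a ^+ 2 <= 1 by nra.
have c2 : c ^+ 2 <= 1 by nra.
have := sqr_ge0 (a * s - c * t).
have : a ^+ 2 * s ^+ 2 <= s ^+ 2 by rewrite ler_piMl ?sqr_ge0.
have : c ^+ 2 * t ^+ 2 <= t ^+ 2 by rewrite ler_piMl ?sqr_ge0.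
by nra.
Qed.

(** Coefficients of modulus at most 1 cover sums, differences and averages, and let
    [(s + t) ^ 2 <= 2 s ^ 2 + 2 t ^ 2] give the constants. *)
Lemma trace_approx_lin a c u u' G G' b b' e e' v v1 v2 v' v1' v2' :
  `|a| <= 1 -> `|c| <= 1 -> sqi u -> sq_int_pair G -> sqi u' -> sq_int_pair G' ->
  bdry_measurable h0 h1 N b -> bdry_measurable h0 h1 N b' ->
  trace_approx u G b e v v1 v2 -> trace_approx u' G' b' e' v' v1' v2' ->
  trace_approx (fun x => a * u x + c * u' x)
    (fun x => (a * (G x).1 + c * (G' x).1, a * (G x).2 + c * (G' x).2))
    (fun x => a * b x + c * b' x) (2 * e + 2 * e')
    (fun x => a * v x + c * v' x) (fun x => a * v1 x + c * v1' x) (fun x => a * v2 x + c * v2' x).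
Proof.
move=> a1 c1 su [s1 s2] su' [s1' s2'] mb mb' [cv gv bv] [cv' gv' bv'].
have [k Dk] := Dbox.
have CC : C1 (fun x => a * v x + c * v' x) (fun x => a * v1 x + c * v1' x) (fun x => a * v2 x + c * v2' x).
  exact: C1_add (C1_scale a cv) (C1_scale c cv').
have lin p q : sqi p -> sqi q -> sqi (fun x => a * p x + c * q x).
  by move=> sp sq; apply: (sq_int_add mD); exact: sq_int_scale.
split => //.
- have i1 := integrable_gap mD Dk su s1 s2 cv; have i2 := integrable_gap mD Dk su' s1' s2' cv'.
  have i3 := integrable_gap (G := fun x => (a * (G x).1 + c * (G' x).1, a * (G x).2 + c * (G' x).2))
    mD Dk (lin _ _ su su') (lin _ _ s1 s1') (lin _ _ s2 s2') CC.
  apply: le_lt_trans (_ : 2 * (\int[leb2]_(x in D) gap u G v v1 v2 x) +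
    2 * (\int[leb2]_(x in D) gap u' G' v' v1' v2' x) < _); last by rewrite ltrD// ltr_pM2l.
  rewrite -!Rint_scale// -Rint_add//; try exact: integrable_scale.
  apply: Rint_le => //; first by apply: integrable_add => //; exact: integrable_scale.
  move=> x _; rewrite /gap /=.
  have l p q p' q' : (a * p + c * p' - (a * q + c * q')) ^+ 2 <= 2 * (p - q) ^+ 2 + 2 * (p' - q') ^+ 2.
    by rewrite (_ : _ - _ = a * (p - q) + c * (p' - q')); [exact: sq_lin|ring].
  apply: le_trans (lerD (lerD (l _ _ _ _) (l _ _ _ _)) (l _ _ _ _)) _.
  by rewrite le_eqVlt; apply/orP; left; apply/eqP; ring.
- have mv := continuous_bdry_measurable N ch0 ch1 (let: And5 h _ _ _ _ := cv in h).
  have mv' := continuous_bdry_measurable N ch0 ch1 (let: And5 h _ _ _ _ := cv' in h).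
  have sc z w d : `|z| <= 1 -> bdry_measurable h0 h1 N w -> (bnorm w < d%:E)%E ->
      bdry_measurable h0 h1 N (fun x => z * w x) /\ (bnorm (fun x => (z * w x)%R) < d%:E)%E.
    move=> z1 mw wd; have mzw : bdry_measurable h0 h1 N (fun x => z * w x).
      by case: mw => ? ? ? ?; split; apply: measurable_funM.
    split => //; apply: le_lt_trans wd; apply: bdry_norm2_le => //.
    by split => t _; rewrite normrM ler_piMl.
  have [m1 l1] := sc _ _ _ a1 (bdry_measurable_sub mv mb) bv.
  have [m2 l2] := sc _ _ _ c1 (bdry_measurable_sub mv' mb') bv'.
  have := bdry_norm2_add_lt m1 m2 l1 l2; congr (bnorm _ < _)%E.
  by apply/funext => x; ring.
Qed.

Lemma traced_lin a c u u' G G' b b' :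
  `|a| <= 1 -> `|c| <= 1 -> bdry_measurable h0 h1 N b -> bdry_measurable h0 h1 N b' ->
  traced u G b -> traced u' G' b' ->
  traced (fun x => a * u x + c * u' x)
    (fun x => (a * (G x).1 + c * (G' x).1, a * (G x).2 + c * (G' x).2))
    (fun x => a * b x + c * b' x).
Proof.
move=> a1 c1 mb mb' [su sG app] [su' sG' app'].
have lin p q : sqi p -> sqi q -> sqi (fun x => a * p x + c * q x).
  by move=> sp sq; apply: (sq_int_add mD); exact: sq_int_scale.
split; [exact: lin|by case: sG sG' => ? ? [? ?]; split; exact: lin|] => e e0.
have e4 : 0 < e / 4 by rewrite divr_gt0.
have [v [v1 [v2 A]]] := app _ e4; have [v' [v1' [v2' A']]] := app' _ e4.
have := trace_approx_lin a1 c1 su sG su' sG' mb mb' A A'.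
rewrite (_ : 2 * (e / 4) + 2 * (e / 4) = e); last by field.
by move=> B; do 3 eexists; exact: B.
Qed.

Lemma energy_unique Q u G G' : 0 < Q -> weak_gradient D u G -> weak_gradient D u G' ->
  energy h0 h1 N Q u G = energy h0 h1 N Q u G'.
Proof.
move=> Q0 wG wG'; have [c Dc] := Dbox.
have ae := weak_gradient_unique mD oD Dc wG wG'.
have m G1 : weak_gradient D u G1 -> measurable_fun (D : set plane)
    (fun x => (((G1 x).1 ^+ 2 + (G1 x).2 ^+ 2) / 2 + F Q (u x))%:E).
  move=> /weak_gradient_sq_int[[mu _] [[m1 _] [m2 _]]].
  apply/measurable_EFinP; apply: measurable_funD.
    apply: measurable_funM; last exact: measurable_cst.
    by apply: measurable_funD; exact: measurable_funX.
  rewrite (_ : (fun x => F Q (u x)) = (fun x => gF Q (u x) ^+ 2 / 2)); last first.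
    by apply/funext => x; rewrite F_gF.
  apply: measurable_funM; last exact: measurable_cst.
  apply: measurable_funX; exact: measurable_comp_cont (continuous_gF Q0) mu.
rewrite /energy; apply: ae_eq_integral => //; [exact: m|exact: m|].
by apply: ae_imply ae => x h Dx; rewrite h.
Qed.

(** An admissible function of no larger energy is itself a minimizer, and minimizers are unique up
    to null sets. *)
Lemma competitor_ae Q g psi w G Gw : 0 < Q -> is_the_minimizer h0 h1 N Q g psi ->
  weak_gradient D psi G -> admissible h0 h1 N g w -> weak_gradient D w Gw ->
  (energy h0 h1 N Q w Gw <= energy h0 h1 N Q psi G)%E ->
  {ae leb2, forall x, D x -> w x = psi x}.
Proof.
move=> Q0 [[apsi mpsi] uniq _] wG aw wGw le; apply: (uniq w); split; first by [].
move=> w' G1 G2 aw' wG1 wG2.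
rewrite (energy_unique Q0 wG1 wGw); apply: le_trans le _.
exact: mpsi aw' wG wG2.
Qed.

End Trace.

(** * The corrected minimizer *)

Section Competitor.
Context {R : realType}.
Implicit Types (u v w p b : R * R -> R) (x y : R * R) (s t e : R).
Local Notation plane := (measurableTypeR R * measurableTypeR R)%type.
Local Notation leb := (@lebesgue_measure R).
Local Notation leb2 := (@lebesgue_measure R \x @lebesgue_measure R)%E.
Variables (h0 h1 : R -> R) (N : R).
Hypotheses (ch0 : continuous h0) (ch1 : continuous h1) (N0 : 0 < N).
Local Notation D := (trunc_nozzle h0 h1 N).
Local Notation bnorm := (bdry_norm2 h0 h1 N).
Local Notation sqi := (sq_int leb2 D).
Local Notation dist2 u v := (\int[leb2]_(x in D) (u x - v x) ^+ 2).

Let sum3_lt (a c d m : R) : 0 <= a -> 0 <= c -> 0 <= d -> a + c + d < m ->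
  [/\ a < m, c < m & d < m].
Proof. by move=> *; split; lra. Qed.

Let sum2_quarter (a c e : R) : 0 < e -> a < e / 24 -> c < e / 24 -> 2 * a + 2 * c < e / 4.
Proof. by move=> *; lra. Qed.

Let sum3_quarter (a c d e : R) : 0 < e -> a < e / 4 -> c < e / 4 -> d < e / 4 -> a + c + d < e.
Proof. by move=> *; lra. Qed.

Let pos_le_lip (a c d m : R) : `|a - c| <= m -> 0 <= m -> c <= d -> pos (a - d) <= m.
Proof. by rewrite ler_norml; case: (pos_case (a - d)) => -[_ ->] *; lra. Qed.

Let first_le (a c d e : \bar R) : (0 <= c -> 0 <= d -> 0 <= e -> a <= a + c + d + e)%E.
Proof. by move=> c0 d0 e0; rewrite -!addeA leeDl// adde_ge0// adde_ge0. Qed.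

Let combine (a c d e : R) : `|a - c| <= e / 4 + e / 4 -> - d <= a -> d <= e / 2 -> - c <= e.
Proof. by rewrite ler_norml => *; lra. Qed.

Let mD : measurable (D : set plane).
Proof. exact: (measurable_trunc_nozzle N ch0 ch1). Qed.

Let Dfin : (leb2 D < +oo)%E.
Proof. by have [c Dc] := trunc_nozzle_bounded ch0 ch1 N0; exact: bounded_finite mD Dc. Qed.

Let csqi w : continuous w -> sqi w.
Proof. by have [c Dc] := trunc_nozzle_bounded ch0 ch1 N0; exact: continuous_sq_int mD Dc w. Qed.

Lemma Rint_gap u G v v1 v2 : sqi u -> sqi (fun x => (G x).1) -> sqi (fun x => (G x).2) ->
  sqi v -> sqi v1 -> sqi v2 ->
  \int[leb2]_(x in D) gap u G v v1 v2 x =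
  dist2 v u + dist2 v1 (fun x => (G x).1) + dist2 v2 (fun x => (G x).2).
Proof.
move=> su s1 s2 sv sv1 sv2.
have i0 := dist2_integrable mD sv su; have i1 := dist2_integrable mD sv1 s1.
have i2 := dist2_integrable mD sv2 s2.
by rewrite -Rint_add// -Rint_add//; exact: integrable_add.
Qed.

(** By Fubini, each vertical segment from the lower wall to height [T] contributes
    [K (t, T) - K (t, h0 t)], and the contribution at [T] may be dropped because [K] is
    nonnegative. *)
Lemma Rint_vertical K K1 K2 (T : R) : C1 K K1 K2 -> (forall x, 0 <= K x) ->
  (forall t, - N < t < N -> h0 t < T <= h1 t) ->
  - (\int[leb]_(t in `]- N, N[) K (t, h0 t)) <=
  \int[leb2]_(x in D) ((x.2 < T)%R%:R * K2 x).
Proof.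
move=> cK K0 wall; have [cK0 cK1 cK2 _ dK2] := cK.
pose f x : R := (x.2 < T)%R%:R * K2 x.
have sf : sqi f.
  apply: (sq_int_dominated mD _ (csqi cK2)).
    apply: measurable_funM; last by case: (csqi cK2).
    apply: measurable_funTS.
    rewrite (_ : (fun x => _) = (fun b : bool => b%:R : R) \o (fun x : plane => x.2 < T))//.
    apply: measurableT_comp => //; apply: measurable_fun_ltr => //; exact: measurable_snd.
  by move=> x _; rewrite normrM ler_piMl//; case: (_ < _); rewrite ?normr1 ?normr0.
have IF := sq_int_integrable mD Dfin sf.
have iT : leb2.-integrable setT ((EFin \o f) \_ D) by apply/(integrable_mkcond _ mD).
pose k t := K (t, T) - K (t, h0 t).
have ck (l : R -> R) : continuous l -> continuous (fun t => K (t, l t)).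
  move=> cl t; apply: (@continuous_comp _ _ _ (fun t => (t, l t)) K); last exact: cK0.
  by apply: (@cvg_pair _ _ _ _ (nbhs t) (nbhs (l t)) _ _ _ id l); [exact: cvg_id|exact: cl].
have ckT : continuous (fun t => K (t, T)) by apply: (ck (fun=> T)) => t; exact: cvg_cst.
have ckh := ck _ ch0.
have Ic (l : R -> R) : continuous l -> leb.-integrable `]- N, N[ (EFin \o l).
  move=> cl; have cI : leb.-integrable `[- N, N] (EFin \o l).
    apply: continuous_compact_integrable; first exact: segment_compact.
    exact: continuous_subspaceT.
  by apply: integrableS cI => //; exact: subset_itv_oo_cc.
have -> : \int[leb2]_(x in D) f x = \int[leb]_(t in `]- N, N[) k t.
  rewrite /Rintegral; congr fine.
  rewrite integral_mkcond -(integral12_prod_meas1 iT) [RHS]integral_mkcond.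
  apply: eq_integral => t _; rewrite /fubini_F patchE.
  case: ifPn => [|/negP tN].
    rewrite inE /= in_itv /= => tN; have /andP[hT Th] := wall _ tN.
    transitivity (\int[leb]_(s in `]h0 t, T[) (K2 (t, s))%:E)%E.
      rewrite [RHS]integral_mkcond; apply: eq_integral => s _; rewrite !patchE.
      case: ifPn => [|/negP nDs].
        rewrite inE /D /trunc_nozzle /nozzle /= => -[/andP[hs sh] _].
        case: ifPn => [|/negP ns].
          by rewrite inE /= in_itv /= /f /= => /andP[_ ->]; rewrite mul1r.
        rewrite /f /= (_ : (s < T) = false) ?mul0r//.
        by apply/negP => sT; apply: ns; rewrite inE /= in_itv /= hs sT.
      case: ifPn => //; rewrite inE /= in_itv /= => /andP[hs sT].
      exfalso; apply: nDs; rewrite inE /D /trunc_nozzle /nozzle /= hs (lt_le_trans sT Th).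
      by rewrite ltr_norml.
    have cKt : continuous (fun s => K2 (t, s)).
      by move=> s; apply: (@continuous_comp _ _ _ (fun s => (t, s)) K2); [exact: cvg_cst_pair|exact: cK2].
    have mKt (I : set R) : measurable_fun I (fun s => (K2 (t, s))%:E).
      by apply: measurable_funTS; apply/measurable_EFinP; exact: continuous_measurable_fun.
    have e := @integral_derive R (fun s => K (t, s)) (fun s => K2 (t, s)) _ _ (ltW hT) (fun s => dK2 (t, s)) cKt.
    by rewrite integral_itv_bndo_bndc// integral_itv_obnd_cbnd.
  rewrite integral0_eq// => s _; rewrite patchE; case: ifPn => //.
  rewrite inE /D /trunc_nozzle /nozzle /= => -[_ tN']; exfalso; apply: tN.
  by rewrite inE /= in_itv /= -ltr_norml.
rewrite /k Rint_sub//; [|exact: Ic|exact: Ic].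
by rewrite lerDr; apply: Rintegral_ge0.
Qed.

Variables (Q : R) (psi : R * R -> R) (G : R * R -> R * R) (bd : R * R -> R) (T : R) (cut : bool).
Hypotheses (Q0 : 0 < Q) (spsi : sqi psi) (sG : sq_int_pair h0 h1 N G).
Local Notation b := (barrier Q).
Local Notation b' := (barrier' Q).
(* [cut] says whether the height [T] crosses the nozzle, in which case the correction
   [cor] is truncated at [T]; it remains weakly differentiable because there [psi] is
   approximated by functions that agree with the barrier on the line [x.2 = T]. *)
Definition chi t : R := if cut then (t < T)%R%:R else 1.
Hypotheses (bdm : bdry_measurable h0 h1 N bd) (T1 : T <= 1).
Hypothesis wall : forall t, - N < t < N -> h0 t < T <= h1 t.
Hypothesis chiD : forall x, D x -> chi x.2 = (x.2 < T)%R%:R.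
Hypothesis bd_ok : bdry_forall h0 h1 N (fun x => 0 <= bd x /\ (chi x.2 = 0 \/ bd x <= b x.2)).
Hypothesis bd0 : forall t, - N < t < N -> bd (t, h0 t) = 0.
Hypothesis app : forall e, 0 < e -> exists p p1 p2,
  trace_approx h0 h1 N psi G bd e p p1 p2 /\ (cut -> forall s, p (s, T) = b T).

(** On the nozzle, [psi + cor] is [psi] clipped to [[0, b]] where [chi] is 1, and the positive part
    of [psi] elsewhere. The correction is treated separately because its trace is 0. *)
Definition cor x : R := - (chi x.2 * pos (psi x - b x.2)) + pos (- psi x).
Definition corG x : R * R :=
  (- (chi x.2 * (step (psi x - b x.2) * (G x).1)) + step (- psi x) * (- (G x).1),
   - (chi x.2 * (step (psi x - b x.2) * ((G x).2 - b' x.2))) + step (- psi x) * (- (G x).2)).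

Lemma chi_case t : chi t = 0 \/ chi t = 1.
Proof. by rewrite /chi; case: cut; [case: (_ < _); [right|left]|right]. Qed.

Lemma measurable_chi : measurable_fun (D : set plane) (fun x : plane => chi x.2).
Proof.
apply: measurable_funTS; rewrite /chi; case: cut => //.
rewrite (_ : (fun x => _) = (fun b : bool => b%:R : R) \o (fun x : plane => x.2 < T))//.
by apply: measurableT_comp => //; apply: measurable_fun_ltr => //; exact: measurable_snd.
Qed.

Lemma sq_int_chi w : sqi w -> sqi (fun x => chi x.2 * w x).
Proof.
move=> sw; apply: (sq_int_dominated mD _ sw).
  by apply: measurable_funM; [exact: measurable_chi|case: sw].
by move=> x _; rewrite normrM ler_piMl//; case: (chi_case x.2) => ->; rewrite ?normr1 ?normr0.
Qed.

Lemma dist2_chi v w : sqi v -> sqi w ->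
  dist2 (fun x => chi x.2 * v x) (fun x => chi x.2 * w x) <= dist2 v w.
Proof.
move=> sv sw; apply: Rint_le => //; try (apply: dist2_integrable => //; exact: sq_int_chi).
move=> x _; rewrite -mulrBr exprMn ler_piMl ?sqr_ge0//.
by case: (chi_case x.2) => ->; rewrite ?expr0n ?expr1n.
Qed.

Let cb : continuous (fun x : R * R => b x.2).
Proof. by have [] := C1_snd (@is_derive_barrier R Q) (@continuous_barrier' R Q). Qed.

Let cb' : continuous (fun x : R * R => b' x.2).
Proof. by have [] := C1_snd (@is_derive_barrier R Q) (@continuous_barrier' R Q). Qed.

Let sG1 : sqi (fun x => (G x).1). Proof. by case: sG. Qed.
Let sG2 : sqi (fun x => (G x).2). Proof. by case: sG. Qed.
Let szw : sqi (fun x => psi x - b x.2). Proof. exact (sq_int_sub mD spsi (csqi cb)). Qed.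
Let sN w : sqi w -> sqi (fun x => - w x).
Proof. by move=> sw; apply: (eq_sq_int mD _ (sq_int_scale mD (-1) sw)) => x _; rewrite mulN1r. Qed.
Let sGb : sqi (fun x => (G x).2 - b' x.2). Proof. exact (sq_int_sub mD sG2 (csqi cb')). Qed.
Let mzw : measurable_fun (D : set plane) (fun x => psi x - b x.2). Proof. by case: szw. Qed.
Let mNpsi : measurable_fun (D : set plane) (fun x => - psi x). Proof. by case: (sN spsi). Qed.

Lemma sq_int_cor : sqi cor /\ sq_int_pair h0 h1 N corG.
Proof.
split; [|split].
- apply: (sq_int_add mD (sN (sq_int_chi (sq_int_pos mD szw)))).
  exact (sq_int_pos mD (sN spsi)).
- apply: (sq_int_add mD (sN (sq_int_chi (sq_int_step_mul mD mzw sG1)))).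
  exact (sq_int_step_mul mD mNpsi (sN sG1)).
- apply: (sq_int_add mD (sN (sq_int_chi (sq_int_step_mul mD mzw sGb)))).
  exact (sq_int_step_mul mD mNpsi (sN sG2)).
Qed.

Lemma cor_C1 p p1 p2 e e' : 0 < e -> 0 < e' -> C1 p p1 p2 ->
  (cut -> forall s, p (s, T) = b T) ->
  C1 (fun x => - (chi x.2 * spos e (p x - b x.2)) + spos e' (- p x))
     (fun x => - (chi x.2 * (spos' e (p x - b x.2) * p1 x)) + spos' e' (- p x) * (- p1 x))
     (fun x => - (chi x.2 * (spos' e (p x - b x.2) * (p2 x - b' x.2))) + spos' e' (- p x) * (- p2 x)).
Proof.
move=> e0 e'0 cp pT.
have cz : C1 (fun x => p x - b x.2) (fun x => p1 x - 0) (fun x => p2 x - b' x.2).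
  by apply: (C1_sub cp); apply: C1_snd; [exact: is_derive_barrier|exact: continuous_barrier'].
have c1 : C1 (fun x => chi x.2 * spos e (p x - b x.2))
     (fun x => chi x.2 * (spos' e (p x - b x.2) * (p1 x - 0)))
     (fun x => chi x.2 * (spos' e (p x - b x.2) * (p2 x - b' x.2))).
  rewrite /chi; case: cut pT => pT.
    by apply: C1_cut => // s; rewrite pT//= subrr.
  apply: eq_C1 (C1_comp (fun t => is_derive_spos t e0) (continuous_spos' e0) cz);
    by move=> x; rewrite mul1r.
have c2 := C1_comp (fun t => is_derive_spos t e'0) (continuous_spos' e'0) (C1_scale (-1) cp).
by apply: eq_C1 (C1_add (C1_scale (-1) c1) c2) => x; rewrite ?mulN1r ?subr0.
Qed.

(** Where [0 <= bd <= b], the value [p] exceeds [b] by at most its distance to [bd], and likewise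
    for its depth below 0. So the correction of an approximant is as small on the boundary as its
    error. *)
Lemma cor_bdry_le p e e' : 0 < e -> 0 < e' -> bdry_forall h0 h1 N (fun x =>
  `|- (chi x.2 * spos e (p x - b x.2)) + spos e' (- p x)| <= `|p x - bd x|).
Proof.
move=> e0 e'0.
have key x : 0 <= bd x /\ (chi x.2 = 0 \/ bd x <= b x.2) ->
    `|- (chi x.2 * spos e (p x - b x.2)) + spos e' (- p x)| <= `|p x - bd x|.
  move=> [bdx ch].
  have ch' : chi x.2 = 0 \/ chi x.2 = 1 /\ bd x <= b x.2.
    by case: (chi_case x.2) ch => [->|->] [ce|h]; [left|left|exfalso; lra|right].
  have := spos_ge0 (p x - b x.2) e0; have := spos_le (p x - b x.2) e0.
  have := spos_ge0 (- p x) e'0; have := spos_le (- p x) e'0.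
  have := ler_norm (p x - bd x); have := ler_norm (bd x - p x); rewrite -normrN opprB.
  move: (spos e _) (spos e' _) => A B.
  case: (pos_case (p x - b x.2)) => -[i ->]; case: (pos_case (- p x)) => -[j ->] *;
    rewrite ler_norml; case: ch' => [->|[-> h]]; rewrite ?mul0r ?mul1r; lra.
by case: bd_ok => b1 b2 b3 b4; split => t ht; apply: key; [exact: b1|exact: b2|exact: b3|exact: b4].
Qed.

Lemma cor_approx e : 0 < e -> exists q q1 q2, trace_approx h0 h1 N cor corG (fun=> 0) e q q1 q2.
Proof.
(* The function and its two partials each collect two errors, doubled by [dist2_add]: [4 * (e / 24)]
   is below [e / 4], and three such terms stay below [e]. *)
move=> e0; have c0 : 0 < e / 24 by rewrite divr_gt0.
have [a [d [a0 d0 L]]] := pos_limit mD Dfin szw sG1 sGb c0.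
have [a' [d' [a'0 d'0 L']]] := pos_limit mD Dfin (sN spsi) (sN sG1) (sN sG2) c0.
have m0 : 0 < Num.min (Num.min d d') e by rewrite !lt_min d0 d'0 e0.
have [p [p1 [p2 [[cp gp bp] pT]]]] := app m0.
have [cp0 cp1 cp2 _ _] := cp.
have sp := csqi cp0; have sp1 := csqi cp1; have sp2 := csqi cp2.
rewrite (Rint_gap spsi sG1 sG2 sp sp1 sp2) in gp.
have [md md'] : Num.min (Num.min d d') e <= d /\ Num.min (Num.min d d') e <= d'.
  by split; rewrite !ge_min lexx ?orbT.
have ub v w (v' w' : R * R -> R) : (forall x, v' x - w' x = v x - w x \/ v' x - w' x = - (v x - w x)) ->
    dist2 v' w' = dist2 v w.
  by move=> h; apply: eq_Rintegral => x _; case: (h x) => ->; rewrite ?sqrrN.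
have sz' : sqi (fun x => p x - b x.2) := sq_int_sub mD sp (csqi cb).
have sp2' : sqi (fun x => p2 x - b' x.2) := sq_int_sub mD sp2 (csqi cb').
have [gp0 gp1 gp2] := sum3_lt (dist2_ge0 _ _ _ _) (dist2_ge0 _ _ _ _) (dist2_ge0 _ _ _ _) gp.
have hz : dist2 (fun x => p x - b x.2) (fun x => psi x - b x.2) < d.
  by rewrite (ub p psi); [exact: lt_le_trans gp0 md|move=> x; left; ring].
have hz2 : dist2 (fun x => p2 x - b' x.2) (fun x => (G x).2 - b' x.2) < d.
  by rewrite (ub p2 (fun x => (G x).2)); [exact: lt_le_trans gp2 md|move=> x; left; ring].
have hN v w : dist2 v w < Num.min (Num.min d d') e -> dist2 (fun x => - v x) (fun x => - w x) < d'.
  by move=> h; rewrite (ub v w); [exact: lt_le_trans h md'|move=> x; right; ring].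
have [l0 l1 l2] := L _ _ _ sz' sp1 sp2' hz (lt_le_trans gp1 md) hz2.
have [k0 k1 k2] := L' _ _ _ (sN sp) (sN sp1) (sN sp2) (hN _ _ gp0) (hN _ _ gp1) (hN _ _ gp2).
have cq := cor_C1 a0 a'0 cp pT.
have mz' : measurable_fun (D : set plane) (fun x => p x - b x.2) by case: sz'.
have mNp : measurable_fun (D : set plane) (fun x => - p x) by case: (sN sp).
have step2 A A0 B B0 : sqi A -> sqi A0 -> sqi B -> sqi B0 -> dist2 A A0 < e / 24 -> dist2 B B0 < e / 24 ->
    dist2 (fun x => - (chi x.2 * A x) + B x) (fun x => - (chi x.2 * A0 x) + B0 x) < e / 4.
  move=> sA sA0 sB sB0 hA hB.
  have h := dist2_add mD (sN (sq_int_chi sA)) (sN (sq_int_chi sA0)) sB sB0.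
  have h' := dist2_chi sA sA0.
  rewrite (ub (fun x => chi x.2 * A x) (fun x => chi x.2 * A0 x)
    (fun x => - (chi x.2 * A x)) (fun x => - (chi x.2 * A0 x))) in h; last by move=> x; right; ring.
  by apply: le_lt_trans h _; apply: sum2_quarter => //; exact: le_lt_trans h' hA.
have [sc [sc1 sc2]] := sq_int_cor; have [cq0 cq1 cq2 _ _] := cq.
eexists; eexists; eexists; split; first exact: cq.
- rewrite (Rint_gap sc sc1 sc2 (csqi cq0) (csqi cq1) (csqi cq2)).
  have h0' := step2 _ _ _ _ (sq_int_spos mD a0 sz') (sq_int_pos mD szw)
    (sq_int_spos mD a'0 (sN sp)) (sq_int_pos mD (sN spsi)) l0 k0.
  have h1' := step2 _ _ _ _ (sq_int_spos'_mul mD a0 mz' sp1) (sq_int_step_mul mD mzw sG1)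
    (sq_int_spos'_mul mD a'0 mNp (sN sp1)) (sq_int_step_mul mD mNpsi (sN sG1)) l1 k1.
  have h2' := step2 _ _ _ _ (sq_int_spos'_mul mD a0 mz' sp2') (sq_int_step_mul mD mzw sGb)
    (sq_int_spos'_mul mD a'0 mNp (sN sp2)) (sq_int_step_mul mD mNpsi (sN sG2)) l2 k2.
  exact: sum3_quarter.
- apply: le_lt_trans (bdry_norm2_le _ _ _) (lt_le_trans bp _).
  + by apply: bdry_measurable_sub; [apply: continuous_bdry_measurable|split; exact: measurable_cst].
  + by apply: bdry_measurable_sub => //; apply: continuous_bdry_measurable.
  + by have [B1 B2 B3 B4] := cor_bdry_le p a0 a'0; split => t ht; rewrite subr0; [exact: B1|exact: B2|exact: B3|exact: B4].
  + by rewrite lee_fin ge_min lexx orbT.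
Qed.

Let Y x := gF Q (psi x) * (G x).2 - gF Q (b x.2) * b' x.2.

(* Below the height [T] the integrand is the vertical derivative of
   [pos (Phi psi - Phi b)], which vanishes on the lower wall. *)
Lemma calibration_ge0 (Phi : R -> R) : (forall s, is_derive s (1 : R) Phi (gF Q s)) ->
  0 <= \int[leb2]_(x in D) (chi x.2 * (step (Phi (psi x) - Phi (b x.2)) * Y x)).
Proof.
move=> dPhi; set J := (X in 0 <= X).
have cPhi : continuous Phi by move=> s; exact: is_derive_continuous (dPhi s).
have Q6 : 0 < 6 * Q by rewrite mulr_gt0.
have gC s : `|gF Q s| <= 6 * Q by rewrite ger0_norm ?gF_le// gF_ge0.
pose Z w x := Phi (w x) - Phi (b x.2).
pose X w q x := gF Q (w x) * q x - gF Q (b x.2) * b' x.2.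
have PhiN w : sqi w -> sqi (Z w).
  move=> sw.
  have s1 : sqi (fun x => Phi (w x) - Phi 0).
    apply: (sq_int_dominated mD _ (sq_int_scale mD (6 * Q) sw)).
      apply: measurable_funB => //; apply: measurable_comp_cont => //; by case: sw.
    by move=> x _; have := Phi_lip Q0 dPhi (w x) 0; rewrite subr0 normrM (ger0_norm (ltW Q6)).
  have s2 : sqi (fun x => Phi (b x.2) - Phi 0).
    apply: csqi => x; apply: cvgB; last exact: cvg_cst.
    by apply: (@continuous_comp _ _ _ (fun x : R * R => b x.2) Phi); [exact: cb|exact: cPhi].
  by apply: (eq_sq_int mD _ (sq_int_sub mD s1 s2)) => x _; rewrite /Z; ring.
have cgb : continuous (fun x : R * R => gF Q (b x.2) * b' x.2).
  move=> x; apply: cvgM; last exact: cb'.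
  by apply: (@continuous_comp _ _ _ (fun x : R * R => b x.2) (gF Q)); [exact: cb|exact: continuous_gF].
have sgm w q : sqi w -> sqi q -> sqi (fun x => gF Q (w x) * q x).
  by move=> sw sq; apply: (sq_int_comp_mul mD (continuous_gF Q0) gC _ sq); case: sw.
have sY w q : sqi w -> sqi q -> sqi (X w q).
  by move=> sw sq; exact (sq_int_sub mD (sgm w q sw sq) (csqi cgb)).
have sY0 := sY _ _ spsi sG2; have sZ := PhiN _ spsi.
have mZ : measurable_fun (D : set plane) (Z psi) by case: sZ.
rewrite -oppr_le0; apply/ler_addgt0Pr => eta eta0; rewrite add0r.
pose m := fine (leb2 D) + 1.
have m0 : 0 < m by rewrite ltr_wpDl// fine_ge0.
pose a := eta / (4 * m); have a0 : 0 < a by rewrite divr_gt0// mulr_gt0.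
have c0 : 0 < a * (eta / 4) by rewrite mulr_gt0// divr_gt0.
(* Only the vertical derivative matters here, so [Y] fills both gradient slots. *)
have [e [d [e0 d0 L]]] := pos_limit mD Dfin sZ sY0 sY0 c0.
have [d' d'0 L'] := mul_limit mD Dfin (continuous_gF Q0) gC (gF_modulus Q0) spsi sG2 d0.
pose al := eta / (4 * (6 * Q) * (2 * N)).
have al0 : 0 < al by rewrite divr_gt0// !mulr_gt0.
have be0 : 0 < al * (eta / (4 * (6 * Q))) by rewrite mulr_gt0// divr_gt0// mulr_gt0.
(* Three demands on the approximant [p]: [d'] keeps [gF p * p2] near its limit, the second keeps
   [Phi p] near [Phi psi], as [Phi] has Lipschitz constant [6 * Q], and the third makes the integral
   over the lower wall small. *)
pose k := Num.min (Num.min d' (d / (6 * Q) ^+ 2)) (al * (eta / (4 * (6 * Q)))).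
have k0 : 0 < k by rewrite !lt_min d'0 be0 divr_gt0// exprn_gt0.
have [p [p1 [p2 [[cp gp bp] _]]]] := app k0.
have [cp0 cp1 cp2 _ _] := cp.
have sp := csqi cp0; have sp1 := csqi cp1; have sp2 := csqi cp2.
rewrite (Rint_gap spsi sG1 sG2 sp sp1 sp2) in gp.
have [gp0 gp1 gp2] := sum3_lt (dist2_ge0 _ _ _ _) (dist2_ge0 _ _ _ _) (dist2_ge0 _ _ _ _) gp.
have [kd' kd kb] : [/\ k <= d', k <= d / (6 * Q) ^+ 2 & k <= al * (eta / (4 * (6 * Q)))].
  by split; rewrite !ge_min lexx ?orbT.
have hY : dist2 (X p p2) Y < d.
  have -> : dist2 (X p p2) Y =
      dist2 (fun x => gF Q (p x) * p2 x) (fun x => gF Q (psi x) * (G x).2).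
    by apply: eq_Rintegral => x _; congr (_ ^+ 2); rewrite /X /Y; ring.
  by apply: L' => //; [exact: lt_le_trans gp0 kd'|exact: lt_le_trans gp2 kd'].
have hZ : dist2 (Z p) (Z psi) < d.
  apply: le_lt_trans (_ : (6 * Q) ^+ 2 * dist2 p psi < d); last first.
    by rewrite mulrC -ltr_pdivlMr ?exprn_gt0//; exact: lt_le_trans gp0 kd.
  have ipp := dist2_integrable mD sp spsi.
  rewrite -Rint_scale//; apply: Rint_le => //.
  - exact (dist2_integrable mD (PhiN _ sp) sZ).
  - exact: integrable_scale.
  move=> x _; rewrite (_ : _ - _ = Phi (p x) - Phi (psi x)); last by rewrite /Z; ring.
  rewrite -[leLHS]real_normK ?num_real// -[(p x - psi x) ^+ 2]real_normK ?num_real// -exprMn.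
  by rewrite ler_pXn2r ?nnegrE ?Phi_lip// mulr_ge0// ltW.
have [_ l1 _] := L _ _ _ (PhiN _ sp) (sY _ _ sp sp2) (sY _ _ sp sp2) hZ hY hY.
have sA := sq_int_spos'_mul mD e0 (sq_int_measurable (PhiN _ sp)) (sY _ _ sp sp2).
have sB := sq_int_step_mul mD mZ sY0.
have close := Rint_dist2 mD Dfin (sq_int_chi sA) (sq_int_chi sB) a0.
have cK : C1 (fun x => spos e (Z p x))
    (fun x => spos' e (Z p x) * (gF Q (p x) * p1 x - gF Q (b x.2) * 0))
    (fun x => spos' e (Z p x) * X p p2 x).
  apply: (C1_comp (fun t => is_derive_spos t e0) (continuous_spos' e0)).
  apply: C1_sub; first exact: C1_comp dPhi (continuous_gF Q0) cp.
  apply: C1_comp dPhi (continuous_gF Q0) _; apply: C1_snd.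
    exact: is_derive_barrier.
  exact: continuous_barrier'.
have V := Rint_vertical cK (fun x => spos_ge0 _ e0) wall.
have VE : \int[leb2]_(x in D) (chi x.2 * (spos' e (Z p x) * X p p2 x)) =
    \int[leb2]_(x in D) ((x.2 < T)%R%:R * (spos' e (Z p x) * X p p2 x)).
  by apply: eq_Rintegral => x /set_mem Dx; rewrite chiD.
rewrite -VE {VE} in V.
(* On the lower wall [b >= 0] gives [Phi b >= Phi 0], hence [spos e (Z p) <= 6 * Q * |p|], and [p]
   is small there in L^2 because the boundary datum is 0. *)
have W : \int[leb]_(t in `]- N, N[) spos e (Z p (t, h0 t)) <= eta / 2.
  have pc t : - N < t < N -> spos e (Z p (t, h0 t)) <= 6 * Q * `|p (t, h0 t)|.
    move=> tN; have /andP[hT _] := wall tN.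
    have b0 : 0 <= b (h0 t) by apply: barrier_ge0 => //; exact: le_trans (ltW hT) T1.
    have Pb := Phi_le Q0 dPhi b0.
    apply: le_trans (spos_le _ e0) _.
    have := Phi_lip Q0 dPhi (p (t, h0 t)) 0; rewrite subr0 => lip.
    have q0 : 0 <= 6 * Q * `|p (t, h0 t)| by rewrite mulr_ge0// ltW.
    exact: pos_le_lip lip q0 Pb.
  pose I := `]- N, N[%classic : set (measurableTypeR R).
  have mI : measurable I by exact: measurable_itv.
  have lI : leb I = (2 * N)%:E.
    have := @lebesgue_measure_itv R `]- N, N[; rewrite /I /= => ->.
    by rewrite lte_fin gtrN// -EFinB; congr _%:E; ring.
  have fI : (leb I < +oo)%E by rewrite lI ltry.
  have cq (l : R * R -> R) : continuous l -> sq_int leb I (fun t => l (t, h0 t)).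
    move=> cl; have clh : continuous (fun t => l (t, h0 t)).
      move=> t; apply: (@continuous_comp _ _ _ (fun t => (t, h0 t)) l); last exact: cl.
      by apply: (@cvg_pair _ _ _ _ (nbhs t) (nbhs (h0 t)) _ _ _ id h0); [exact: cvg_id|exact: ch0].
    have [C HC] := @continuous2_bounded R (fun x => l (x.1, h0 x.1)) N (continuous_fst_comp clh).
    apply: (sq_int_bounded mI fI); first by apply: measurable_funTS; exact: continuous_measurable_fun.
    move=> t; rewrite /I /= in_itv /= -ltr_norml => tN.
    by apply: (HC (t, 0)) => /=; [exact: ltW|rewrite normr0 ltW].
  have sp0 : sq_int leb I (fun t => `|p (t, h0 t)|).
    by apply: (cq (fun x => `|p x|)) => x; apply: cvg_norm; exact: cp0.
  have cs : continuous (fun x => spos e (Z p x)) by case: cK.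
  have B : \int[leb]_(t in I) (`|p (t, h0 t)| - 0) ^+ 2 < k.
    have iB := dist2_integrable mI sp0 (sq_int_bounded mI fI (measurable_cst (0 : R)) (fun t _ => lexx `|0|)).
    rewrite -lte_fin -(Rint_EFin mI iB); apply: le_lt_trans bp.
    apply: (le_trans _ (first_le _ _ _ _)); try by apply: integral_ge0 => t _; rewrite lee_fin sqr_ge0.
    rewrite le_eqVlt; apply/orP; left; apply/eqP; apply: eq_integral => t.
    rewrite inE /I /= in_itv /= => tN.
    by rewrite bd0// !subr0 real_normK ?num_real.
  have s00 : sq_int leb I (fun=> 0) := sq_int_bounded mI fI (measurable_cst (0 : R)) (fun t _ => lexx `|0|).
  have R1 := Rint_dist2 mI fI sp0 s00 al0.
  apply: le_trans (_ : 6 * Q * \int[leb]_(t in I) `|p (t, h0 t)| <= _).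
    have ip0 := sq_int_integrable mI fI sp0.
    rewrite -Rint_scale//; apply: Rint_le => //.
    - by apply: (sq_int_integrable mI fI); exact: (cq _ cs).
    - exact: integrable_scale.
  have {}R1 : \int[leb]_(t in I) `|p (t, h0 t)| <=
      al * (2 * N) + al^-1 * \int[leb]_(t in I) (`|p (t, h0 t)| - 0) ^+ 2.
    have E : fine (leb I) = 2 * N by rewrite lI.
    by rewrite -E; move: R1; rewrite Rintegral_cst// mul0r subr0; exact: (le_trans (ler_norm _)).
  rewrite mulrC -ler_pdivlMr//; apply: le_trans R1 _.
  have E1 : al * (2 * N) = eta / (4 * (6 * Q)) by rewrite /al; field; rewrite !gt_eqF.
  have E2 : al^-1 * \int[leb]_(t in I) (`|p (t, h0 t)| - 0) ^+ 2 <= eta / (4 * (6 * Q)).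
    by rewrite ler_pdivrMl// ltW// (lt_le_trans B).
  rewrite E1; apply: le_trans (lerD (lexx _) E2) _.
  by rewrite le_eqVlt; apply/orP; left; apply/eqP; field; rewrite gt_eqF.
have E1 : a * fine (leb2 D) <= eta / 4.
  apply: le_trans (_ : a * m <= _); first by rewrite ler_pM2l// lerDl.
  by rewrite le_eqVlt; apply/orP; left; apply/eqP; rewrite /a; field; rewrite gt_eqF.
have E2 := le_lt_trans (dist2_chi sA sB) l1.
have E3 : a^-1 * dist2 (fun x => chi x.2 * (spos' e (Z p x) * X p p2 x))
    (fun x => chi x.2 * (step (Z psi x) * Y x)) <= eta / 4.
  by rewrite ler_pdivrMl// ltW.
have {}close := le_trans close (lerD E1 E3).
exact: combine close V W.
Qed.

Let density u (H : R * R -> R * R) x := ((H x).1 ^+ 2 + (H x).2 ^+ 2) / 2 + F Q (u x).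

Let integrable_density u H : sqi u -> sq_int_pair h0 h1 N H ->
  leb2.-integrable D (EFin \o density u H).
Proof.
move=> [mu_ _] [[m1 i1] [m2 i2]].
have i3 : leb2.-integrable D (EFin \o (fun x => gF Q (u x) ^+ 2)).
  apply: (integrable_bounded mD Dfin (C := (6 * Q) ^+ 2)).
    by apply: measurable_funX; exact: measurable_comp_cont (continuous_gF Q0) mu_.
  move=> x _; rewrite normrX ger0_norm ?gF_ge0// ler_pXn2r ?nnegrE ?gF_ge0 ?gF_le//.
  by rewrite mulr_ge0// ltW.
have := integrable_scale mD 2^-1 (integrable_add mD (integrable_add mD i1 i2) i3).
by apply: eq_integrable_on => // x _; rewrite /density F_gF//; field.
Qed.

Let amgm (A g1 r c : R) : r * g1 - c * c <= (A ^+ 2 + g1 ^+ 2) / 2 + r ^+ 2 / 2 - ((0 ^+ 2 + c ^+ 2) / 2 + c ^+ 2 / 2).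
Proof. by have := sqr_ge0 A; have := sqr_ge0 (g1 - r); nra. Qed.

(* AM-GM: [gF psi * G.2 <= G.2 ^ 2 / 2 + F psi], with equality along the barrier because
   [b' = gF b]. *)
Let density_cor (Phi : R -> R) x :
  (forall s, is_derive s (1 : R) Phi (gF Q s)) -> D x ->
  chi x.2 * (step (Phi (psi x) - Phi (b x.2)) * (gF Q (psi x) * (G x).2 - gF Q (b x.2) * b' x.2)) <=
  density psi G x - density (fun x => psi x + cor x)
    (fun x => ((G x).1 + (corG x).1, (G x).2 + (corG x).2)) x.
Proof.
move=> dPhi Dx; rewrite /density /cor /corG /= !F_gF//.
have gF0 : gF Q 0 = 0 by rewrite gF_le0.
have cases : chi x.2 = 0 \/ chi x.2 = 1 /\ x.2 < T.
  by rewrite chiD//; case: (x.2 < T); [right|left].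
have step0 t : t <= 0 -> step t = 0 by move=> t0; rewrite /step ltNge t0.
have step1 t : 0 < t -> step t = 1 by move=> t0; rewrite /step t0.
have pos_le0 t : t <= 0 -> pos t = 0 by move=> t0; case: (pos_case t) => -[] //; lra.
(* Where [psi < 0] the competitor is 0 with zero gradient, so its density is 0; the left-hand side
   vanishes, since [chi] is 0 or [Phi psi <= Phi b]. *)
have [p0|p0] := ltP (psi x) 0.
  rewrite (step1 (- psi x)) ?oppr_gt0// (pos_id (t := - psi x)) ?oppr_ge0 ?(ltW p0)//.
  have e0 (A B C : R) : A = 0 -> 0 <= B -> C = 0 -> A <= B - C by lra.
  have ch : chi x.2 * step (Phi (psi x) - Phi (b x.2)) = 0 /\
            chi x.2 * pos (psi x - b x.2) = 0 /\ chi x.2 * step (psi x - b x.2) = 0.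
    case: cases => [->|[-> xT]]; first by rewrite !mul0r.
    have b0 : psi x <= b x.2 by apply: ltW; apply: lt_le_trans p0 _; apply: barrier_ge0 => //; exact: le_trans (ltW xT) T1.
    by rewrite !step0 ?pos_le0 ?mulr0// subr_le0//; exact: Phi_le b0.
  case: ch => c1 [c2 c3]; apply: e0.
  - by rewrite mulrA c1 mul0r.
  - by rewrite addr_ge0// mulr_ge0// ?addr_ge0// sqr_ge0.
  - rewrite c2 !mulrA c3 !mul0r !mul1r !oppr0 !add0r !subrr gF0; ring.
rewrite (step0 (- psi x)) ?oppr_le0// (pos_le0 (- psi x)) ?oppr_le0// !mul0r !addr0.
case: cases => [->|[-> xT]].
  by rewrite !mul0r oppr0 !addr0 subrr.
rewrite !mul1r; have x1 : x.2 < 1 by exact: lt_le_trans xT T1.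
have [pb|pb] := leP (psi x) (b x.2).
  rewrite !step0 ?subr_le0//; last exact: Phi_le pb.
  by rewrite pos_le0 ?subr_le0// !mul0r oppr0 !addr0 subrr.
have bx0 := barrier_ge0 Q0 (ltW x1).
have PP := Phi_lt Q0 dPhi bx0 (barrier_ltQ Q0 x1) pb.
rewrite !step1 ?subr_gt0// pos_id ?subr_ge0 ?(ltW pb)// !mul1r.
rewrite (_ : psi x + - _ = b x.2); last by ring.
rewrite (_ : (G x).2 - _ = b' x.2); last by ring.
by rewrite subrr gF_barrier ?(ltW x1)//; exact: amgm.
Qed.

Lemma competitor_energy :
  (energy h0 h1 N Q (fun x => (psi x + cor x)%R)
     (fun x => ((G x).1 + (corG x).1, (G x).2 + (corG x).2)%R) <= energy h0 h1 N Q psi G)%E.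
Proof.
have [Phi [dPhi _]] := Phi_exists Q0.
have J := calibration_ge0 dPhi.
have [sc [sc1 sc2]] := sq_int_cor.
set Gu := (fun x => (_, _)).
have sGu : sq_int_pair h0 h1 N Gu.
  by split; [exact: (sq_int_add mD sG1 sc1)|exact: (sq_int_add mD sG2 sc2)].
have iu := integrable_density (sq_int_add mD spsi sc) sGu.
have ip := integrable_density spsi sG.
rewrite /energy (Rint_EFin mD iu) (Rint_EFin mD ip) lee_fin -subr_ge0 -Rint_sub//.
apply: le_trans J _.
have cPhi : continuous Phi by move=> s; exact: is_derive_continuous (dPhi s).
have gC s : `|gF Q s| <= 6 * Q by rewrite ger0_norm ?gF_le// gF_ge0.
have s1 : sqi (fun x => gF Q (psi x) * (G x).2).
  by apply: (sq_int_comp_mul mD (continuous_gF Q0) gC _ sG2); case: spsi.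
have s2 : sqi (fun x => gF Q (b x.2) * b' x.2).
  apply: csqi => x; apply: cvgM; last exact: cb'.
  by apply: (@continuous_comp _ _ _ (fun x : R * R => b x.2) (gF Q)); [exact: cb|exact: continuous_gF].
have mz : measurable_fun (D : set plane) (fun x => Phi (psi x) - Phi (b x.2)).
  apply: measurable_funB; first by apply: measurable_comp_cont => //; case: spsi.
  apply: measurable_comp_cont => //; apply: measurable_funTS.
  exact: continuous_measurable_plane.
have sj := sq_int_chi (sq_int_step_mul mD mz (sq_int_sub mD s1 s2)).
apply: Rint_le => //.
- exact: sq_int_integrable sj.
- exact: integrable_sub.
- by move=> x; exact: density_cor.
Qed.

(* The corrected minimizer is again a minimizer, hence equal to it almost everywhere. *)
Lemma cor_ae0 g Gg : is_the_minimizer h0 h1 N Q g psi ->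
  traced h0 h1 N (fun x => psi x - g x) Gg (fun=> 0) ->
  {ae leb2, forall x, D x -> cor x = 0}.
Proof.
move=> minpsi tg; have [sc scG] := sq_int_cor.
have tpsi : traced h0 h1 N psi G bd.
  by split => // e /app[p [p1 [p2 [A _]]]]; exists p, p1, p2.
have tc : traced h0 h1 N cor corG (fun=> 0) by split => // e; exact: cor_approx.
have bm0 : bdry_measurable h0 h1 N (fun=> 0) by split; exact: measurable_cst.
have le1 : `|1 : R| <= 1 by rewrite normr1.
have wu := traced_weak_gradient ch0 ch1 N0 (traced_lin ch0 ch1 N0 le1 le1 bdm bm0 tpsi tc).
have tu := traced_lin ch0 ch1 N0 le1 le1 bm0 bm0 tg tc.
rewrite (_ : (fun x => 1 * psi x + 1 * cor x) = (fun x => psi x + cor x)) in wu; last first.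
  by apply/funext => x; rewrite !mul1r.
rewrite (_ : (fun x => (_, _)) = (fun x => ((G x).1 + (corG x).1,
  (G x).2 + (corG x).2))) in wu; last by apply/funext => x; rewrite !mul1r.
rewrite (_ : (fun x => 1 * (psi x - g x) + 1 * cor x) = (fun x => psi x + cor x - g x)) in tu; last first.
  by apply/funext => x; ring.
rewrite (_ : (fun x => 1 * 0 + 1 * 0) = (fun=> 0)) in tu; last first.
  by apply/funext => x; rewrite !mulr0 addr0.
have adm : admissible h0 h1 N g (fun x => psi x + cor x).
  by split; [eexists; exact: wu|apply/(has_traceP ch0 ch1 N0); eexists; exact: tu].
have := competitor_ae ch0 ch1 N0 Q0 minpsi (traced_weak_gradient ch0 ch1 N0 tpsi) adm wu competitor_energy.
apply: ae_imply => x h Dx; apply: (@addrI _ (psi x)); rewrite addr0; exact: h.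
Qed.

(** A neighbourhood contains an open rectangle of positive area. Together with continuity, this
    turns an equality almost everywhere into a pointwise one. *)
Lemma nbhs_not_negligible (A : set (R * R)) x : nbhs x A -> ~ leb2.-negligible (A : set plane).
Proof.
move=> [[/= U V] [/nbhs_ballP[r /= r0 rU] /nbhs_ballP[s /= s0 sV]] UV] nA.
have sub : (`]x.1 - r, x.1 + r[ `*` `]x.2 - s, x.2 + s[ : set plane) `<=` A.
  move=> y [/= y1 y2]; apply: UV; split => /=; [apply: rU|apply: sV]; rewrite /ball /=.
    by move: y1; rewrite in_itv /= ltr_distlC; case/andP => -> ->.
  by move: y2; rewrite in_itv /= ltr_distlC; case/andP => -> ->.
have mB : measurable (`]x.1 - r, x.1 + r[ `*` `]x.2 - s, x.2 + s[ : set plane).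
  by apply: measurableX; exact: measurable_itv.
have len (c d : R) : 0 < d -> leb `]c - d, c + d[%classic = (2 * d)%:E.
  move=> d0; have := @lebesgue_measure_itv R `]c - d, c + d[; rewrite /= => ->.
  rewrite lte_fin ifT; last by lra.
  by rewrite -EFinB; congr _%:E; ring.
have z : leb2 (`]x.1 - r, x.1 + r[ `*` `]x.2 - s, x.2 + s[ : set plane) = 0%E.
  by apply/negligibleP => //; exact: negligibleS sub nA.
move: z; rewrite product_measure1E; [|exact: measurable_itv|exact: measurable_itv].
move=> z; have := etrans (esym z) (congr2 (fun m k => m * k)%E (len x.1 r r0) (len x.2 s s0)).
by rewrite -EFinM => -[] /esym/eqP; rewrite !mulf_eq0 !(gt_eqF r0, gt_eqF s0) pnatr_eq0.
Qed.

(** Below height 0 the barrier is 0, so [cor] reduces to [- psi]; it vanishes almost everywhere, and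
    the continuity of [psi] does the rest. *)
Lemma minimizer_eq0 g Gg (xbar y : R) : 0 < T -> is_the_minimizer h0 h1 N Q g psi ->
  traced h0 h1 N (fun x => psi x - g x) Gg (fun=> 0) -> D (xbar, y) -> y < 0 -> psi (xbar, y) = 0.
Proof.
move=> T0 minpsi tg Dy y0; have ae0 := cor_ae0 minpsi tg; have [_ _ cpsi] := minpsi.
apply/eqP/negPn/negP => ny.
have oD : open (D : set (R * R)) by exact: open_trunc_nozzle.
have cD : {in D, continuous psi}.
  rewrite -(continuous_open_subspace _ oD); apply: continuous_subspaceW cpsi.
  by move=> x [/andP[a1 a2] a3]; split => //=; rewrite (ltW a1) ltW.
have Ay : nbhs (xbar, y) [set x | [/\ D x, x.2 < 0 & psi x != 0]].
  have n1 : \forall x \near (xbar, y), D x by exact: open_nbhs_nbhs.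
  have n2 : \forall x \near (xbar, y), x.2 < 0.
    have c2 : continuous (fun x : R * R => - x.2) by move=> x; apply: cvgN; exact: cvg_snd.
    apply: (@filterS _ (nbhs (xbar, y)) _ [set x | 0 < - x.2]); first by move=> x /=; rewrite oppr_gt0.
    by apply: open_nbhs_nbhs; split; [exact: open_pos_set c2|rewrite /= oppr_gt0].
  have n3 : \forall x \near (xbar, y), psi x != 0.
    have c3 : psi z @[z --> (xbar, y)] --> psi (xbar, y) by apply: cD; rewrite inE.
    exact: cvgr_neq0 c3 ny.
  by near=> x; split; near: x.
apply: (nbhs_not_negligible Ay); apply: negligibleS ae0 => x [Dx x0 px] /= /(_ Dx).
rewrite /cor barrier_le0 ?(ltW x0)// chiD// (lt_trans x0 T0) mul1r subr0 => h.
move: px; apply/negP/negPn/eqP; move: h.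
by case: (pos_case (psi x)) => -[? ->]; case: (pos_case (- psi x)) => -[? ->]; lra.
Unshelve. all: by end_near. Qed.

Lemma htilde0_ge0 g Gg (xbar : R) : 0 < T -> is_the_minimizer h0 h1 N Q g psi ->
  traced h0 h1 N (fun x => psi x - g x) Gg (fun=> 0) -> - N < xbar < N -> h0 xbar < 0 ->
  (0 <= htilde0 h0 h1 psi xbar)%E.
Proof.
move=> T0 minpsi tg xN hx; apply/lee_addgt0Pr => e e0; rewrite -leeBlDr// sub0e.
(* A zero of [psi] strictly between the wall and height 0, within [e] of the latter; [h0 xbar / 2]
   keeps it above the wall when [e] is large. *)
pose y := Num.max (h0 xbar / 2) (- e).
have y0 : y < 0 by rewrite gt_max oppr_lt0 e0 andbT; lra.
have hy : h0 xbar < y by rewrite lt_max; apply/orP; left; lra.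
have yh : y < h1 xbar.
  by have /andP[_ Th] := wall xN; exact: lt_le_trans (lt_trans y0 T0) Th.
apply: (@le_trans _ _ y%:E); first by rewrite lee_fin le_max lexx orbT.
apply: ereal_sup_ubound; exists y => //; split; first by rewrite (ltW hy) ltW.
by apply: (minimizer_eq0 T0 minpsi tg) => //; split; [rewrite /nozzle /= hy yh|rewrite /= ltr_norml].
Qed.

End Competitor.

(** * Reflection *)

Section Reflection.
Context {R : realType}.
Implicit Types (x : R * R) (t : R).
Local Notation plane := (measurableTypeR R * measurableTypeR R)%type.
Local Notation leb := (@lebesgue_measure R).
Local Notation leb2 := (@lebesgue_measure R \x @lebesgue_measure R)%E.

Definition flip t : R := 1 - t.

Lemma measurable_flip : measurable_fun [set: measurableTypeR R] (flip : measurableTypeR R -> measurableTypeR R).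
Proof. by apply: measurable_funB; [exact: measurable_cst|exact: measurable_id]. Qed.

Lemma measurable_flip_snd : measurable_fun [set: plane] (flip_snd : plane -> plane).
Proof.
by apply/measurable_fun_pairP; split; [exact: measurable_fst|exact: measurableT_comp measurable_flip measurable_snd].
Qed.

(** Lebesgue measure is determined by the half-open intervals; the reflection moves the closed end
    to the other side without changing the length. *)
Lemma lebesgue_flip (A : set (measurableTypeR R)) : measurable A -> leb (flip @^-1` A) = leb A.
Proof.
move=> mA; pose m' := measure_function_pushforward__canonical__measure_function_Measure leb measurable_flip.
suff h : forall X, ocitv X -> leb X = m' X by rewrite (lebesgue_measure_unique h mA).
move=> _ [[a b]] /= _ <-; rewrite /pushforward.
have -> : flip @^-1` `]a, b] = `[1 - b, 1 - a[%classic.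
  by apply/seteqP; split => t /=; rewrite /flip !in_itv /= => /andP[? ?]; apply/andP; split; lra.
have := @lebesgue_measure_itv R `]a, b]; have := @lebesgue_measure_itv R `[1 - b, 1 - a[.
rewrite /= => -> ->; rewrite !lte_fin ltrD2l ltrN2.
by case: ifP => // _; rewrite -!EFinB; congr _%:E; ring.
Qed.

Lemma lebesgue2_flip_snd (A : set plane) : measurable A -> leb2 (flip_snd @^-1` A) = leb2 A.
Proof.
move=> mA; pose m' := measure_function_pushforward__canonical__measure_function_Measure leb2 measurable_flip_snd.
suff h : forall X Y, measurable X -> measurable Y -> m' (X `*` Y) = (leb X * leb Y)%E.
  by rewrite (product_measure_unique h mA).
move=> X Y mX mY; rewrite /= /pushforward.
have -> : flip_snd @^-1` (X `*` Y) = X `*` (flip @^-1` Y) by [].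
have mF : measurable (flip @^-1` Y : set (measurableTypeR R)).
  by rewrite -(setTI (_ @^-1` _)); exact: measurable_flip.
by rewrite product_measure1E//; congr (_ * _)%E; exact: lebesgue_flip.
Qed.

Lemma ge0_integral_flip (D : set (measurableTypeR R)) (f : R -> \bar R) : measurable D ->
  measurable_fun D f -> (forall t, D t -> 0 <= f t)%E ->
  (\int[leb]_(t in flip @^-1` D) f (flip t) = \int[leb]_(t in D) f t)%E.
Proof.
move=> mD mf f0.
pose m' := measure_function_pushforward__canonical__measure_function_Measure leb measurable_flip.
transitivity (\int[m']_(t in D) f t)%E.
  apply/esym; apply: (ge0_integral_pushforward measurable_flip _ mD mf) => t /set_mem; exact: f0.
by apply: eq_measure_integral => A mA _; exact: lebesgue_flip.
Qed.

Lemma ge0_integral_flip_snd (D : set plane) (f : R * R -> \bar R) : measurable D ->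
  measurable_fun D f -> (forall x, D x -> 0 <= f x)%E ->
  (\int[leb2]_(x in flip_snd @^-1` D) f (flip_snd x) = \int[leb2]_(x in D) f x)%E.
Proof.
move=> mD mf f0.
pose m' := measure_function_pushforward__canonical__measure_function_Measure leb2 measurable_flip_snd.
transitivity (\int[m']_(x in D) f x)%E.
  apply/esym; apply: (ge0_integral_pushforward measurable_flip_snd _ mD mf) => t /set_mem; exact: f0.
by apply: eq_measure_integral => A mA _; exact: lebesgue2_flip_snd.
Qed.

End Reflection.

(** * Symmetry of the minimizer in case (i) *)

Section SymmetricNozzle.
Context {R : realType}.
Implicit Types (u v w b g psi : R * R -> R) (G : R * R -> R * R) (x y : R * R) (s t e : R).
Local Notation plane := (measurableTypeR R * measurableTypeR R)%type.
Local Notation leb := (@lebesgue_measure R).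
Local Notation leb2 := (@lebesgue_measure R \x @lebesgue_measure R)%E.
Variables (h0 h1 : R -> R) (N : R).
Hypotheses (ch0 : continuous h0) (ch1 : continuous h1) (N0 : 0 < N).
Hypothesis h01 : forall t, h1 t = 1 - h0 t.
Local Notation D := (trunc_nozzle h0 h1 N).
Local Notation bnorm := (bdry_norm2 h0 h1 N).
Local Notation sqi := (sq_int leb2 D).
Local Notation bmeas := (bdry_measurable h0 h1 N).

Let mD : measurable (D : set plane).
Proof. exact: (measurable_trunc_nozzle N ch0 ch1). Qed.

Lemma preimage_flip_nozzle : flip_snd @^-1` D = D.
Proof.
apply/seteqP; split => x; rewrite /trunc_nozzle /nozzle /= h01 => -[/andP[a b] c]; split => //;
  by apply/andP; split; lra.
Qed.

Lemma flip_nozzle x : D x -> D (flip_snd x).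
Proof. by rewrite -{1}preimage_flip_nozzle. Qed.

Lemma integral_flip_nozzle (k : R * R -> R) : measurable_fun (D : set plane) k ->
  (forall x, 0 <= k x) ->
  (\int[leb2]_(x in D) (k (flip_snd x))%:E = \int[leb2]_(x in D) (k x)%:E)%E.
Proof.
move=> mk k0; rewrite -[in LHS]preimage_flip_nozzle.
apply: (ge0_integral_flip_snd mD (f := fun x => (k x)%:E)); first exact/measurable_EFinP.
by move=> x _; rewrite lee_fin.
Qed.

Lemma measurable_flip_nozzle (k : R * R -> R) : measurable_fun (D : set plane) k ->
  measurable_fun (D : set plane) (fun x => k (flip_snd x)).
Proof.
move=> mk; apply: (measurable_comp mD _ mk) => //.
  by move=> _ [x Dx <-]; exact: flip_nozzle.
by apply: measurable_funTS; exact: measurable_flip_snd.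
Qed.

Lemma sq_int_flip u : sqi u -> sqi (fun x => u (flip_snd x)).
Proof.
move=> [mu_ iu]; split; first exact: measurable_flip_nozzle.
apply: lt_integrable => //.
- by apply: measurable_funX; exact: measurable_flip_nozzle.
- by move=> x _; exact: sqr_ge0.
- rewrite (integral_flip_nozzle (k := fun x => u x ^+ 2)).
  + exact: (integrable_lt mD iu).
  + exact: measurable_funX.
  + by move=> x; exact: sqr_ge0.
Qed.

Let flip_itv r : flip @^-1` `]h0 r, h1 r[ = `]h0 r, h1 r[%classic.
Proof.
by apply/seteqP; split => t /=; rewrite !in_itv /= h01 /flip => /andP[a b]; apply/andP; split; lra.
Qed.

Lemma bdry_measurable_flip w : bmeas w -> bmeas (fun x => w (flip_snd x)).
Proof.
have lat r (k : R -> R) : measurable_fun `]h0 r, h1 r[%classic k ->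
    measurable_fun `]h0 r, h1 r[%classic (fun t => k (1 - t)).
  move=> mk; apply: (measurable_comp (F := `]h0 r, h1 r[%classic) _ _ mk) => //.
    by move=> _ [t It <-]; move: It; rewrite -{1}flip_itv.
  by apply: measurable_funTS; exact: measurable_flip.
move=> [m1 m2 m3 m4]; split; rewrite /flip_snd /=.
- by apply: eq_measurable_fun m2 => t _; rewrite h01.
- by apply: eq_measurable_fun m1 => t _; rewrite h01 subKr.
- exact: (lat _ (fun t => w (- N, t))).
- exact: (lat _ (fun t => w (N, t))).
Qed.

Lemma bdry_norm2_flip w : bmeas w -> bnorm (fun x => w (flip_snd x)) = bnorm w.
Proof.
have lat r (k : R -> R) : measurable_fun `]h0 r, h1 r[%classic k ->
    (\int[leb]_(t in `]h0 r, h1 r[) (k (1 - t) ^+ 2)%:E =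
     \int[leb]_(t in `]h0 r, h1 r[) (k t ^+ 2)%:E)%E.
  move=> mk; rewrite -[in LHS]flip_itv.
  apply: (ge0_integral_flip _ (f := fun t => (k t ^+ 2)%:E)) => //.
    by apply/measurable_EFinP; exact: measurable_funX.
  by move=> t _; rewrite lee_fin sqr_ge0.
move=> [m1 m2 m3 m4]; rewrite /bdry_norm2.
congr (_ + _ + _)%E; [|exact: (lat _ (fun t => w (- N, t)) m3)|exact: (lat _ (fun t => w (N, t)) m4)].
by rewrite addeC; congr (_ + _)%E; apply: eq_integral => t _; rewrite /flip_snd /= h01 ?subKr.
Qed.

Variables (Q : R) (bd : R * R -> R).
Hypotheses (Q0 : 0 < Q) (bdm : bmeas bd).
Hypothesis bd_sym : bdry_forall h0 h1 N (fun x => bd (flip_snd x) = Q - bd x).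

(** The symmetry of the variational problem: it preserves the energy because [gF (Q - s) = gF s],
    and the boundary data by [bd_sym]. *)
Definition mirror u x := Q - u (flip_snd x).
Definition mirrorG G x := (- (G (flip_snd x)).1, (G (flip_snd x)).2).

Lemma trace_approx_mirror u G e v v1 v2 : sqi u -> sq_int_pair h0 h1 N G ->
  trace_approx h0 h1 N u G bd e v v1 v2 ->
  trace_approx h0 h1 N (mirror u) (mirrorG G) bd e (mirror v)
    (fun x => - v1 (flip_snd x)) (fun x => v2 (flip_snd x)).
Proof.
have [c Dc] := trunc_nozzle_bounded ch0 ch1 N0.
move=> su [s1 s2] [cv gv bv].
have cm : C1 (mirror v) (fun x => - v1 (flip_snd x)) (fun x => v2 (flip_snd x)).
  by apply: eq_C1 (C1_sub (C1_cst Q) (C1_flip_snd cv)) => x; rewrite ?sub0r ?opprK.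
split => //.
- apply: le_lt_trans gv; rewrite /Rintegral.
  rewrite -(integral_flip_nozzle (k := gap u G v v1 v2)).
  + rewrite le_eqVlt; apply/orP; left; apply/eqP; congr fine; apply: eq_integral => x _.
    by rewrite /gap /mirror /mirrorG /=; congr _%:E; ring.
  + by have := integrable_measurable (integrable_gap mD Dc su s1 s2 cv).
  + by move=> x; rewrite !addr_ge0 ?sqr_ge0.
- apply: le_lt_trans bv; have cb w := @continuous_bdry_measurable R h0 h1 N ch0 ch1 w.
  have mw : bmeas (fun x => v x - bd x) by apply: bdry_measurable_sub => //; apply: cb; case: cv.
  rewrite -(bdry_norm2_flip mw); apply: bdry_norm2_le.
  + by apply: bdry_measurable_sub => //; apply: cb; case: cm.
  + exact: bdry_measurable_flip mw.
  + have k x : bd (flip_snd x) = Q - bd x -> `|mirror v x - bd x| <= `|v (flip_snd x) - bd (flip_snd x)|.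
      move=> E; rewrite (_ : v (flip_snd x) - bd (flip_snd x) = - (mirror v x - bd x)) ?normrN//.
      by rewrite E /mirror; ring.
    by case: bd_sym => b1 b2 b3 b4; split => t ht; apply: k; [exact: b1|exact: b2|exact: b3|exact: b4].
Qed.

Lemma traced_mirror u G : traced h0 h1 N u G bd -> traced h0 h1 N (mirror u) (mirrorG G) bd.
Proof.
move=> [su [s1 s2] app].
have [c Dc] := trunc_nozzle_bounded ch0 ch1 N0.
split.
- have sQ : sqi (fun=> Q) by apply: (continuous_sq_int mD Dc) => x; exact: cvg_cst.
  exact (sq_int_sub mD sQ (sq_int_flip su)).
- split; last exact: sq_int_flip s2.
  by apply: (eq_sq_int mD _ (sq_int_scale mD (-1) (sq_int_flip s1))) => x _; rewrite mulN1r.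
- move=> e /app[v [v1 [v2 A]]]; do 3 eexists.
  exact: (trace_approx_mirror su (conj s1 s2) A).
Qed.

Lemma energy_mirror u G : sqi u -> sq_int_pair h0 h1 N G ->
  energy h0 h1 N Q (mirror u) (mirrorG G) = energy h0 h1 N Q u G.
Proof.
move=> [mu_ _] [[m1 _] [m2 _]].
rewrite /energy -(integral_flip_nozzle (k := fun x => ((G x).1 ^+ 2 + (G x).2 ^+ 2) / 2 + F Q (u x))).
- apply: eq_integral => x _; rewrite /mirror /mirrorG /= !F_gF// gF_sym// sqrrN //.
- apply: measurable_funD.
    apply: measurable_funM; last exact: measurable_cst.
    by apply: measurable_funD; exact: measurable_funX.
  rewrite (_ : (fun x => F Q (u x)) = (fun x => gF Q (u x) ^+ 2 / 2)); last first.
    by apply/funext => x; rewrite F_gF.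
  apply: measurable_funM; last exact: measurable_cst.
  by apply: measurable_funX; exact: measurable_comp_cont (continuous_gF Q0) mu_.
- by move=> x; rewrite F_gF// addr_ge0// mulr_ge0 ?invr_ge0// ?addr_ge0 ?sqr_ge0.
Qed.

(** The mirror image has the same trace and the same energy as [psi], so uniqueness identifies the
    two. *)
Lemma minimizer_mirror g psi Gg G : is_the_minimizer h0 h1 N Q g psi ->
  traced h0 h1 N (fun x => psi x - g x) Gg (fun=> 0) -> traced h0 h1 N psi G bd ->
  {ae leb2, forall x, D x -> mirror psi x = psi x}.
Proof.
move=> minpsi tg tpsi; have [su sG _] := tpsi; have tm := traced_mirror tpsi.
have le1 : `|1 : R| <= 1 by rewrite normr1.
have leN1 : `|-1 : R| <= 1 by rewrite normrN1.
have td := traced_lin ch0 ch1 N0 le1 leN1 bdm bdm tm tpsi.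
have bm0 : bmeas (fun=> 0) by split; exact: measurable_cst.
rewrite (_ : (fun x => 1 * bd x + -1 * bd x) = (fun=> 0)) in td; last first.
  by apply/funext => x; ring.
have tt := traced_lin ch0 ch1 N0 le1 le1 bm0 bm0 td tg.
rewrite (_ : (fun x => 1 * 0 + 1 * 0) = (fun=> 0)) in tt; last first.
  by apply/funext => x; rewrite !mulr0 addr0.
rewrite (_ : (fun x => 1 * (1 * mirror psi x + -1 * psi x) + 1 * (psi x - g x)) =
  (fun x => mirror psi x - g x)) in tt; last by apply/funext => x; ring.
have wm := traced_weak_gradient ch0 ch1 N0 tm.
apply: (competitor_ae ch0 ch1 N0 Q0 minpsi (traced_weak_gradient ch0 ch1 N0 tpsi) _ wm).
  by split; [eexists; exact: wm|apply/(has_traceP ch0 ch1 N0); eexists; exact: tt].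
by rewrite energy_mirror.
Qed.

Let half_sum (s q : R) : 2^-1 * s + 2^-1 * (q - s) = q / 2.
Proof. by rewrite -mulrDr addrC subrK mulrC. Qed.

(** For the cut at height 1/2 the approximants must equal [Q / 2] exactly on the axis, which
    averaging with the mirror image achieves. The gradient is averaged as well, since the given [G]
    need not be symmetric pointwise. *)
Lemma symmetric_approx g psi Gg G : is_the_minimizer h0 h1 N Q g psi ->
  traced h0 h1 N (fun x => psi x - g x) Gg (fun=> 0) -> traced h0 h1 N psi G bd ->
  exists G', traced h0 h1 N psi G' bd /\
    forall e, 0 < e -> exists p p1 p2, trace_approx h0 h1 N psi G' bd e p p1 p2 /\
      forall s, p (s, 2^-1) = Q / 2.
Proof.
move=> minpsi tg tpsi; have ae := minimizer_mirror minpsi tg tpsi.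
have [c Dc] := trunc_nozzle_bounded ch0 ch1 N0.
have [su sG app] := tpsi; have tm := traced_mirror tpsi; have [sm sGm _] := tm.
have le2 : `|2^-1 : R| <= 1 by rewrite ger0_norm; lra.
have [sh sGh _] := traced_lin ch0 ch1 N0 le2 le2 bdm bdm tpsi tm.
set G' := (fun x => (_, _)) in sGh.
have A e : 0 < e -> exists p p1 p2, trace_approx h0 h1 N psi G' bd e p p1 p2 /\
      forall s, p (s, 2^-1) = Q / 2.
  move=> e0; have e4 : 0 < e / 4 by rewrite divr_gt0.
  have [v [v1 [v2 B]]] := app _ e4; have B' := trace_approx_mirror su sG B.
  have := trace_approx_lin ch0 ch1 N0 le2 le2 su sG sm sGm bdm bdm B B'.
  rewrite (_ : 2 * (e / 4) + 2 * (e / 4) = e); last by field.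
  rewrite (_ : (fun x => 2^-1 * bd x + 2^-1 * bd x) = bd); last by apply/funext => x; field.
  move=> [cp gp bp]; do 3 eexists; split; first split; [exact: cp| |exact: bp|].
    (* The average of [psi] and its mirror image is known to be [psi] only almost everywhere, which
       suffices under the integral. *)
    apply: le_lt_trans gp; rewrite le_eqVlt; apply/orP; left; apply/eqP.
    have [s1 s2] := sGh.
    rewrite /Rintegral; congr fine; apply: ae_eq_integral => //.
    - apply/measurable_EFinP; exact: (integrable_measurable (integrable_gap mD Dc su s1 s2 cp)).
    - apply/measurable_EFinP; exact: (integrable_measurable (integrable_gap mD Dc sh s1 s2 cp)).
    - by apply: ae_imply ae => x h Dx; rewrite /gap h// /=; congr (_ ^+ 2 + _ + _)%:E; field.
  move=> s; rewrite /mirror /flip_snd /= (_ : 1 - 2^-1 = 2^-1); last by field.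
  exact: half_sum.
exists G'; split => //; split => // e /A[p [p1 [p2 [B _]]]]; by exists p, p1, p2.
Qed.

End SymmetricNozzle.

(** * Boundary data *)

Section BoundaryData.
Context {R : realType}.
Implicit Types (x : R * R) (s t y : R).
Variables (h0 h1 : R -> R) (N Q : R) (phibar : R -> R -> R).
Hypothesis h01 : forall t, h0 t < h1 t.
Hypotheses (Q0 : 0 < Q) (phiP : forall d : R, 0 < d <= 1 -> is_phibar Q d (phibar d)).
Hypotheses (wl : h1 (- N) - h0 (- N) <= 1) (wr : h1 N - h0 N <= 1).
Local Notation bd := (boundary_data h0 h1 Q phibar).

Lemma boundary_data_lower t : bd (t, h0 t) = 0.
Proof. by rewrite /boundary_data /= eqxx. Qed.

Lemma boundary_data_upper t : bd (t, h1 t) = Q.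
Proof. by rewrite /boundary_data /= gt_eqF// eqxx. Qed.

Lemma boundary_data_inner s t : h0 s < t < h1 s -> bd (s, t) = phibar (h1 s - h0 s) (t - h0 s).
Proof. by move=> /andP[a b]; rewrite /boundary_data /= gt_eqF// lt_eqF. Qed.

Let width s : h1 s - h0 s <= 1 -> 0 < h1 s - h0 s <= 1.
Proof. by rewrite subr_gt0 h01. Qed.

Lemma boundary_data_measurable : bdry_measurable h0 h1 N bd.
Proof.
have lat s : h1 s - h0 s <= 1 ->
    measurable_fun `]h0 s, h1 s[%classic (fun t => bd (s, t)).
  move=> w1; have [_ [_ [phi1 [_ d1]]] _ _ _] := phiP (width w1).
  apply: (@eq_measurable_fun _ _ _ _ _ (fun t => phibar (h1 s - h0 s) (t - h0 s))).
    by move=> t; rewrite inE /= in_itv /= => ht; rewrite boundary_data_inner.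
  apply: open_continuous_measurable_fun; first exact: interval_open.
  move=> t; rewrite inE /= in_itv /= => /andP[a b].
  apply: (@continuous_comp _ _ _ (fun t => t - h0 s) (phibar (h1 s - h0 s))).
    by apply: cvgB; [exact: cvg_id|exact: cvg_cst].
  apply: (is_derive_continuous (d1 _ _)).
  by rewrite subr_gt0 a ltrD2r.
split; [| |exact: lat|exact: lat].
- have -> : (fun t => bd (t, h0 t)) = (fun=> 0) by apply/funext => t; exact: boundary_data_lower.
  exact: measurable_cst.
- have -> : (fun t => bd (t, h1 t)) = (fun=> Q) by apply/funext => t; exact: boundary_data_upper.
  exact: measurable_cst.
Qed.

Lemma boundary_data_le_barrier (T : R) (cut : bool) : T <= 1 ->
  (forall t, h0 t < T) ->
  (forall t, chi T cut (h1 t) = 0 \/ Q <= barrier Q (h1 t)) ->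
  (forall s t, h1 s - h0 s <= 1 -> h0 s < t < h1 s ->
     chi T cut t = 0 \/ phibar (h1 s - h0 s) (t - h0 s) <= barrier Q t) ->
  bdry_forall h0 h1 N (fun x => 0 <= bd x /\ (chi T cut x.2 = 0 \/ bd x <= barrier Q x.2)).
Proof.
move=> T1 hT top inner.
have lat s t : h1 s - h0 s <= 1 -> h0 s < t < h1 s ->
    0 <= bd (s, t) /\ (chi T cut t = 0 \/ bd (s, t) <= barrier Q t).
  move=> w1 ht; rewrite boundary_data_inner//; split; last exact: inner.
  have [+ _ _ _ _] := phiP (width w1) => /(_ (t - h0 s)).
  by case/andP: ht => a b; case/(_ _)/andP => //; rewrite subr_ge0 ltW//= lerD2r ltW.
split => t ht; rewrite /= ?boundary_data_lower ?boundary_data_upper; [| |exact: lat|exact: lat].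
- split => //; right; apply: barrier_ge0 => //; exact: ltW (lt_le_trans (hT t) T1).
- by split; [exact: ltW|exact: top].
Qed.

Lemma boundary_data_sym : (forall t, h1 t = 1 - h0 t) ->
  bdry_forall h0 h1 N (fun x => bd (flip_snd x) = Q - bd x).
Proof.
move=> sym; have lat s t : h1 s - h0 s <= 1 -> h0 s < t < h1 s -> bd (s, 1 - t) = Q - bd (s, t).
  move=> w1 /andP[a b]; have := h01 s; have := sym s => e l.
  rewrite !boundary_data_inner ?a ?b//; last by apply/andP; split; lra.
  rewrite -(phibar_sym Q0 (width w1) (phiP (width w1))); last by apply/andP; split; lra.
  by congr phibar; lra.
split => t ht; rewrite /flip_snd /=; [| |exact: lat|exact: lat].
- by rewrite -sym boundary_data_lower boundary_data_upper subr0.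
- by rewrite {1}sym subKr boundary_data_lower boundary_data_upper subrr.
Qed.

End BoundaryData.

Lemma C2holder_continuous (R : realType) (alpha : R) (h : R -> R) :
  C2holder alpha h -> continuous h.
Proof. by case=> d _ _ t; apply: differentiable_continuous; exact/derivable1_diffP. Qed.

Theorem proposition5p15 (R : realType) (alpha Lm Lp a b : R)
  (h0 h1 : R -> R) (hnozzle : is_nozzle alpha Lm Lp a b h0 h1)
  (Q : R) (hQ : 0 < Q)
  (phibar : R -> R -> R)
  (hphibar : forall d : R, 0 < d <= 1 -> is_phibar Q d (phibar d))
  (N : R) (hN : 0 < N)
  (hwidthl : h1 (- N) - h0 (- N) <= 1) (hwidthr : h1 N - h0 N <= 1)
  (gN : R * R -> R)
  (hgN : H1 (trunc_nozzle h0 h1 N) gN)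
  (hgN_trace : has_trace h0 h1 N gN (boundary_data h0 h1 Q phibar))
  (psiN : R * R -> R)
  (hpsiN : is_the_minimizer h0 h1 N Q gN psiN)
  (xbar : R) (hxbar : - N < xbar < N) (hh0 : h0 xbar < 0)
  (hcond : (forall x1 : R, h1 x1 = 1 - h0 x1) \/ (forall x1 : R, h1 x1 = 1)) :
  (0 <= htilde0 h0 h1 psiN xbar)%E.
Proof.
have [_ _ [/C2holder_continuous ch0 /C2holder_continuous ch1] h01 _] := hnozzle.
have [[[_ trpsi] _] _ _] := hpsiN.
have [Gg tg] := (has_traceP ch0 ch1 hN _ _).1 trpsi.
have [GN tN] := (has_traceP ch0 ch1 hN _ _).1 hgN_trace.
have bdm := boundary_data_measurable h01 hphibar hwidthl hwidthr.
have bm0 : bdry_measurable h0 h1 N (fun=> 0) by split; exact: measurable_cst.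
have le1 : `|1 : R| <= 1 by rewrite normr1.
have tpsi := traced_lin ch0 ch1 hN le1 le1 bm0 bdm tg tN.
rewrite (_ : (fun x => 1 * (psiN x - gN x) + 1 * gN x) = psiN) in tpsi; last first.
  by apply/funext => x; ring.
rewrite (_ : (fun x => 1 * 0 + 1 * _) = boundary_data h0 h1 Q phibar) in tpsi; last first.
  by apply/funext => x; rewrite mulr0 add0r mul1r.
have bd0 t : - N < t < N -> boundary_data h0 h1 Q phibar (t, h0 t) = 0.
  by move=> _; exact: boundary_data_lower.
case: hcond => hc.
(* Case (i): the line [x.2 = 1/2] runs inside the nozzle and the correction is truncated there, so
   that on the upper wall, where the datum is [Q], [chi] is 0. *)
- have half t : h0 t < 2^-1 <= h1 t by have := h01 t; rewrite hc; lra.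
  have half1 : (2^-1 : R) <= 1 by lra.
  have half0 : (0 : R) < 2^-1 by lra.
  have wall t : - N < t < N -> h0 t < 2^-1 <= h1 t by [].
  have chiD x : trunc_nozzle h0 h1 N x -> chi 2^-1 true x.2 = (x.2 < 2^-1)%R%:R by [].
  have bdsym := boundary_data_sym h01 hQ hphibar hwidthl hwidthr hc.
  have [G [tG appG]] := symmetric_approx ch0 ch1 hN hc hQ bdm bdsym hpsiN tg tpsi.
  have app e : 0 < e -> exists p p1 p2,
      trace_approx h0 h1 N psiN G (boundary_data h0 h1 Q phibar) e p p1 p2 /\
      (true -> forall s, p (s, 2^-1) = barrier Q 2^-1).
    move=> /appG[p [p1 [p2 [A pT]]]]; exists p, p1, p2; split => // _ s.
    by rewrite pT barrier_pos ?ltW// /poiseuille; field.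
  have bdok : bdry_forall h0 h1 N (fun x => 0 <= boundary_data h0 h1 Q phibar x /\
      (chi 2^-1 true x.2 = 0 \/ boundary_data h0 h1 Q phibar x <= barrier Q x.2)).
    apply: boundary_data_le_barrier => // [t|t|s t w1 /andP[ht th]].
    + by have /andP[] := half t.
    + by left; rewrite /chi (_ : _ < _ = false)//; apply/negbTE; rewrite -leNgt; have /andP[] := half t.
    + have [t2|t2] := leP 2^-1 t; first by left; rewrite /chi (_ : _ < _ = false)// ltNge t2.
      right; have dw : 0 < h1 s - h0 s <= 1 by rewrite subr_gt0 h01.
      have e := hc s.
      (* Width at most 1 together with [h1 = 1 - h0] gives [h0 s >= 0], so on the lateral sides the
         barrier is [P], and the shift [(1 - d) / 2] of [phibar_le_middle] is [h0 s]. *)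
      have t0 : 0 <= t by lra.
      rewrite barrier_pos//.
      have := phibar_le_middle hQ dw (hphibar _ dw) (y := t - h0 s).
      rewrite (_ : t - h0 s + _ = t); last by rewrite e; field.
      by apply; apply/andP; split; lra.
  have [sp sG _] := tG.
  exact: (htilde0_ge0 ch0 ch1 hN hQ sp sG bdm half1 wall chiD bdok bd0 app half0 hpsiN tg).
(* Case (ii): [T] is the height of the upper wall, so [x.2 < T] throughout the nozzle and the
   correction is not truncated. *)
- have wall t : - N < t < N -> h0 t < 1 <= h1 t by move=> _; have := h01 t; rewrite !hc lexx andbT.
  have chiD x : trunc_nozzle h0 h1 N x -> chi 1 false x.2 = (x.2 < 1)%R%:R.
    by move=> [/andP[_]]; rewrite hc => ->.
  have [sp sG approx] := tpsi.
  have app e : 0 < e -> exists p p1 p2,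
      trace_approx h0 h1 N psiN (fun x => (1 * (Gg x).1 + 1 * (GN x).1, 1 * (Gg x).2 + 1 * (GN x).2)) (boundary_data h0 h1 Q phibar) e p p1 p2 /\
      (false -> forall s, p (s, 1) = barrier Q 1).
    by move=> /approx[p [p1 [p2 A]]]; exists p, p1, p2.
  have bdok : bdry_forall h0 h1 N (fun x => 0 <= boundary_data h0 h1 Q phibar x /\
      (chi 1 false x.2 = 0 \/ boundary_data h0 h1 Q phibar x <= barrier Q x.2)).
    apply: boundary_data_le_barrier => // [t|t|s t w1 /andP[ht th]].
    + by have := h01 t; rewrite hc.
    + by right; rewrite hc barrier_pos// poiseuille1.
    + right; have dw : 0 < h1 s - h0 s <= 1 by rewrite subr_gt0 h01.
      have e := hc s.
      (* Again [h0 s >= 0], now from [1 - h0 s <= 1], and the shift [1 - d] of [phibar_le_top] is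
         [h0 s]. *)
      have t0 : 0 <= t by lra.
      rewrite barrier_pos//.
      have := phibar_le_top hQ dw (hphibar _ dw) (y := t - h0 s).
      rewrite (_ : t - h0 s + _ - _ = t); last by rewrite e; ring.
      by apply; apply/andP; split; lra.
  exact: (htilde0_ge0 ch0 ch1 hN hQ sp sG bdm (lexx 1) wall chiD bdok bd0 app ltr01 hpsiN tg).
Qed.
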